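(* Let $\varsigma\in M^1(\mathbb{Z}^n\times\mathbb{T}^n)$ and $g_1,g_2\in M^1(\mathbb{Z}^n)$. Then the localization operator $\mathfrak{L}^{g_1,g_2}_\varsigma$ is in $\mathcal{B}(\ell^2(\mathbb{Z}^n))$ and $$\|\mathfrak{L}^{g_1,g_2}_\varsigma\|_{\mathcal{B}(\ell^2(\mathbb{Z}^n))}\le\|\varsigma\|_{M^1(\mathbb{Z}^n\times\mathbb{T}^n)}\,\|g_1\|_{M^1(\mathbb{Z}^n)}\,\|g_2\|_{M^1(\mathbb{Z}^n)}.$$
   Context: $\mathbb{T}^n$ is the torus with normalized Haar measure $dw$; $\mathbb{Z}^n\times\mathbb{T}^n$ carries the product of counting measure and $dw$. $T_mf(k)=f(k-m)$, $M_wf(k)=e^{2\pi i w\cdot k}f(k)$, and the short-time Fourier transform is $V_gf(m,w)=\langle f,M_wT_mg\rangle=\sum_{k\in\mathbb{Z}^n}f(k)\overline{g(k-m)}e^{-2\pi i w\cdot k}$. $\mathcal{S}(\mathbb{Z}^n)$ is the space of rapidly decreasing functions on $\mathbb{Z}^n$, $\mathcal{S}'(\mathbb{Z}^n)$ its dual (tempered distributions); $\mathcal{S}(\mathbb{Z}^n\times\mathbb{T}^n)$ and $\mathcal{S}'(\mathbb{Z}^n\times\mathbb{T}^n)$ are the Schwartz functions and tempered distributions on the group $\mathbb{Z}^n\times\mathbb{T}^n$. Modulation spaces: fix a non-zero window $g\in\mathcal{S}(\mathbb{Z}^n)$; for $1\le p\le\infty$, $M^p(\mathbb{Z}^n)=\{f\in\mathcal{S}'(\mathbb{Z}^n):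 V_gf\in L^p(\mathbb{Z}^n\times\mathbb{T}^n)\}$ with $\|f\|_{M^p(\mathbb{Z}^n)}=\|V_gf\|_{L^p}$. Similarly, fix a non-zero $g\in\mathcal{S}(\mathbb{Z}^n\times\mathbb{T}^n)$ and set $$V_gF(m,\omega,\xi,k)=\sum_{j\in\mathbb{Z}^n}\int_{\mathbb{T}^n}e^{-2\pi i j\xi}e^{-2\pi i\eta k}F(j,\eta)\overline{g(j-m,\eta-\omega)}\,d\eta,\quad m,k\in\mathbb{Z}^n,\ \omega,\xi\in\mathbb{T}^n;$$ $M^p(\mathbb{Z}^n\times\mathbb{T}^n)$ is the space of $F\in\mathcal{S}'(\mathbb{Z}^n\times\mathbb{T}^n)$ with $\|F\|_{M^p(\mathbb{Z}^n\times\mathbb{T}^n)}=\|V_gF\|_{L^p((\mathbb{Z}^n\times\mathbb{T}^n)\times(\mathbb{T}^n\times\mathbb{Z}^n))}<\infty$. Different windows give equivalent norms. Localization operator: $\mathfrak{L}^{g_1,g_2}_\varsigma f(k)=\sum_{m\in\mathbb{Z}^n}\int_{\mathbb{T}^n}\varsigma(m,w)V_{g_1}f(m,w)\,M_wT_mg_2(k)\,dw$, or in the weak sense $$\langle\mathfrak{L}^{g_1,g_2}_\varsigma f,h\rangle_{\ell^2(\mathbb{Z}^n)}=\sum_{m\in\mathbb{Z}^n}\int_{\mathbb{T}^n}\varsigma(m,w)\,V_{g_1}f(m,w)\,\overline{V_{g_2}h(m,w)}\,dw,\qquad f,h\in\ell^2(\mathbb{Z}^n).$$ $\mathcal{B}(X)$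 denotes the bounded linear operators on $X$ with operator norm.
   Formalization: The bound with constant 1 fails for arbitrary non-zero windows (scale a window down); it is stated with a constant C > 0 depending only on n and the windows, uniform in the symbol and g_1, g_2, with C = 1 whenever both windows have L^2 norm 1. *)

(* Defs.v *)
From HB Require Import structures.
From mathcomp Require Import all_boot all_order all_algebra.
From mathcomp Require Import complex.
From mathcomp Require Import all_classical all_reals all_analysis.

Set Implicit Arguments.
Unset Strict Implicit.
Unset Printing Implicit Defensive.

Import Order.TTheory GRing.Theory Num.Theory.
Import numFieldNormedType.Exports.

Local Open Scope classical_set_scope.
Local Open Scope ring_scope.
Local Open Scope complex_scope.

Definition Zn (n : nat) := 'rV[int]_n.

HB.instance Definition _ n := GRing.Zmodule.on (Zn n).
HB.instance Definition _ n := Countable.on (Zn n).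
HB.instance Definition _ n := isPointed.Build (Zn n) 0.
HB.instance Definition _ n := @isMeasurable.Build default_measure_display
  (Zn n) discrete_measurable discrete_measurable0
  discrete_measurableC discrete_measurableU.

Section counting_Zn.
Variables (R : realType) (n : nat).

(* A separate constant, because [counting] only carries a sigma-finite
   structure on nat. *)
Definition muZ : set (Zn n) -> \bar R := @counting (Zn n) R.

HB.instance Definition _ := Measure.on muZ.

Lemma sigma_finite_muZ : sigma_finite [set: Zn n] muZ.
Proof.
exists (fun i => [set x : Zn n | pickle x = i]).
  by apply/seteqP; split => // x _; exists (pickle x).
move=> i; split => //.
rewrite /muZ /counting /= asboolT ?ltry//.
have [[x xi]|noi] := pselect (exists x : Zn n, pickle x = i); last first.
  rewrite (_ : [set _ | _] = set0); first exact: finite_set0.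
  by apply/seteqP; split => // x xi; case: noi; exists x.
apply: sub_finite_set (finite_set1 x) => y /= yi.
by apply: (pcan_inj pickleK); rewrite yi.
Qed.

HB.instance Definition _ :=
  @Measure_isSigmaFinite.Build _ _ _ muZ sigma_finite_muZ.

End counting_Zn.

(* A point of the torus is given by any of its lifts to R^n, and a function on
   the torus by a function of the lift.  Integration takes place over the
   fundamental domain [0, 1]^n, through the probability [haar] below. *)
Definition Tn (R : realType) (n : nat) := 'rV[R]_n.

Section torus_measurable.
Variables (R : realType) (n : nat).

HB.instance Definition _ := NormedModule.on (Tn R n).

Let coord (i : 'I_n) (x : Tn R n) : R := x ord0 i.

Let meas0 : g_sigma_preimage coord set0.
Proof. exact: sigma_algebra0. Qed.

Let measC A : g_sigma_preimage coord A -> g_sigma_preimage coord (~` A).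
Proof. exact: sigma_algebraC. Qed.

Let measU (F : (set (Tn R n))^nat) :
  (forall i, g_sigma_preimage coord (F i)) ->
  g_sigma_preimage coord (\bigcup_i F i).
Proof. exact: sigma_algebra_bigcup. Qed.

HB.instance Definition _ := @isMeasurable.Build
  (measure_tuple_display default_measure_display) (Tn R n)
  (g_sigma_preimage coord) meas0 measC measU.

End torus_measurable.

Section haar_measure.
Variable R : realType.

Definition consT n (z : measurableTypeR R * Tn R n) : Tn R n.+1 :=
  \row_(i < n.+1) if unlift ord0 i is Some j then z.2 ord0 j else z.1.

Lemma measurable_coordT n (i : 'I_n) :
  measurable_fun setT (fun x : Tn R n => x ord0 i).
Proof.
move=> _ A mA; apply: sub_sigma_algebra.
case: n i => [[] //|n i].
rewrite -bigcup_mkord_ord; exists i; first exact: ltn_ord.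
by exists A => //; rewrite inord_val.
Qed.

Lemma measurable_consT n : measurable_fun setT (@consT n).
Proof.
move=> _ A mA; rewrite setTI.
suff : g_sigma_preimage (fun (i : 'I_n.+1) (z : measurableTypeR R * Tn R n) => consT z ord0 i)
    `<=` measurable.
  apply; rewrite (@g_sigma_preimage_comp _ _ _ (Tn R n.+1)
    (fun i x => x ord0 i) _ (@consT n)).
  by exists A => //; rewrite setTI.
apply: smallest_sub; first exact: sigma_algebra_measurable.
rewrite -bigcup_mkord_ord; apply: bigcup_sub => i Ii.
move=> B [D mD <-].
suff : measurable_fun setT (fun z : measurableTypeR R * Tn R n => consT z ord0 (inord i)).
  by apply.
rewrite /consT; under eq_fun do rewrite mxE.
case: unliftP => [j _|_]; last exact: measurable_fst.
apply: (measurableT_comp (measurable_coordT j)); exact: measurable_snd.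
Qed.

HB.instance Definition _ n :=
  @isMeasurableFun.Build _ _ _ _ (@consT n) (@measurable_consT n).

Fixpoint haar (n : nat) : probability (Tn R n) R :=
  match n with
  | 0 => \d_ (0 : Tn R 0)
  | n.+1 => distribution (uniform_prob (@ltr01 R) \x haar n)%E
      [the {mfun _ >-> Tn R n.+1} of @consT n]
  end.

End haar_measure.

Section complex_Lp.
Context d (T : measurableType d) (R : realType).
Variable mu : {measure set T -> \bar R}.
Implicit Types f : T -> R[i].

Definition cmod (z : R[i]) : R := complex.Re `|z|.

Definition cmeasurable f :=
  measurable_fun setT (fun x => complex.Re (f x)) /\
  measurable_fun setT (fun x => complex.Im (f x)).

Definition cintegrable f :=
  mu.-integrable setT (fun x => (complex.Re (f x))%:E) /\
  mu.-integrable setT (fun x => (complex.Im (f x))%:E).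

Definition cintegral f : R[i] :=
  Rintegral mu setT (fun x => complex.Re (f x)) +i*
  Rintegral mu setT (fun x => complex.Im (f x)).

Definition normLp (p : \bar R) f : \bar R :=
  Lnorm mu p (fun x => (cmod (f x))%:E).

Definition inLp (p : \bar R) f := cmeasurable f /\ (normLp p f < +oo)%E.

End complex_Lp.

Section statement_notions.
Variables (R : realType) (n : nat).

Local Notation C := R[i].
Local Notation Z := (Zn n).
Local Notation T := (Tn R n).

Local Notation muZ := (@muZ R n).

Definition muZT : {measure set (Z * T) -> \bar R} := (muZ \x haar R n)%E.

Definition muZTTZ : {measure set (Z * T * T * Z) -> \bar R} :=
  (muZ \x haar R n \x haar R n \x muZ)%E.

Definition intT (l : Z) : T := \row_i (l ord0 i)%:~R.

Definition dot (w : T) (k : Z) : R := \sum_i w ord0 i * (k ord0 i)%:~R.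

(* exp(2 pi i t) *)
Definition e2pi (t : R) : C := cos (2 * pi * t) +i* sin (2 * pi * t).

Definition translation (m : Z) (f : Z -> C) : Z -> C := fun k => f (k - m).

Definition modulation (w : T) (f : Z -> C) : Z -> C :=
  fun k => e2pi (dot w k) * f k.

Definition znorm (k : Z) : R := \sum_i `|(k ord0 i)%:~R|.

Definition seminormZ (N : nat) (f : Z -> C) : \bar R :=
  ereal_sup (range (fun k => ((1 + znorm k) ^+ N * cmod (f k))%:E)).

Definition schwartzZ (f : Z -> C) := forall N, (seminormZ N f < +oo)%E.

(* The seminorms increase with [N]: continuity is a bound by one of them.
   The values of [u] outside the Schwartz space are irrelevant. *)
Definition temperedZ (u : (Z -> C) -> C) :=
  (forall (a : C) f h, schwartzZ f -> schwartzZ h ->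
     u (fun k => a * f k + h k) = a * u f + u h) /\
  exists (N : nat) (c : R), forall f, schwartzZ f ->
    ((cmod (u f))%:E <= c%:E * seminormZ N f)%E.

(* The function on Z^n with which the tempered distribution [u] is identified *)
Definition funZ (u : (Z -> C) -> C) : Z -> C :=
  fun k => u (fun j => (j == k)%:R).

Definition stft (g f : Z -> C) (z : Z * T) : C :=
  cintegral muZ (fun k => f k * conjc (modulation z.2 (translation z.1 g) k)).

(* V_g u (m, w) = <u, M_w T_m g>, the pairing being antilinear on the right *)
Definition stft_dist (g : Z -> C) (u : (Z -> C) -> C) (z : Z * T) : C :=
  u (fun k => conjc (modulation z.2 (translation z.1 g) k)).

Definition modulZ (g : Z -> C) (p : \bar R) (u : (Z -> C) -> C) :=
  temperedZ u /\ inLp muZT p (stft_dist g u).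

Definition normMZ (g : Z -> C) (p : \bar R) (u : (Z -> C) -> C) : \bar R :=
  normLp muZT p (stft_dist g u).

Definition partialR (s : seq 'I_n) (h : T -> R) : T -> R :=
  foldr (fun i f => 'D_(delta_mx ord0 i : T) f) h s.

Definition partialC (s : seq 'I_n) (h : T -> C) (x : T) : C :=
  partialR s (fun y => complex.Re (h y)) x +i*
  partialR s (fun y => complex.Im (h y)) x.

Definition smoothR (h : T -> R) := forall s : seq 'I_n,
  continuous (partialR s h) /\
  forall i x, derivable (partialR s h) x (delta_mx ord0 i : T).

Definition smoothC (h : T -> C) :=
  smoothR (fun x => complex.Re (h x)) /\ smoothR (fun x => complex.Im (h x)).

Definition seminormZT (N : nat) (F : Z * T -> C) : \bar R :=
  ereal_sup [set y | exists (s : seq 'I_n) (j : Z) (x : T), (size s <= N)%N /\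
    y = ((1 + znorm j) ^+ N * cmod (partialC s (fun t => F (j, t)) x))%:E].

Definition schwartzZT (F : Z * T -> C) :=
  [/\ forall j x l, F (j, x + intT l) = F (j, x),
      forall j, smoothC (fun x => F (j, x)) &
      forall N, (seminormZT N F < +oo)%E].

Definition temperedZT (u : (Z * T -> C) -> C) :=
  (forall (a : C) F H, schwartzZT F -> schwartzZT H ->
     u (fun z => a * F z + H z) = a * u F + u H) /\
  exists (N : nat) (c : R), forall F, schwartzZT F ->
    ((cmod (u F))%:E <= c%:E * seminormZT N F)%E.

(* [u] is the distribution defined by the function [s] *)
Definition represented (u : (Z * T -> C) -> C) (s : Z * T -> C) :=
  cmeasurable s /\
  forall F, schwartzZT F ->
    cintegrable muZT (fun z => s z * F z) /\
    u F = cintegral muZT (fun z => s z * F z).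

(* For [u] represented by F, this is the sum over j and integral over eta of
   e^(-2 pi i j xi) e^(-2 pi i eta k) F(j, eta) conj(G(j - m, eta - omega)),
   where z = (j, eta). *)
Definition stftZT (G : Z * T -> C) (u : (Z * T -> C) -> C)
    (y : Z * T * T * Z) : C :=
  let: (m, omega, xi, k) := y in
  u (fun z => e2pi (- dot xi z.1) * e2pi (- dot z.2 k) *
              conjc (G (z.1 - m, z.2 - omega))).

Definition modulZT (G : Z * T -> C) (p : \bar R) (u : (Z * T -> C) -> C) :=
  temperedZT u /\ inLp muZTTZ p (stftZT G u).

Definition normMZT (G : Z * T -> C) (p : \bar R) (u : (Z * T -> C) -> C)
    : \bar R :=
  normLp muZTTZ p (stftZT G u).

Definition l2 (f : Z -> C) := inLp muZ 2%:E f.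

Definition norm2 (f : Z -> C) : \bar R := normLp muZ 2%:E f.

Definition inner (f h : Z -> C) : C :=
  cintegral muZ (fun k => f k * conjc (h k)).

Definition opnorm (L : (Z -> C) -> (Z -> C)) : \bar R :=
  ereal_sup [set norm2 (L f) | f in [set f | l2 f /\ (norm2 f <= 1)%E]].

(* [L] restricts to an element of B(l^2(Z^n)) *)
Definition bounded_operator (L : (Z -> C) -> (Z -> C)) :=
  [/\ forall f, l2 f -> l2 (L f),
      forall (a : C) f h, l2 f -> l2 h -> forall k,
        L (fun j => a * f j + h j) k = a * L f k + L h k &
      (opnorm L < +oo)%E].

Definition locop_kernel (s : Z * T -> C) (g1 g2 f : Z -> C) (k : Z)
    (z : Z * T) : C :=
  s z * stft g1 f z * modulation z.2 (translation z.1 g2) k.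

Definition locop (s : Z * T -> C) (g1 g2 f : Z -> C) : Z -> C :=
  fun k => cintegral muZT (locop_kernel s g1 g2 f k).

(* All the sums and integrals defining [locop s g1 g2] on l^2 converge
   absolutely. *)
Definition locop_converges (s : Z * T -> C) (g1 g2 : Z -> C) :=
  forall f, l2 f ->
    (forall z : Z * T, cintegrable muZ
       (fun k => f k * conjc (modulation z.2 (translation z.1 g1) k))) /\
    forall k, cintegrable muZT (locop_kernel s g1 g2 f k).

Definition weak_integrand (s : Z * T -> C) (g1 g2 f h : Z -> C) (z : Z * T) :=
  s z * stft g1 f z * conjc (stft g2 h z).

Definition locop_weak (s : Z * T -> C) (g1 g2 : Z -> C)
    (L : (Z -> C) -> (Z -> C)) :=
  forall f h, l2 f -> l2 h ->
    cintegrable muZT (weak_integrand s g1 g2 f h) /\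
    inner (L f) h = cintegral muZT (weak_integrand s g1 g2 f h).

End statement_notions.

Arguments muZ : clear implicits.
Arguments muZT : clear implicits.

(* Main.v *)
Require Import Defs.
From HB Require Import structures.
From mathcomp Require Import all_boot all_order all_algebra.
From mathcomp Require Import complex.
From mathcomp Require Import all_classical all_reals all_analysis.
From mathcomp Require Import measurable_realfun ring lra.

Set Implicit Arguments.
Unset Strict Implicit.
Unset Printing Implicit Defensive.

Import Order.TTheory GRing.Theory Num.Theory.
Import numFieldNormedType.Exports.

Local Open Scope classical_set_scope.
Local Open Scope ring_scope.
Local Open Scope complex_scope.

                                                               

                                                                            
                                                                           
                                                                          
                                                                               
                                                                                
                                                                               
                                                                            
                                                    

                                                                            
                                                                             
                                                                                 
                                                                             
                                                         

                                                                 

                                                                                 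
                                                                                  
                                                                            
                                                                               
                                                                                  
                                                                              
                      

                                                                                 
                                                                      
                                                                                 
                                                                               
                                                                                 
                                                                                 
                                                                                 
                                                           

                                   

Section cmod.
Variable R : realType.
Implicit Types z w : R[i].

Lemma cmodE z : cmod z = Num.sqrt (complex.Re z ^+ 2 + complex.Im z ^+ 2).
Proof. by case: z => a b; rewrite /cmod normc_def. Qed.

Lemma normc_cmod z : `|z| = (cmod z)%:C.
Proof. by rewrite /cmod; case: z => a b; rewrite normc_def. Qed.

Lemma realc_inj : injective (fun x : R => x%:C).
Proof. by move=> x y [] . Qed.

Lemma cmod_ge0 z : 0 <= cmod z.
Proof. by rewrite cmodE sqrtr_ge0. Qed.

Lemma cmodM z w : cmod (z * w) = cmod z * cmod w.
Proof. by apply: realc_inj; rewrite rmorphM /= -!normc_cmod normrM. Qed.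

Lemma cmodD z w : cmod (z + w) <= cmod z + cmod w.
Proof. by rewrite -lecR rmorphD /= -!normc_cmod ler_normD. Qed.

Lemma cmodN z : cmod (- z) = cmod z.
Proof. by rewrite /cmod normrN. Qed.

Lemma cmodB z w : cmod (z - w) <= cmod z + cmod w.
Proof. by rewrite -(cmodN w) cmodD. Qed.

Lemma cmod0 : cmod (0 : R[i]) = 0.
Proof. by rewrite /cmod normr0. Qed.

Lemma cmod1 : cmod (1 : R[i]) = 1.
Proof. by rewrite /cmod normr1. Qed.

Lemma cmod_eq0 z : (cmod z == 0) = (z == 0).
Proof. by rewrite -[RHS]normr_eq0 normc_cmod -(inj_eq realc_inj). Qed.

Lemma cmod_conj z : cmod (conjc z) = cmod z.
Proof. by rewrite !cmodE; case: z => a b /=; rewrite sqrrN. Qed.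

Lemma sqr_cmod z : cmod z ^+ 2 = complex.Re z ^+ 2 + complex.Im z ^+ 2.
Proof. by rewrite cmodE sqr_sqrtr // addr_ge0 ?sqr_ge0. Qed.

Lemma Re_le_cmod z : `|complex.Re z| <= cmod z.
Proof.
by rewrite -(@ler_pXn2r _ 2) ?nnegrE ?cmod_ge0// sqr_cmod real_normK ?num_real// lerDl sqr_ge0.
Qed.

Lemma Im_le_cmod z : `|complex.Im z| <= cmod z.
Proof.
by rewrite -(@ler_pXn2r _ 2) ?nnegrE ?cmod_ge0// sqr_cmod real_normK ?num_real// lerDr sqr_ge0.
Qed.

Lemma cmod_le_ReIm z : cmod z <= `|complex.Re z| + `|complex.Im z|.
Proof.
rewrite -(@ler_pXn2r _ 2) ?nnegrE ?cmod_ge0 ?addr_ge0// sqr_cmod sqrrD.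
by rewrite !real_normK ?num_real// addrAC lerDl mulrn_wge0// mulr_ge0.
Qed.

Lemma cmod_real (x : R) : cmod x%:C = `|x|.
Proof. by rewrite cmodE /= expr0n addr0 sqrtr_sqr. Qed.

Lemma mul_conjc z : z * conjc z = (cmod z ^+ 2)%:C.
Proof. by rewrite -sqr_normc normc_cmod rmorphXn. Qed.

Lemma conjcM z w : conjc (z * w) = conjc z * conjc w.
Proof. exact: rmorphM. Qed.

                                                                              
                                                                            
Lemma cmod_phase z : exists2 u : R[i], cmod u = 1 & u * z = (cmod z)%:C.
Proof.
have [->|z0] := eqVneq z 0; first by exists 1; rewrite ?cmod1// mulr0 cmod0.
have m0 : cmod z != 0 by rewrite cmod_eq0.
exists (conjc z * ((cmod z)^-1)%:C).
  by rewrite cmodM cmod_conj cmod_real ger0_norm ?invr_ge0 ?cmod_ge0// divff.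
rewrite mulrAC (mulrC _ z) mul_conjc -rmorphM /=; congr (_%:C).
by rewrite expr2 mulfK.
Qed.

End cmod.

Section cmeasurable.
Context d (T : measurableType d) (R : realType).
Implicit Types f g : T -> R[i].

Lemma cmeas_cst (c : R[i]) : cmeasurable (fun _ : T => c).
Proof. by split; exact: measurable_cst. Qed.

Lemma cmeasD f g : cmeasurable f -> cmeasurable g ->
  cmeasurable (fun x => f x + g x).
Proof.
move=> [f1 f2] [g1 g2]; split.
  by rewrite [X in measurable_fun _ X](_ : _ = (fun x => complex.Re (f x) + complex.Re (g x)));
    [exact: measurable_funD|apply/funext => x; case: (f x); case: (g x)].
by rewrite [X in measurable_fun _ X](_ : _ = (fun x => complex.Im (f x) + complex.Im (g x)));
    [exact: measurable_funD|apply/funext => x; case: (f x); case: (g x)].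
Qed.

Lemma cmeasM f g : cmeasurable f -> cmeasurable g ->
  cmeasurable (fun x => f x * g x).
Proof.
move=> [f1 f2] [g1 g2]; split.
  rewrite [X in measurable_fun _ X](_ : _ = (fun x => complex.Re (f x) * complex.Re (g x)
     - complex.Im (f x) * complex.Im (g x))); last first.
    by apply/funext => x; case: (f x); case: (g x).
  by apply: measurable_funB; exact: measurable_funM.
rewrite [X in measurable_fun _ X](_ : _ = (fun x => complex.Re (f x) * complex.Im (g x)
     + complex.Im (f x) * complex.Re (g x))); last first.
    by apply/funext => x; case: (f x); case: (g x).
by apply: measurable_funD; exact: measurable_funM.
Qed.

Lemma cmeas_conj f : cmeasurable f -> cmeasurable (fun x => conjc (f x)).
Proof.
move=> [f1 f2]; split.
  by rewrite [X in measurable_fun _ X](_ : _ = (fun x => complex.Re (f x)))//;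
    apply/funext => x; case: (f x).
rewrite [X in measurable_fun _ X](_ : _ = (fun x => - complex.Im (f x)));
  last by apply/funext => x; case: (f x).
exact: measurable_funN.
Qed.

Lemma cmeasB f g : cmeasurable f -> cmeasurable g ->
  cmeasurable (fun x => f x - g x).
Proof.
move=> mf mg; rewrite (_ : (fun x => _) = (fun x => f x + (-1) * g x)).
  by apply: cmeasD => //; apply: cmeasM => //; exact: cmeas_cst.
by apply/funext => x; rewrite mulN1r.
Qed.

Lemma cmeas_cmod f : cmeasurable f -> measurable_fun setT (fun x => cmod (f x)).
Proof.
move=> [f1 f2]; under eq_fun do rewrite cmodE.
apply: (measurableT_comp (continuous_measurable_fun (@sqrt_continuous R))).
by apply: measurable_funD; exact: measurable_funX.
Qed.

Lemma cmeas_comp d' (T' : measurableType d') (h : T' -> T) f :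
  measurable_fun setT h -> cmeasurable f -> cmeasurable (f \o h).
Proof. by move=> mh [f1 f2]; split; [apply: (measurableT_comp f1)|apply: (measurableT_comp f2)]. Qed.

End cmeasurable.

Section cintegral.
Context d (T : measurableType d) (R : realType).
Variable mu : {measure set T -> \bar R}.
Implicit Types f g : T -> R[i].

Lemma cintegrable_meas f : cintegrable mu f -> cmeasurable f.
Proof.
by move=> [f1 f2]; split; apply/measurable_EFinP; [exact: measurable_int f1|exact: measurable_int f2].
Qed.

Lemma cintegrable_le f (g : T -> R) : cmeasurable f ->
  mu.-integrable setT (EFin \o g) -> (forall x, cmod (f x) <= g x) ->
  cintegrable mu f.
Proof.
move=> [f1 f2] ig fg; split.
- apply: le_integrable ig => //; first exact/measurable_EFinP.
  move=> x _ /=; rewrite lee_fin (le_trans (Re_le_cmod _))// (le_trans (fg x))//.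
  exact: ler_norm.
- apply: le_integrable ig => //; first exact/measurable_EFinP.
  move=> x _ /=; rewrite lee_fin (le_trans (Im_le_cmod _))// (le_trans (fg x))//.
  exact: ler_norm.
Qed.

Lemma integrable_cmod f : cintegrable mu f ->
  mu.-integrable setT (EFin \o (fun x => cmod (f x))).
Proof.
move=> fi; have mf := cintegrable_meas fi; case: fi => f1 f2.
apply: (@le_integrable _ _ _ _ _ _ _ (fun x => `|complex.Re (f x)|%:E + `|complex.Im (f x)|%:E)%E) => //.
- exact/measurable_EFinP/cmeas_cmod.
- move=> x _ /=; rewrite lee_fin ger0_norm ?cmod_ge0// ger0_norm ?addr_ge0//.
  exact: cmod_le_ReIm.
- by apply: integrableD => //; [exact: integrable_norm f1|exact: integrable_norm f2].
Qed.

Lemma cintegrable_lty f : cmeasurable f ->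
  (\int[mu]_x (cmod (f x))%:E < +oo)%E -> cintegrable mu f.
Proof.
move=> mf fl; apply: (@cintegrable_le _ (fun x => cmod (f x))) => //.
apply/integrableP; split; first exact/measurable_EFinP/cmeas_cmod.
by under eq_integral do rewrite /= ger0_norm ?cmod_ge0//.
Qed.

Lemma integral_cmod_lty f : cintegrable mu f ->
  (\int[mu]_x (cmod (f x))%:E < +oo)%E.
Proof. by move=> /integrable_cmod h; apply: (integrable_lty measurableT h). Qed.

Lemma cintegrableD f g : cintegrable mu f -> cintegrable mu g ->
  cintegrable mu (fun x => f x + g x).
Proof.
move=> fi gi.
apply: (@cintegrable_le _ (fun x => cmod (f x) + cmod (g x))).
- by apply: cmeasD; exact: cintegrable_meas.
- exact: (integrableD measurableT (integrable_cmod fi) (integrable_cmod gi)).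
- by move=> x; exact: cmodD.
Qed.

Lemma cintegrableZ c f : cintegrable mu f -> cintegrable mu (fun x => c * f x).
Proof.
move=> fi.
apply: (@cintegrable_le _ (fun x => cmod c * cmod (f x))).
- by apply: cmeasM; [exact: cmeas_cst|exact: cintegrable_meas].
- exact: (integrableZl measurableT (cmod c) (integrable_cmod fi)).
- by move=> x; rewrite cmodM.
Qed.

Lemma cintegrableB f g : cintegrable mu f -> cintegrable mu g ->
  cintegrable mu (fun x => f x - g x).
Proof.
move=> fi gi; rewrite (_ : (fun x => _) = (fun x => f x + (-1) * g x)).
  exact: cintegrableD (cintegrableZ (-1) gi).
by apply/funext => x; rewrite mulN1r.
Qed.

Lemma cintegrable_conj f : cintegrable mu f -> cintegrable mu (fun x => conjc (f x)).
Proof.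
move=> fi.
apply: (@cintegrable_le _ (fun x => cmod (f x))).
- by apply: cmeas_conj; exact: cintegrable_meas.
- exact: integrable_cmod.
- by move=> x; rewrite cmod_conj.
Qed.

Lemma cintegral_ext f g : f =1 g -> cintegral mu f = cintegral mu g.
Proof. by move=> fg; congr (cintegral mu _); exact/funext. Qed.

Lemma cintegral0 : cintegral mu (fun _ => 0) = 0.
Proof. by rewrite /cintegral /= /Rintegral integral0. Qed.

Lemma cintegralD f g : cintegrable mu f -> cintegrable mu g ->
  cintegral mu (fun x => f x + g x) = cintegral mu f + cintegral mu g.
Proof.
move=> [f1 f2] [g1 g2]; rewrite /cintegral.
under eq_Rintegral do rewrite raddfD; rewrite RintegralD//.
by under [X in _ +i* X]eq_Rintegral do rewrite raddfD; rewrite RintegralD//.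
Qed.

Lemma cintegral_conj f : cintegrable mu f ->
  cintegral mu (fun x => conjc (f x)) = conjc (cintegral mu f).
Proof.
move=> [f1 f2]; rewrite /cintegral /=.
rewrite (_ : (fun x => complex.Re (conjc (f x))) = (fun x => complex.Re (f x))); last first.
  by apply/funext => x; case: (f x).
rewrite (_ : (fun x => complex.Im (conjc (f x))) = (fun x => (-1) * complex.Im (f x))).
  by rewrite RintegralZl// mulN1r.
by apply/funext => x; case: (f x) => a b; rewrite mulN1r.
Qed.

Lemma cintegralZ c f : cintegrable mu f ->
  cintegral mu (fun x => c * f x) = c * cintegral mu f.
Proof.
move=> [f1 f2]; rewrite /cintegral; case: c => a b.
have Zl r h : mu.-integrable setT (fun x => (h x)%:E) ->
  mu.-integrable setT (EFin \o (fun x => r * h x)).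
  by move=> ih; exact: (integrableZl measurableT r ih).
rewrite (_ : (fun x => complex.Re _) = (fun x => a * complex.Re (f x)
     - b * complex.Im (f x))); last by apply/funext => x; case: (f x).
rewrite (_ : (fun x => complex.Im _) = (fun x => a * complex.Im (f x)
     + b * complex.Re (f x))); last by apply/funext => x; case: (f x).
rewrite RintegralB//; [|exact: Zl|exact: Zl].
rewrite RintegralD//; [|exact: Zl|exact: Zl].
by rewrite !RintegralZl.
Qed.

Lemma cintegralZr c f : cintegrable mu f ->
  cintegral mu (fun x => f x * c) = cintegral mu f * c.
Proof. by move=> fi; rewrite mulrC -cintegralZ//; apply: cintegral_ext => x; rewrite mulrC. Qed.

Lemma cintegralB f g : cintegrable mu f -> cintegrable mu g ->
  cintegral mu (fun x => f x - g x) = cintegral mu f - cintegral mu g.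
Proof.
move=> fi gi; rewrite -mulN1r -cintegralZ// -cintegralD//; last exact: cintegrableZ.
by apply: cintegral_ext => x; rewrite mulN1r.
Qed.

Lemma cmod_cintegral_le f : cintegrable mu f ->
  cmod (cintegral mu f) <= (\int[mu]_x cmod (f x))%R.
Proof.
move=> fi; have [u u1 ue] := cmod_phase (cintegral mu f).
have -> : cmod (cintegral mu f) = complex.Re ((cmod (cintegral mu f))%:C) by [].
rewrite -ue -cintegralZ// /cintegral /=.
have [ui _] := cintegrableZ u fi.
apply: le_Rintegral => //; first exact: integrable_cmod.
move=> x _; rewrite (le_trans (ler_norm _))// (le_trans (Re_le_cmod _))//.
by rewrite cmodM u1 mul1r.
Qed.

Lemma cmod_cintegral_lee f : cintegrable mu f ->
  ((cmod (cintegral mu f))%:E <= \int[mu]_x (cmod (f x))%:E)%E.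
Proof.
move=> fi; rewrite -[leRHS]fineK ?integrable_fin_num//; last exact: integrable_cmod.
by rewrite lee_fin; exact: cmod_cintegral_le.
Qed.

Lemma cintegral_real (f : T -> R) :
  cintegral mu (fun x => (f x)%:C) = (\int[mu]_x f x)%R%:C.
Proof. by rewrite /cintegral /= /Rintegral integral0. Qed.

Lemma ae_cintegrable f g : cmeasurable g ->
  {ae mu, forall x, f x = g x} -> cintegrable mu f -> cintegrable mu g.
Proof.
move=> mg fg fi; apply: cintegrable_lty => //.
rewrite -(@ae_eq_integral _ _ _ mu setT (fun x => (cmod (g x))%:E) (fun x => (cmod (f x))%:E))//.
- exact: integral_cmod_lty.
- exact/measurable_EFinP/cmeas_cmod/cintegrable_meas.
- exact/measurable_EFinP/cmeas_cmod.
- by apply: filterS fg => x -> _.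
Qed.

End cintegral.

Section cFubini.
Context d1 d2 (T1 : measurableType d1) (T2 : measurableType d2) (R : realType).
Variable m1 : {sigma_finite_measure set T1 -> \bar R}.
Variable m2 : {sigma_finite_measure set T2 -> \bar R}.
Variable f : T1 * T2 -> R[i].
Hypothesis fi : cintegrable (m1 \x m2)%E f.

                                                                            
                                                                           
                              
Lemma cFubini1 : (forall x, cintegrable m2 (fun y => f (x, y))) ->
  cintegrable m1 (fun x => cintegral m2 (fun y => f (x, y))) /\
  cintegral m1 (fun x => cintegral m2 (fun y => f (x, y))) = cintegral (m1 \x m2)%E f.
Proof.
move=> sec; case: (fi) => f1 f2.
have e1 : fubini_F m2 (EFin \o (fun z => complex.Re (f z))) =
   (fun x => (complex.Re (cintegral m2 (fun y => f (x, y))))%:E).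
  apply/funext => x; rewrite /fubini_F /= /Rintegral fineK//.
  by apply: integrable_fin_num => //; have [] := sec x.
have e2 : fubini_F m2 (EFin \o (fun z => complex.Im (f z))) =
   (fun x => (complex.Im (cintegral m2 (fun y => f (x, y))))%:E).
  apply/funext => x; rewrite /fubini_F /= /Rintegral fineK//.
  by apply: integrable_fin_num => //; have [] := sec x.
split; first by split; rewrite -?e1 -?e2; exact: integrable_fubini_F.
rewrite {1 3}/cintegral /Rintegral; congr (fine _ +i* fine _).
  by rewrite -integral12_prod_meas1// e1.
by rewrite -integral12_prod_meas1// e2.
Qed.

Lemma cFubini2 : (forall y, cintegrable m1 (fun x => f (x, y))) ->
  cintegrable m2 (fun y => cintegral m1 (fun x => f (x, y))) /\
  cintegral m2 (fun y => cintegral m1 (fun x => f (x, y))) = cintegral (m1 \x m2)%E f.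
Proof.
move=> sec; case: (fi) => f1 f2.
have e1 : fubini_G m1 (EFin \o (fun z => complex.Re (f z))) =
   (fun x => (complex.Re (cintegral m1 (fun y => f (y, x))))%:E).
  apply/funext => x; rewrite /fubini_G /= /Rintegral fineK//.
  by apply: integrable_fin_num => //; have [] := sec x.
have e2 : fubini_G m1 (EFin \o (fun z => complex.Im (f z))) =
   (fun x => (complex.Im (cintegral m1 (fun y => f (y, x))))%:E).
  apply/funext => x; rewrite /fubini_G /= /Rintegral fineK//.
  by apply: integrable_fin_num => //; have [] := sec x.
have mG : cmeasurable (fun y => cintegral m1 (fun x => f (x, y))).
  have h1 := @measurable_fubini_G _ _ _ _ _ m1 m2 _ f1.
  have h2 := @measurable_fubini_G _ _ _ _ _ m1 m2 _ f2.
  by split; apply/measurable_EFinP; rewrite /comp/= -?e1 -?e2.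
split.
  apply: cintegrable_lty => //.
  have mc := cmeas_cmod (cintegrable_meas fi).
  apply: le_lt_trans (integral_cmod_lty fi).
  rewrite [leRHS]fubini_tonelli2//; last 2 first.
  - exact/measurable_EFinP.
  - by move=> x; rewrite lee_fin cmod_ge0.
  apply: ge0_le_integral => //.
  - by move=> y _; rewrite lee_fin cmod_ge0.
  - exact/measurable_EFinP/cmeas_cmod.
  - apply: measurable_fun_fubini_tonelli_G => //; first exact/measurable_EFinP.
    by move=> x; rewrite lee_fin cmod_ge0.
  - by move=> y _; exact: cmod_cintegral_lee.
rewrite {1 3}/cintegral /Rintegral; congr (fine _ +i* fine _).
  by rewrite -integral21_prod_meas1// e1.
by rewrite -integral21_prod_meas1// e2.
Qed.

End cFubini.

                                

Section product_bounds.
Context d1 d2 (T1 : measurableType d1) (T2 : measurableType d2) (R : realType).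
Variable m1 : {sigma_finite_measure set T1 -> \bar R}.
Variable m2 : {sigma_finite_measure set T2 -> \bar R}.

Lemma cintegrable_prod (f : T1 * T2 -> R[i]) (a : T1 -> R) (b : T2 -> R) :
  cmeasurable f -> m1.-integrable setT (EFin \o a) ->
  m2.-integrable setT (EFin \o b) ->
  (forall x, 0 <= a x) -> (forall y, 0 <= b y) ->
  (forall x y, cmod (f (x, y)) <= a x * b y) ->
  cintegrable (m1 \x m2)%E f.
Proof.
move=> mf ia ib a0 b0 fab; apply: cintegrable_lty => //.
have mc := cmeas_cmod mf.
rewrite fubini_tonelli1//; last 2 first.
- exact/measurable_EFinP.
- by move=> x; rewrite lee_fin cmod_ge0.
have mb : measurable_fun setT (EFin \o b) := measurable_int m2 ib.
have ma : measurable_fun setT (EFin \o a) := measurable_int m1 ia.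
apply: (@le_lt_trans _ _ (\int[m1]_x ((a x)%:E * \int[m2]_y (b y)%:E))%E).
  apply: ge0_le_integral => //.
  - by move=> x _; apply: integral_ge0 => y _; rewrite lee_fin cmod_ge0.
  - apply: measurable_fun_fubini_tonelli_F => //; first exact/measurable_EFinP.
    by move=> x; rewrite lee_fin cmod_ge0.
  - by apply: emeasurable_funM => //; exact: measurable_cst.
  - move=> x _; rewrite -ge0_integralZl//; [|by move=> y _; rewrite lee_fin|by rewrite lee_fin].
    apply: ge0_le_integral => //.
    + by move=> y _; rewrite lee_fin cmod_ge0.
    + apply/measurable_EFinP; exact: (measurableT_comp mc (pair1_measurable x)).
    + by apply: emeasurable_funM => //; exact: measurable_cst.
    + by move=> y _; rewrite lee_fin.
have b1 : (\int[m2]_y (b y)%:E < +oo)%E by exact: (integrable_lty _ ib).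
have b2 : (0 <= \int[m2]_y (b y)%:E)%E by apply: integral_ge0 => y _; rewrite lee_fin.
rewrite ge0_integralZr//; last by move=> x _; rewrite lee_fin.
apply: lte_mul_pinfty => //; first by apply: integral_ge0 => y _; rewrite lee_fin.
by apply: integrable_fin_num => //.
Qed.

Lemma cmeas_section1 (f : T1 * T2 -> R[i]) x : cmeasurable f ->
  cmeasurable (fun y => f (x, y)).
Proof. by move=> mf; exact: (cmeas_comp (pair1_measurable x) mf). Qed.

Lemma cmeas_fst (f : T1 -> R[i]) : cmeasurable f ->
  cmeasurable (fun z : T1 * T2 => f z.1).
Proof. by move=> mf; exact: (cmeas_comp measurable_fst mf). Qed.

Lemma cmeas_snd (f : T2 -> R[i]) : cmeasurable f ->
  cmeasurable (fun z : T1 * T2 => f z.2).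
Proof. by move=> mf; exact: (cmeas_comp measurable_snd mf). Qed.

End product_bounds.

                                                                             
                                                                              
                                                                            
                                                      
Definition counting_like d (I : measurableType d) (R : realType)
    (mu : set I -> \bar R) :=
  [/\ countable [set: I], forall A : set I, measurable A &
      forall i, mu [set i] = 1%E].

Section counting_like_measurability.
Context d (I : measurableType d) (R : realType).
Variable mu : {measure set I -> \bar R}.
Hypothesis muI : counting_like mu.

Lemma counting_like_meas d' (Y : measurableType d') (f : I -> Y) :
  measurable_fun setT f.
Proof. by case: muI => _ mI _ _ B mB; exact: mI. Qed.

Lemma counting_like_cmeas (f : I -> R[i]) : cmeasurable f.
Proof. by split; exact: counting_like_meas. Qed.

                                                                    
Lemma meas_slices d' (Y : measurableType d') d2 (Z : measurableType d2)
    (f : I * Y -> Z) :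
  (forall i, measurable_fun setT (fun y => f (i, y))) -> measurable_fun setT f.
Proof.
case: muI => cI mI _ mf _ B mB; rewrite setTI.
have -> : f @^-1` B = \bigcup_(i in [set: I]) ([set i] `*` ((fun y => f (i, y)) @^-1` B)).
  apply/seteqP; split => [[i y] /= Bf|[i y] [j _] [/= -> //]].
  by exists i.
apply: countable_bigcupT_measurable => // i.
by apply: measurableX => //; have := mf i measurableT B mB; rewrite setTI.
Qed.

Lemma cmeas_slices d' (Y : measurableType d') (f : I * Y -> R[i]) :
  (forall i, cmeasurable (fun y => f (i, y))) -> cmeasurable f.
Proof. by move=> mf; split; apply: meas_slices => i; have [] := mf i. Qed.

Lemma integral_point (f : I -> \bar R) i :
  (\int[mu]_(x in [set i]) f x = f i)%E.
Proof.
case: (muI) => _ mI mu1.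
rewrite (eq_integral (cst (f i))); last by move=> x; rewrite inE => /= ->.
by rewrite integral_cst// [X in (_ * X)%E]mu1 mule1.
Qed.

Lemma point_le_integral (f : I -> \bar R) i : (forall x, 0 <= f x)%E ->
  (f i <= \int[mu]_x f x)%E.
Proof.
move=> f0; rewrite -[leLHS]integral_point; case: (muI) => _ mI _.
by apply: ge0_subset_integral => //; exact: counting_like_meas.
Qed.

Lemma point_le_Rintegral (f : I -> R) i : mu.-integrable setT (EFin \o f) ->
  (forall x, 0 <= f x) -> f i <= (\int[mu]_x f x)%R.
Proof.
move=> fi f0; rewrite -lee_fin fineK; last exact: integrable_fin_num.
by apply: (point_le_integral (f := EFin \o f)) => x; rewrite lee_fin.
Qed.

Lemma integral_delta (f : I -> \bar R) i : (forall x, x != i -> f x = 0%E) ->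
  (\int[mu]_x f x = f i)%E.
Proof.
move=> f0; case: (muI) => _ mI _.
rewrite -[RHS]integral_point [RHS]integral_mkcond; apply: eq_integral => x _.
rewrite patchE; case: ifPn; rewrite ?inE// notin_setE => /= xi.
by rewrite f0//; apply/eqP.
Qed.

Lemma cintegral_delta (f : I -> R[i]) i : (forall x, x != i -> f x = 0) ->
  cintegral mu f = f i.
Proof.
move=> f0; rewrite /cintegral /Rintegral !(@integral_delta _ i) /=; first by case: (f i).
- by move=> x /f0 ->.
- by move=> x /f0 ->.
Qed.

End counting_like_measurability.

Section counting_like_unique.
Context d (I : measurableType d) (R : realType).

                                                                       
Lemma counting_like_unique (mu nu : {measure set I -> \bar R}) :
  counting_like mu -> counting_like nu -> mu = nu :> (set I -> \bar R).
Proof.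
move=> [cI mI mu1] [_ _ nu1]; apply/funext => A.
have /countable_injP[p pinj] := cI.
have AE : A = \bigcup_n (A `&` (p @^-1` [set n])).
  by apply/seteqP; split => [x Ax|x [n _ []//]]; exists (p x).
have tA : trivIset setT (fun n => A `&` (p @^-1` [set n])).
  by move=> i j _ _ [x [[_ /= <-] [_ /= <-]]].
rewrite AE !measure_bigcup//.
apply: eq_eseriesr => n _.
have [[x [Ax pxn]]|no] := pselect ((A `&` (p @^-1` [set n])) !=set0).
  suff -> : A `&` p @^-1` [set n] = [set x] by rewrite [LHS]mu1 [RHS]nu1.
  apply/seteqP; split => [y [Ay pyn]|_ ->//].
  by apply: pinj; rewrite ?inE// pxn.
have -> : A `&` p @^-1` [set n] = set0.
  by apply/seteqP; split => // x Ax; apply: no; exists x.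
by rewrite !measure0.
Qed.

End counting_like_unique.

                                                                            
                                                          
Lemma counting_like_bij d1 d2 (I : measurableType d1) (J : measurableType d2)
    (R : realType) (mu : {measure set I -> \bar R}) (nu : {measure set J -> \bar R})
    (h : I -> J) (g : J -> I) (f : J -> \bar R) :
  counting_like mu -> counting_like nu -> cancel h g -> cancel g h ->
  (forall x, 0 <= f x)%E -> (\int[mu]_x f (h x) = \int[nu]_x f x)%E.
Proof.
move=> muI nuJ hg gh f0.
have mh : measurable_fun setT h := counting_like_meas muI h.
have mf : measurable_fun setT f := counting_like_meas nuJ f.
rewrite -(@ge0_integral_pushforward _ _ _ _ _ h mh mu setT f)//.
apply: eq_measure_integral => A _ _.
rewrite (@counting_like_unique _ _ _ (pushforward mu h) nu)//.
case: (muI) (nuJ) => cI mI mu1 [cJ mJ _]; split => // i; rewrite /pushforward.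
rewrite -[LHS]/(mu (h @^-1` [set i])) (_ : h @^-1` [set i] = [set g i]) ?mu1//.
by apply/seteqP; split => x /= => [<-|->]; rewrite ?hg ?gh.
Qed.

Section counting_like_instances.
Variable R : realType.

Lemma counting_like_muZ n : counting_like (muZ R n).
Proof.
split => //.
  apply/countable_injP; exists pickle => x y _ _; exact: (pcan_inj pickleK).
by move=> i; rewrite /muZ /counting /= asboolT// fset_set1 finmap.cardfs1.
Qed.

Lemma counting_like_prod d1 d2 (I : measurableType d1) (J : measurableType d2)
   (mu : {sigma_finite_measure set I -> \bar R})
   (nu : {sigma_finite_measure set J -> \bar R}) :
  counting_like mu -> counting_like nu -> counting_like (mu \x nu)%E.
Proof.
move=> [cI mI mu1] [cJ mJ nu1].
have cIJ : countable [set: I * J] by rewrite -setXTT; exact: countableX.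
have X1 i j : [set (i, j)] = [set i] `*` [set j] :> set (I * J).
  by apply/seteqP; split => -[x y] /= [-> ->].
split => //.
- move=> A; apply: countable_measurable.
    by move=> [i j]; rewrite X1; apply: measurableX.
  exact: sub_countable (subset_card_le (@subsetT _ A)) cIJ.
- move=> [i j]; rewrite X1 product_measure1E//.
  by rewrite [X in (X * _)%E]mu1 [X in (_ * X)%E]nu1 mule1.
Qed.

End counting_like_instances.

                                                           

Section partial_sums.
Context d (I : measurableType d) (R : realType).
Variable mu : {measure set I -> \bar R}.
Hypothesis muI : counting_like mu.

                                                                             
                                                                            
Lemma counting_like_index : exists (p : I -> nat) (q : nat -> option I),
  pcancel p q /\ ocancel q p.
Proof.
case: (muI) => /countable_injP[p pinj] _ _; exists p.
exists (fun L => if pselect (exists i, p i = L) is left ex then Some (projT1 (cid ex)) else None).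
split=> [x|L].
  case: pselect => [ex|[]]; last by exists x.
  by congr Some; apply: pinj; rewrite ?inE//; case: (cid ex).
by case: pselect => //= ex; case: (cid ex).
Qed.

Variables (p : I -> nat) (q : nat -> option I).
Hypotheses (pK : pcancel p q) (qK : ocancel q p).

Lemma integrable_above (w : I -> R) L : mu.-integrable setT (EFin \o w) ->
  mu.-integrable setT (fun i => (w i * (L <= p i)%:R)%:E).
Proof.
move=> iw; apply: le_integrable iw => //; first exact: (counting_like_meas muI).
move=> i _ /=; rewrite lee_fin normrM ler_piMr//.
by case: (L <= p i)%N; rewrite ?normr1 ?normr0.
Qed.

Lemma cvg_tail (w : I -> R) : mu.-integrable setT (EFin \o w) ->
  (\int[mu]_i (w i * (L <= p i)%:R))%R @[L --> \oo] --> (0 : R).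
Proof.
move=> iw.
have /(_ _ _ _)[] := @dominated_convergence _ _ _ mu setT measurableT
  (fun L i => (w i * (L <= p i)%:R)%:E) (cst 0%E) (fun i => `|w i|%:E).
- by move=> n; exact: (counting_like_meas muI).
- exact: measurable_cst.
- apply: aeW => i _; apply: (@cvg_near_cst _ _ _ _ _) .
  near=> L; rewrite leqNgt (_ : (p i < L)%N) ?mulr0//.
  by near: L; exists (p i).+1.
- exact: integrable_norm.
- apply: aeW => i L _; rewrite lee_fin normrM ler_piMr//.
  by case: (L <= p i)%N; rewrite ?normr1 ?normr0.
move=> _ _; rewrite integral0 => h.
exact: (fine_cvg h).
Unshelve. all: by end_near. Qed.

Lemma cintegrable_below (f : I -> R[i]) L : cintegrable mu f ->
  cintegrable mu (fun i => f i * (p i < L)%:R).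
Proof.
move=> fi; apply: (cintegrable_le (g := fun i => cmod (f i))).
- exact: (counting_like_cmeas muI).
- exact: integrable_cmod.
- move=> i; rewrite cmodM ler_piMr ?cmod_ge0//.
  by case: (p i < L)%N; rewrite ?cmod1 ?cmod0.
Qed.

Lemma cvg_partial (f : I -> R[i]) : cintegrable mu f ->
  cmod (cintegral mu f - cintegral mu (fun i => f i * (p i < L)%:R)) @[L --> \oo]
   --> (0 : R).
Proof.
move=> fi.
apply: (@squeeze_cvgr _ _ _ _ (cst 0) (fun L => \int[mu]_i (cmod (f i) * (L <= p i)%:R))%R).
- apply: nearW => L; rewrite cmod_ge0/=.
  have fiL := cintegrable_below L fi.
  rewrite -cintegralB//; apply: le_trans (cmod_cintegral_le (cintegrableB fi fiL)) _.
  rewrite le_eqVlt; apply/orP; left; apply/eqP/eq_Rintegral => i _.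
  by rewrite (leqNgt L); case: (p i < L)%N; rewrite /= ?mulr1 ?mulr0 ?subrr ?cmod0 ?subr0 ?mulr1.
- exact: cvg_cst.
- exact/cvg_tail/integrable_cmod.
Qed.

                                                                      
                                                                           
                                            
Fixpoint partial_sum (Y : Type) (e : I -> Y -> R[i]) (c : I -> R[i]) (L : nat)
    (y : Y) : R[i] :=
  if L is L.+1 then
    (if q L is Some i then c i * e i y else 0) + partial_sum e c L y
  else 0.

Lemma cintegrable_point (f : I -> R[i]) (j : I) :
  cintegrable mu (fun x => f x * (x == j)%:R).
Proof.
apply: cintegrable_lty; first exact: (counting_like_cmeas muI).
rewrite (integral_delta muI (i := j)); first exact: ltry.
by move=> x /negbTE ->; rewrite mulr0 cmod0.
Qed.

Lemma cintegral_below_S (f : I -> R[i]) L : cintegrable mu f ->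
  cintegral mu (fun i => f i * (p i < L.+1)%:R) =
  (if q L is Some i then f i else 0) + cintegral mu (fun i => f i * (p i < L)%:R).
Proof.
move=> fi; case qL : (q L) => [j|].
  have pj : p j = L by have := qK L; rewrite qL.
  rewrite -[X in X + _](_ : cintegral mu (fun i => f i * (i == j)%:R) = _); last first.
    rewrite (cintegral_delta muI (i := j)) ?eqxx ?mulr1//.
    by move=> x /negbTE ->; rewrite mulr0.
  rewrite -cintegralD//; [|exact: cintegrable_point|exact: cintegrable_below].
  apply: cintegral_ext => x; rewrite -mulrDr; congr (_ * _).
  have [->|xj] := eqVneq x j; first by rewrite pj ltnSn ltnn addr0.
  rewrite add0r ltnS leq_eqVlt; case: eqP => //= px.
  by case/eqP: xj; apply: (pcan_inj pK); rewrite px.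
rewrite add0r; apply: cintegral_ext => x; congr (_ * _).
rewrite ltnS leq_eqVlt; case: eqP => //= px.
by have := pK x; rewrite px qL.
Qed.

Lemma partial_sumE (Y : Type) (e : I -> Y -> R[i]) (c : I -> R[i]) L y :
  cintegrable mu (fun i => c i * e i y) ->
  partial_sum e c L y = cintegral mu (fun i => c i * e i y * (p i < L)%:R).
Proof.
move=> ci; elim: L => [|L IH] /=.
  by under cintegral_ext do rewrite mulr0; rewrite cintegral0.
by rewrite IH cintegral_below_S.
Qed.

Lemma partial_sum_closed (Y : Type) (S : (Y -> R[i]) -> Prop)
    (e : I -> Y -> R[i]) (c : I -> R[i]) L :
  S (fun=> 0) -> (forall a F H, S F -> S H -> S (fun y => a * F y + H y)) ->
  (forall i, S (e i)) -> S (partial_sum e c L).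
Proof.
move=> S0 SD Se; elim: L => [|L IH]//=.
case: (q L) => [j|]; first exact: SD.
rewrite (_ : (fun y => _) = (fun y => 0 * partial_sum e c L y + partial_sum e c L y)).
  exact: SD.
by apply/funext => y; rewrite mul0r.
Qed.

                                                                             
                                                                    
                                                                             
                                                                            
                                                    
Lemma functional_expansion (Y : Type) (S : (Y -> R[i]) -> Prop)
    (u : (Y -> R[i]) -> R[i]) (e : I -> Y -> R[i]) (c : I -> R[i])
    (F : Y -> R[i]) (w : I -> R) (K : R) :
  S (fun=> 0) -> (forall a F H, S F -> S H -> S (fun y => a * F y + H y)) ->
  (forall a F H, S F -> S H -> u (fun y => a * F y + H y) = a * u F + u H) ->
  (forall i, S (e i)) -> S F ->
  mu.-integrable setT (EFin \o w) ->
  (forall L, cmod (u (fun y => - partial_sum e c L y + F y)) <=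
     K * (\int[mu]_i (w i * (L <= p i)%:R))%R) ->
  cintegrable mu (fun i => c i * u (e i)) ->
  u F = cintegral mu (fun i => c i * u (e i)).
Proof.
move=> S0 SD ul Se SF iw uw ci.
have u0 : u (fun=> 0) = 0.
  have := ul 1 _ _ S0 S0; rewrite (_ : (fun y => _) = (fun=> 0)).
    by rewrite mul1r => /eqP; rewrite -subr_eq0 opprD addrA subrr add0r oppr_eq0 => /eqP.
  by apply/funext => y; rewrite mulr0 addr0.
have uP L : u (partial_sum e c L) = cintegral mu (fun i => c i * u (e i) * (p i < L)%:R).
  elim: L => [|L IH].
    by under cintegral_ext do rewrite mulr0; rewrite cintegral0 -[RHS]u0.
  rewrite cintegral_below_S// -IH /=; case: (q L) => [j|].
    by rewrite ul//; exact: partial_sum_closed.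
  by rewrite add0r; congr u; apply/funext => y; rewrite add0r.
suff : cmod (u F - cintegral mu (fun i => c i * u (e i))) <= 0.
  rewrite le_eqVlt ltNge cmod_ge0 orbF cmod_eq0 subr_eq0 => /eqP //.
have cv : (fun L => K * (\int[mu]_i (w i * (L <= p i)%:R))%R +
   cmod (cintegral mu (fun i => c i * u (e i)) - cintegral mu (fun i => c i * u (e i) * (p i < L)%:R)))
   @ \oo --> (0 : R).
  rewrite -[X in _ --> X]addr0 -[X in _ --> X + _](mulr0 K).
  apply: cvgD; last exact: cvg_partial.
  by apply: cvgM; [exact: cvg_cst|exact: cvg_tail].
rewrite -(cvg_lim (@Rhausdorff R) cv).
apply: limr_ge; first exact: cvgP cv.
apply: nearW => L.
apply: le_trans (lerD (uw L) (lexx _)).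
rewrite -uP (_ : (fun y => - _ + _) = (fun y => -1 * partial_sum e c L y + F y)); last first.
  by apply/funext => y; rewrite mulN1r.
rewrite ul//; last exact: partial_sum_closed.
rewrite (_ : u F - _ = (-1 * u (partial_sum e c L) + u F) - (cintegral mu (fun i => c i * u (e i)) - u (partial_sum e c L))); last by ring.
exact: cmodB.
Qed.

End partial_sums.

                                                   

Section orthonormal_series.
Context d (I : measurableType d) (R : realType).
Variable mu : {sigma_finite_measure set I -> \bar R}.
Hypothesis muI : counting_like mu.
Context d' (W : measurableType d') (P : probability W R).
Variable chi : I -> W -> R[i].
Hypothesis mchi : forall k, cmeasurable (chi k).
Hypothesis chi1 : forall k w, cmod (chi k w) = 1.
Hypothesis chi_orth : forall k k',
  cintegral P (fun w => chi k w * conjc (chi k' w)) = (k == k')%:R.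
Variable c : I -> R[i].
Hypothesis ci : cintegrable mu c.

Let V w := cintegral mu (fun k => c k * chi k w).

Lemma integrable_unit : P.-integrable setT (EFin \o (fun=> 1 : R)).
Proof. exact: finite_measure_integrable_cst. Qed.

Lemma cintegrable_series w : cintegrable mu (fun k => c k * chi k w).
Proof.
apply: (cintegrable_le (g := fun k => cmod (c k))).
- exact: (counting_like_cmeas muI).
- exact: integrable_cmod.
- by move=> k; rewrite cmodM chi1 mulr1.
Qed.

Lemma cmod_series_le w : cmod (V w) <= (\int[mu]_k cmod (c k))%R.
Proof.
apply: le_trans (cmod_cintegral_le (cintegrable_series w)) _.
rewrite le_eqVlt; apply/orP; left; apply/eqP/eq_Rintegral => k _.
by rewrite cmodM chi1 mulr1.
Qed.

Lemma cmeas_series_kernel (F : W -> R[i]) : cmeasurable F ->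
  cmeasurable (fun z : I * W => c z.1 * chi z.1 z.2 * F z.2).
Proof.
move=> mF; apply: (cmeas_slices muI) => k /=.
apply: cmeasM => //; apply: cmeasM => //; exact: cmeas_cst.
Qed.

                                                                           
                                        
Lemma series_pairing (F : W -> R[i]) : cintegrable P F ->
  cintegrable P (fun w => V w * F w) /\
  cintegral P (fun w => V w * F w) =
  cintegral mu (fun k => c k * cintegral P (fun w => chi k w * F w)).
Proof.
move=> Fi; have mF := cintegrable_meas Fi.
have ki : cintegrable (mu \x P)%E (fun z : I * W => c z.1 * chi z.1 z.2 * F z.2).
  apply: (cintegrable_prod (a := fun k => cmod (c k)) (b := fun w => cmod (F w))).
  - exact: cmeas_series_kernel.
  - exact: integrable_cmod.
  - exact: integrable_cmod.
  - by move=> k; exact: cmod_ge0.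
  - by move=> w; exact: cmod_ge0.
  - by move=> k w /=; rewrite !cmodM chi1 mulr1.
have s2 w : cintegrable mu (fun k => c k * chi k w * F w).
  have := cintegrableZ (F w) (cintegrable_series w).
  by under eq_fun do rewrite mulrC.
have xi k : cintegrable P (fun w => chi k w * F w).
  apply: (cintegrable_le (g := fun w => cmod (F w))).
  - exact: cmeasM.
  - exact: integrable_cmod.
  - by move=> w; rewrite cmodM chi1 mul1r.
have s1 k : cintegrable P (fun w => c k * chi k w * F w).
  have := cintegrableZ (c k) (xi k).
  by under eq_fun do rewrite mulrA.
have [_ e1] := cFubini1 ki s1.
have [i2 e2] := cFubini2 ki s2.
have VF : (fun w => V w * F w) = (fun y => cintegral mu (fun k => c k * chi k y * F y)).
  by apply/funext => w; rewrite cintegralZr//; exact: cintegrable_series.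
rewrite VF; split => //; rewrite e2 -e1.
apply: cintegral_ext => k /=; rewrite -cintegralZ//.
by apply: cintegral_ext => w; rewrite mulrA.
Qed.

Lemma cintegrable_bounded (F : W -> R[i]) (M : R) : cmeasurable F ->
  (forall w, cmod (F w) <= M) -> cintegrable P F.
Proof.
move=> mF FM; apply: (cintegrable_le (g := fun=> M)) => //.
exact: finite_measure_integrable_cst.
Qed.

Lemma cintegrable_chi k : cintegrable P (fun w => conjc (chi k w)).
Proof.
apply: (@cintegrable_bounded _ 1); first exact: cmeas_conj.
by move=> w; rewrite cmod_conj chi1.
Qed.

Lemma cintegrable_seriesP : cintegrable P V.
Proof.
have h1 : cintegrable P (fun=> 1 : R[i]).
  by apply: (@cintegrable_bounded _ 1); [exact: cmeas_cst|move=> w; rewrite cmod1].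
have [h _] := series_pairing h1.
by move: h; under eq_fun do rewrite mulr1.
Qed.

Lemma series_coef k : cintegral P (fun w => V w * conjc (chi k w)) = c k.
Proof.
have [_ ->] := series_pairing (cintegrable_chi k).
rewrite (cintegral_delta muI (i := k)).
  by rewrite chi_orth eqxx mulr1.
by move=> j /negbTE jk; rewrite chi_orth jk mulr0.
Qed.

                                                                            
Lemma coef_le_norm k : ((cmod (c k))%:E <= \int[P]_w (cmod (V w))%:E)%E.
Proof.
rewrite -[in leLHS](series_coef k).
have [i1 _] := series_pairing (cintegrable_chi k).
apply: le_trans (cmod_cintegral_lee i1) _.
by rewrite le_eqVlt; apply/orP; left; apply/eqP/eq_integral => w _; rewrite cmodM cmod_conj chi1 mulr1.
Qed.

Lemma cintegral_sqr d2 (T : measurableType d2) (nu : {measure set T -> \bar R})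
    (f : T -> R[i]) : cintegrable nu (fun x => f x * conjc (f x)) ->
  (\int[nu]_x (cmod (f x) ^+ 2)%:E < +oo)%E /\
  cintegral nu (fun x => f x * conjc (f x)) =
  (fine (\int[nu]_x (cmod (f x) ^+ 2)%:E))%:C.
Proof.
under eq_fun do rewrite mul_conjc; move=> h.
by rewrite cintegral_real; split=> //; case: h => /= h _; exact: (integrable_lty _ h).
Qed.

                                                             
Lemma parseval : (\int[P]_w (cmod (V w) ^+ 2)%:E = \int[mu]_k (cmod (c k) ^+ 2)%:E)%E.
Proof.
have [i1] := series_pairing (cintegrable_conj cintegrable_seriesP).
have -> : (fun k => c k * cintegral P (fun w => chi k w * conjc (V w))) =
   (fun k => c k * conjc (c k)).
  apply/funext => k; congr (_ * _); rewrite -[in RHS](series_coef k) -cintegral_conj.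
    by apply: cintegral_ext => w; rewrite conjcM conjcK mulrC.
  by have [] := series_pairing (cintegrable_chi k).
have i2 : cintegrable mu (fun k => c k * conjc (c k)).
  apply: (cintegrable_le (g := fun k => (\int[mu]_k cmod (c k))%R * cmod (c k))).
  - exact: (counting_like_cmeas muI).
  - exact: (integrableZl measurableT _ (integrable_cmod ci)).
  - move=> k; rewrite cmodM cmod_conj ler_wpM2r ?cmod_ge0//.
    apply: (point_le_Rintegral muI k (integrable_cmod ci)) => x; exact: cmod_ge0.
have [l1 ->] := cintegral_sqr i1; have [l2 ->] := cintegral_sqr i2.
move=> /realc_inj h.
have p1 : (0 <= \int[P]_w (cmod (V w) ^+ 2)%:E)%E by apply: integral_ge0 => x _; rewrite lee_fin sqr_ge0.
have p2 : (0 <= \int[mu]_w (cmod (c w) ^+ 2)%:E)%E by apply: integral_ge0 => x _; rewrite lee_fin sqr_ge0.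
by rewrite -[LHS]fineK ?ge0_fin_numE// h fineK// ge0_fin_numE.
Qed.

End orthonormal_series.

                                                                  

                                                                             
                                                                            
                                                                     
                                                                         
                                                                            
              
Section stft_estimate.
Context d (I : measurableType d) (R : realType).
Variable mu : {sigma_finite_measure set I -> \bar R}.
Hypothesis muI : counting_like mu.
Context d' (W : measurableType d') (P : probability W R).
Variable s : I -> I -> I.
Hypothesis sl : forall m, exists g, cancel (s ^~ m) g /\ cancel g (s ^~ m).
Hypothesis sr : forall k, cancel (s k) (s k).
Variable chi : I -> I -> W -> R[i].
Hypothesis mchi : forall m k, cmeasurable (chi m k).
Hypothesis chi1 : forall m k w, cmod (chi m k w) = 1.
Hypothesis chi_orth : forall m k k',
  cintegral P (fun w => chi m k w * conjc (chi m k' w)) = (k == k')%:R.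
Variables c gam : I -> R[i].
Hypothesis gi : cintegrable mu gam.
Variable i0 : I.
Hypothesis gam_i0 : gam i0 != 0.
Hypothesis cgi : forall m, cintegrable mu (fun k => c k * conjc (gam (s k m))).

Let V m w := cintegral mu (fun k => c k * conjc (gam (s k m)) * chi m k w).
Let a m := (\int[P]_w (cmod (V m w))%:E)%E.

Variable X : R.
Hypothesis XE : (\int[mu]_m \int[P]_w (cmod (V m w))%:E = X%:E)%E.

Let a_ge0 m : (0 <= a m)%E.
Proof. by apply: integral_ge0 => w _; rewrite lee_fin cmod_ge0. Qed.

Let X_ge0 : 0 <= X.
Proof. by rewrite -lee_fin -XE; apply: integral_ge0 => m _; exact: a_ge0. Qed.

Let mI d2 (Y : measurableType d2) (f : I -> Y) : measurable_fun setT f.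
Proof. exact: (counting_like_meas muI). Qed.

Let coef_le m k : ((cmod (c k) * cmod (gam (s k m)))%:E <= a m)%E.
Proof.
rewrite -[X in (_ * X)%:E]cmod_conj -cmodM.
exact: (coef_le_norm muI (mchi m) (chi1 m) (chi_orth m) (cgi m) k).
Qed.

                                                                              
                                                                            
                                 
Lemma stft_coef_integrable : cintegrable mu c.
Proof.
apply: cintegrable_lty; first exact: (counting_like_cmeas muI).
have g0 : 0 < cmod (gam i0) by rewrite lt_def cmod_ge0 andbT cmod_eq0.
have h : (\int[mu]_k ((cmod (gam i0))%:E * (cmod (c k))%:E) <= X%:E)%E.
  have [g [sg gs]] := sl i0.
  have E1 : (\int[mu]_k a (s k i0) = X%:E)%E.
    by rewrite (@counting_like_bij _ _ _ _ _ mu mu (s ^~ i0) g a muI muI sg gs).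
  rewrite -E1; apply: ge0_le_integral => //; try exact: mI.
  - by move=> x _; rewrite -EFinM lee_fin mulr_ge0 ?cmod_ge0.
  - move=> k _; rewrite -EFinM mulrC.
    by have := coef_le (s k i0) k; rewrite sr.
rewrite ge0_integralZl// in h; last 3 first.
- exact: mI.
- by move=> x _; rewrite lee_fin cmod_ge0.
- by rewrite lee_fin ltW.
rewrite ltNge leye_eq; apply/negP => /eqP e; move: h.
by rewrite e mulry gtr0_sg// mul1e leNgt ltry.
Qed.

Let N1 := (\int[mu]_k cmod (gam k))%R.

Let N1E : (\int[mu]_k (cmod (gam k))%:E = N1%:E)%E.
Proof. by rewrite fineK//; apply: integrable_fin_num => //; exact: integrable_cmod. Qed.

                                                  
Let coef_sup k : cmod (c k) * N1 <= X.
Proof.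
rewrite -lee_fin EFinM -N1E -XE.
rewrite -(@counting_like_bij _ _ _ _ _ mu mu (s k) (s k) (fun m => (cmod (gam m))%:E) muI muI (sr k) (sr k)); last first.
  by move=> m; rewrite lee_fin cmod_ge0.
rewrite -ge0_integralZl//; last 3 first.
- exact: mI.
- by move=> x _; rewrite lee_fin cmod_ge0.
- by rewrite lee_fin cmod_ge0.
apply: ge0_le_integral => //; try exact: mI.
- by move=> x _; rewrite -EFinM lee_fin mulr_ge0 ?cmod_ge0.
- by move=> m _; exact: coef_le.
Qed.

Let N1_gt0 : 0 < N1.
Proof.
rewrite lt_def Rintegral_ge0 ?andbT; last by move=> x _; exact: cmod_ge0.
have /lt_le_trans h : 0 < cmod (gam i0) by rewrite lt_def cmod_ge0 andbT cmod_eq0.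
rewrite gt_eqF//; apply: h.
by apply: (point_le_Rintegral muI i0 (integrable_cmod gi)) => x; exact: cmod_ge0.
Qed.

                                                                             
                                             
Let V_sup m w : cmod (V m w) <= X.
Proof.
rewrite -lee_fin.
apply: le_trans (cmod_cintegral_lee (cintegrable_series muI (chi1 m) (cgi m) w)) _.
have [g [sg gs]] := sl m.
apply: (@le_trans _ _ (\int[mu]_k ((X / N1)%:E * (cmod (gam (s k m)))%:E))%E).
  apply: ge0_le_integral => //; try exact: mI.
  - by move=> x _; rewrite lee_fin cmod_ge0.
  - move=> k _; rewrite -EFinM lee_fin !cmodM chi1 mulr1 cmod_conj ler_wpM2r ?cmod_ge0//.
    by rewrite ler_pdivlMr.
rewrite ge0_integralZl//; last 3 first.
- exact: mI.
- by move=> x _; rewrite lee_fin cmod_ge0.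
- by rewrite lee_fin divr_ge0// ltW.
rewrite (@counting_like_bij _ _ _ _ _ mu mu (s ^~ m) g (fun m => (cmod (gam m))%:E) muI muI sg gs); last first.
  by move=> k; rewrite lee_fin cmod_ge0.
by rewrite N1E -EFinM divfK// gt_eqF.
Qed.

                                                                              
                                                                    
Lemma stft_coef_l2 :
  ((\int[mu]_k (cmod (c k) ^+ 2)%:E) * (\int[mu]_k (cmod (gam k) ^+ 2)%:E) <= (X ^+ 2)%:E)%E.
Proof.
have mV m : cmeasurable (V m).
  exact: (cintegrable_meas (cintegrable_seriesP muI P (mchi m) (chi1 m) (cgi m))).
have step m : (\int[mu]_k (cmod (c k) ^+ 2 * cmod (gam (s k m)) ^+ 2)%:E <= X%:E * a m)%E.
  have <- : (\int[P]_w (cmod (V m w) ^+ 2)%:E = \int[mu]_k (cmod (c k) ^+ 2 * cmod (gam (s k m)) ^+ 2)%:E)%E.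
    rewrite (parseval muI (mchi m) (chi1 m) (chi_orth m) (cgi m)).
    by apply: eq_integral => k _; rewrite cmodM cmod_conj exprMn.
  rewrite -ge0_integralZl//; last 2 first.
  - exact/measurable_EFinP/cmeas_cmod.
  - by move=> x _; rewrite lee_fin cmod_ge0.
  apply: ge0_le_integral => //.
  - by move=> x _; rewrite lee_fin sqr_ge0.
  - by apply/measurable_EFinP/measurable_funX/cmeas_cmod.
  - by apply: emeasurable_funM; [exact: measurable_cst|exact/measurable_EFinP/cmeas_cmod].
  - by move=> w _; rewrite -EFinM lee_fin expr2 ler_wpM2r ?cmod_ge0// V_sup.
have -> : (X ^+ 2)%:E = (\int[mu]_m (X%:E * a m))%E.
  rewrite ge0_integralZl//; [|exact: mI].
  by rewrite XE.
have mk : measurable_fun setT (fun z : I * I => (cmod (c z.2) ^+ 2 * cmod (gam (s z.2 z.1)) ^+ 2)%:E).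
  by apply: (meas_slices muI) => i; exact: mI.
apply: (@le_trans _ _ (\int[mu]_m \int[mu]_k (cmod (c k) ^+ 2 * cmod (gam (s k m)) ^+ 2)%:E)%E); last first.
  apply: ge0_le_integral => //; try exact: mI.
  by move=> m _; apply: integral_ge0 => k _; rewrite lee_fin mulr_ge0 ?sqr_ge0.
have := @fubini_tonelli _ _ _ _ _ mu mu (fun z : I * I => (cmod (c z.2) ^+ 2 * cmod (gam (s z.2 z.1)) ^+ 2)%:E).
rewrite /= => ->//; last by move=> z; rewrite lee_fin mulr_ge0 ?sqr_ge0.
rewrite -ge0_integralZr//; last 3 first.
- exact: mI.
- by move=> x _; rewrite lee_fin sqr_ge0.
- by apply: integral_ge0 => x _; rewrite lee_fin sqr_ge0.
apply: ge0_le_integral => //; try exact: mI.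
- move=> x _; rewrite mule_ge0 ?lee_fin ?sqr_ge0//.
  by apply: integral_ge0 => k _; rewrite lee_fin sqr_ge0.
move=> k _.
under [leRHS]eq_integral do rewrite EFinM.
rewrite ge0_integralZl//; last 3 first.
- exact: mI.
- by move=> x _; rewrite lee_fin sqr_ge0.
- by rewrite lee_fin sqr_ge0.
rewrite (@counting_like_bij _ _ _ _ _ mu mu (s k) (s k) (fun m => (cmod (gam m) ^+ 2)%:E) muI muI (sr k) (sr k))//.
by move=> m; rewrite lee_fin sqr_ge0.
Qed.

End stft_estimate.

                                 

Section torus_integration.
Variable R : realType.

Notation unif := (uniform_prob (@ltr01 R)).

Lemma ge0_integral_haarS n (f : Tn R n.+1 -> \bar R) : measurable_fun setT f ->
  (forall x, 0 <= f x)%E ->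
  (\int[haar R n.+1]_x f x = \int[unif \x haar R n]_z f (consT z))%E.
Proof.
move=> mf f0.
have := @ge0_integral_pushforward _ _ _ _ _ _ (@measurable_consT R n)
  (unif \x haar R n)%E setT f measurableT mf (fun y _ => f0 y).
by rewrite preimage_setT.
Qed.

Lemma integrable_haarS n (f : Tn R n.+1 -> \bar R) : (haar R n.+1).-integrable setT f ->
  (unif \x haar R n)%E.-integrable setT (f \o @consT R n).
Proof.
move=> /integrableP[mf fi]; apply/integrableP; split.
  by apply: measurableT_comp => //; exact: measurable_consT.
rewrite -(@ge0_integral_haarS n (fun x => `|f x|)%E)//.
by apply: measurableT_comp.
Qed.

Lemma integral_haarS n (f : Tn R n.+1 -> \bar R) : (haar R n.+1).-integrable setT f ->
  (\int[haar R n.+1]_x f x = \int[unif \x haar R n]_z f (consT z))%E.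
Proof.
move=> fi.
have mf : measurable_fun setT f := measurable_int _ fi.
have := @integral_pushforward _ _ _ _ _ _ (@measurable_consT R n)
  (unif \x haar R n)%E setT f mf (integrable_haarS fi) measurableT.
by rewrite preimage_setT.
Qed.

Lemma integral_unif (f : R -> \bar R) : measurable_fun setT f ->
  (\int[unif]_t f t = \int[lebesgue_measure]_(t in `[0%R, 1%R]) f t)%E.
Proof.
move=> mf; rewrite integralE [RHS]integralE.
rewrite !integral_uniform//; try exact: measurable_funepos; try exact: measurable_funeneg.
by rewrite subr0 invr1 !mul1e.
Qed.

End torus_integration.

Section continuous_measurable.
Variables (R : realType) (n : nat).

                                                     
Definition grid (N : nat) (x : Tn R n) : Zn n := \row_i Num.floor (x ord0 i * N.+1%:R).

Lemma measurable_grid N : measurable_fun setT (grid N).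
Proof.
move=> _ B _; rewrite setTI.
have -> : grid N @^-1` B = \bigcup_(k in [set: Zn n]) (if k \in B then grid N @^-1` [set k] else set0).
  apply/seteqP; split=> [x Bx|x [k _]].
    by exists (grid N x) => //; rewrite mem_set.
  by case: ifPn => // /set_mem kB /= ->.
apply: countable_bigcupT_measurable.
  by apply/countable_injP; exists pickle => x y _ _; exact: (pcan_inj pickleK).
move=> k; case: ifPn => // _.
have -> : grid N @^-1` [set k] = \bigcap_(i in [set: 'I_n])
   ((fun x : Tn R n => x ord0 i) @^-1` `[((k ord0 i)%:~R / N.+1%:R), ((k ord0 i + 1)%:~R / N.+1%:R)[).
  apply/seteqP; split=> x /=.
    move=> <- i _ /=; rewrite in_itv/= mxE ler_pdivrMr// ltr_pdivlMr//.
    by rewrite floor_le floorD1_gt.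
  move=> h; apply/rowP => i; rewrite mxE.
  apply/eqP; rewrite floor_eq; have := h i I => /=.
  by rewrite in_itv/= ler_pdivrMr// ltr_pdivlMr//.
apply: fin_bigcap_measurable => // i _; rewrite -[X in measurable X]setTI.
by apply: measurable_coordT.
Qed.

Definition ungrid (N : nat) (k : Zn n) : Tn R n := \row_i ((k ord0 i)%:~R / N.+1%:R).

Lemma grid_cvg (x : Tn R n) : ungrid N (grid N x) @[N --> \oo] --> x.
Proof.
apply/cvgrPdist_le => e e0; near=> N.
have eN : N.+1%:R^-1 <= e.
  by apply/ltW; near: N; exact: near_infty_natSinv_lt (PosNum e0).
rewrite /Num.norm/= mx_normrE.
apply: bigmax_le => [|[i j] _]; first exact: ltW.
rewrite /= !mxE (ord1 i) ger0_norm.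
  rewrite lerBlDr -lerBlDl; apply: le_trans (_ : x ord0 j - N.+1%:R^-1 <= _).
    by rewrite lerB.
  rewrite ler_pdivlMr// mulrBl mulVf// lerBlDr.
  by apply: ltW; have := floorD1_gt (x ord0 j * N.+1%:R); rewrite intrD.
by rewrite subr_ge0 ler_pdivrMr// floor_le.
Unshelve. all: by end_near. Qed.

                                                                              
                                                                          
                                                                         
                                   
Lemma continuous_meas (f : Tn R n -> R) : continuous f -> measurable_fun setT f.
Proof.
move=> cf; apply: (measurable_fun_cvg (h := fun N x => f (ungrid N (grid N x)))).
  move=> N; apply: (measurableT_comp (f := fun k => f (ungrid N k))).
    by move=> _ B _.
  exact: measurable_grid.
move=> x _; apply: (cvg_comp _ _ (@grid_cvg x)); exact: cf.
Qed.

End continuous_measurable.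

                                                

Section continuous_ring.
Variables (T : topologicalType) (R : realType).
Implicit Types f g : T -> R.

Lemma fun_continuousD f g : continuous f -> continuous g -> continuous (fun x => f x + g x).
Proof. by move=> cf cg x; exact: (continuousD (cf x) (cg x)). Qed.

Lemma fun_continuousM f g : continuous f -> continuous g -> continuous (fun x => f x * g x).
Proof. by move=> cf cg x; exact: (continuousM (cf x) (cg x)). Qed.

End continuous_ring.

Section derivative_integral.
Variable R : realType.

Notation unif := (uniform_prob (@ltr01 R)).

                                                                              
                      
Lemma is_derive_along (V W : normedModType R) (phi : V -> W) (h : W -> R) (a w : V)
    (v : W) (d : R) :
  (forall r : R, phi (r *: w + a) = r *: v + phi a) ->
  is_derive (phi a) v h d -> is_derive a w (h \o phi) d.
Proof.
move=> phiE [hd hv].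
have E : (fun r : R => r^-1 *: ((h \o phi \o shift a) (r *: w) - (h \o phi) a)) =
    (fun r : R => r^-1 *: ((h \o shift (phi a)) (r *: v) - h (phi a))).
  by apply/funext => r; rewrite /= phiE.
apply: DeriveDef; first by rewrite /derivable E.
by rewrite -hv /derive E.
Qed.

Lemma integral_derive1_eq0 (F f : R -> R) : (forall t : R, is_derive t (1 : R) F (f t)) ->
  continuous f -> F 1 = F 0 -> (\int[unif]_t (f t)%:E = 0)%E.
Proof.
move=> dF cf F10.
have mf : measurable_fun setT f := continuous_measurable_fun cf.
rewrite integral_unif; last exact: (measurableT_comp _ mf).
have cF : continuous F.
  move=> t; apply/differentiable_continuous/derivable1_diffP.
  exact: ex_derive.
rewrite (@continuous_FTC2 _ f F)//.
- by rewrite F10 subee.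
- exact: continuous_subspaceT.
- split.
  + by move=> t _; apply: ex_derive.
  + by apply: cvg_at_right_filter; exact: cF.
  + by apply: cvg_at_left_filter; exact: cF.
- by move=> t _; rewrite derive1E derive_val.
Qed.

Lemma consT_head n (t r : R) (x : Tn R n) :
  consT (r *: 1 + t, x) = r *: (delta_mx ord0 ord0 : Tn R n.+1) + consT (t, x).
Proof.
apply/rowP => i; rewrite !mxE eqxx /=; case: unliftP => [j ->|->] /=.
  by rewrite mulr0 add0r.
by [].
Qed.

Lemma consT_tail n (t r : R) (x : Tn R n) j :
  consT (t, r *: (delta_mx ord0 j : Tn R n) + x) =
  r *: (delta_mx ord0 (lift ord0 j) : Tn R n.+1) + consT (t, x).
Proof.
apply/rowP => i; rewrite !mxE eqxx /=; case: unliftP => [k ->|->] /=.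
  by rewrite !mxE eqxx (inj_eq lift_inj).
by rewrite mulr0 add0r.
Qed.

Lemma consT_continuous_tail n (t : R) : continuous (fun x : Tn R n => consT (t, x)).
Proof.
move=> x; apply/(@cvgrPdist_le _ _ _ (nbhs x) (nbhs_filter x)) => e e0; near=> y.
rewrite /Num.norm/= mx_normrE; apply: bigmax_le => [|[i j] _]; first exact: ltW.
rewrite /= !mxE; case: unliftP => [k _|_] /=; last by rewrite subrr normr0 ltW.
have : `|x - y| <= e by near: y; apply: (@cvgr_dist_le _ _ _ (nbhs x) (nbhs_filter x) id x (@cvg_id _ _)).
apply: le_trans; rewrite [leRHS]/Num.norm/= mx_normrE.
have := @le_bigmax _ _ _ 0 (fun ij => `|(x - y) ij.1 ij.2|) (ord0, k).
by rewrite /= !mxE.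
Unshelve. all: by end_near. Qed.

Lemma consT_continuous_head n (x : Tn R n) : continuous (fun t : R => consT (t, x)).
Proof.
move=> t; apply/cvgrPdist_le => e e0; near=> s.
rewrite /Num.norm/= mx_normrE; apply: bigmax_le => [|[i j] _]; first exact: ltW.
rewrite /= !mxE; case: unliftP => [k _|_] /=; first by rewrite subrr normr0 ltW.
by near: s; apply: (@cvgr_dist_le _ _ _ (nbhs t) (nbhs_filter t) id t (@cvg_id _ _)).
Unshelve. all: by end_near. Qed.

Lemma bounded_integrable_haar n (f : Tn R n -> R) M : measurable_fun setT f ->
  (forall x, `|f x| <= M) -> (haar R n).-integrable setT (EFin \o f).
Proof.
move=> mf fM.
apply: (le_integrable _ _ _ (finite_measure_integrable_cst (haar R n) M _)) => //.
  exact/measurable_EFinP.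
by move=> x _ /=; rewrite lee_fin (le_trans (fM x))// ler_norm.
Qed.

                                                                        
                                                                                 
Lemma integral_derive_eq0 n (i : 'I_n) (h h' : Tn R n -> R) (M : R) :
  (forall x, is_derive x (delta_mx ord0 i : Tn R n) h (h' x)) ->
  continuous h' -> (forall x, `|h' x| <= M) ->
  (forall x, h (x + delta_mx ord0 i) = h x) ->
  (\int[haar R n]_x (h' x)%:E = 0)%E.
Proof.
elim: n i h h' => [[]//|n IH] i h h' dh ch' bh' ph.
have ih' : (haar R n.+1).-integrable setT (EFin \o h').
  by apply: bounded_integrable_haar bh'; exact: continuous_meas.
rewrite integral_haarS//.
have ih := integrable_haarS ih'.
                                                                           
                                                
case: (unliftP ord0 i) => [j iE|iE]; last first.
  rewrite -(integral21_prod_meas1 ih) /fubini_G /=.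
  rewrite (eq_integral (cst 0%E)) ?integral0// => x _.
  apply: (@integral_derive1_eq0 (fun t => h (consT (t, x))) (fun t : R => h' (consT (t, x)))).
  - move=> t; apply: (is_derive_along (phi := fun t => consT (t, x)) (v := delta_mx ord0 ord0)).
      by move=> r; rewrite consT_head.
    by rewrite -iE.
  - by move=> t; exact: (continuous_comp (@consT_continuous_head n x t) (ch' _)).
  - rewrite -[in RHS](ph (consT (0, x))) iE; congr h.
    by have := consT_head 0 1 x; rewrite addr0 !scale1r addrC.
rewrite -(integral12_prod_meas1 ih) /fubini_F /=.
rewrite (eq_integral (cst 0%E)) ?integral0// => t _.
apply: (IH j (fun x => h (consT (t, x))) (fun x => h' (consT (t, x)))) => //.
- move=> x; apply: (is_derive_along (phi := fun x => consT (t, x)) (v := delta_mx ord0 (lift ord0 j))).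
    by move=> r; rewrite consT_tail.
  by rewrite -iE.
- by move=> x; exact: (continuous_comp (@consT_continuous_tail n t x) (ch' _)).
- move=> x; rewrite -[in RHS](ph (consT (t, x))) iE; congr h.
  by have := consT_tail t 1 x j; rewrite !scale1r addrC [RHS]addrC.
Qed.

End derivative_integral.

Section characters.
Variable R : realType.
Variable n : nat.
Implicit Types (x y w : Tn R n) (k l : Zn n).

Lemma e2piD (a b : R) : e2pi (a + b) = e2pi a * e2pi b.
Proof.
rewrite /e2pi mulrDr cosD sinD; congr (_ +i* _).
by rewrite addrC.
Qed.

Lemma e2pi0 : e2pi (0 : R) = 1.
Proof. by rewrite /e2pi mulr0 cos0 sin0. Qed.

Lemma conj_e2pi (a : R) : conjc (e2pi a) = e2pi (- a).
Proof. by rewrite /e2pi mulrN cosN sinN. Qed.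

Lemma cmod_e2pi (a : R) : cmod (e2pi a) = 1.
Proof. by rewrite cmodE /= cos2Dsin2 sqrtr1. Qed.

Lemma e2pi_nat (m : nat) : e2pi (m%:R : R) = 1.
Proof.
elim: m => [|m IH]; first exact: e2pi0.
rewrite -natr1 e2piD IH mul1r /e2pi mulr1 mulrC mulr_natr cos2pi.
by rewrite sin2pi.
Qed.

Lemma e2pi_int (z : int) : e2pi (z%:~R : R) = 1.
Proof.
case: z => m; first by rewrite -pmulrn e2pi_nat.
by rewrite NegzE rmorphN /= -conj_e2pi -pmulrn e2pi_nat conjc1.
Qed.

Lemma dotDr x k l : dot x (k + l) = dot x k + dot x l.
Proof. by rewrite /dot -big_split; apply: eq_bigr => i _; rewrite mxE rmorphD /= mulrDr. Qed.

Lemma dotNr x k : dot x (- k) = - dot x k.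
Proof. by rewrite /dot -sumrN; apply: eq_bigr => i _; rewrite mxE rmorphN /= mulrN. Qed.

Lemma dotBr x k l : dot x (k - l) = dot x k - dot x l.
Proof. by rewrite dotDr dotNr. Qed.

Lemma dotDl x y k : dot (x + y) k = dot x k + dot y k.
Proof. by rewrite /dot -big_split; apply: eq_bigr => i _; rewrite mxE mulrDl. Qed.

Lemma dotNl x k : dot (- x) k = - dot x k.
Proof. by rewrite /dot -sumrN; apply: eq_bigr => i _; rewrite mxE mulNr. Qed.

Lemma dotBl x y k : dot (x - y) k = dot x k - dot y k.
Proof. by rewrite dotDl dotNl. Qed.

Lemma dotZl (r : R) x k : dot (r *: x) k = r * dot x k.
Proof. by rewrite /dot mulr_sumr; apply: eq_bigr => i _; rewrite mxE mulrA. Qed.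

Lemma dot_delta i k : dot (delta_mx ord0 i : Tn R n) k = (k ord0 i)%:~R.
Proof.
rewrite /dot (bigD1 i)//= mxE !eqxx mul1r big1 ?addr0// => j ji.
by rewrite mxE (negbTE ji) andbF mul0r.
Qed.

Lemma dot_intT k l : e2pi (dot (intT R k) l) = 1.
Proof.
rewrite (_ : dot _ _ = (\sum_i (k ord0 i * l ord0 i))%:~R) ?e2pi_int//.
by rewrite rmorph_sum /dot /=; apply: eq_bigr => i _; rewrite mxE rmorphM.
Qed.

Lemma continuous_dot l : continuous (fun x => dot x l).
Proof.
rewrite /dot; elim: (index_enum _) => [|i r IH] x.
  by under eq_fun do rewrite big_nil; exact: cst_continuous.
rewrite (_ : (fun x => _) = (fun x => x ord0 i * (l ord0 i)%:~R) + (fun x => \sum_(j <- r) x ord0 j * (l ord0 j)%:~R)); last first.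
  by apply/funext => y; rewrite big_cons.
apply: continuousD; last exact: IH.
by apply: continuousM; [exact: (@coord_continuous _ _ _ ord0 i x)|exact: cst_continuous].
Qed.

                                                                  
                                                                      
Definition trig (f : R -> R) l (phi : R) x : R := f (2 * pi * dot x l + phi).

Lemma continuous_trig f l phi : continuous f -> continuous (trig f l phi).
Proof.
move=> cf x; apply: (continuous_comp (f := fun x => 2 * pi * dot x l + phi)); last exact: cf.
apply: continuousD; last exact: cst_continuous.
by apply: continuousM; [exact: cst_continuous|exact: continuous_dot].
Qed.

Lemma is_derive_trig (f f' : R -> R) l phi x i :
  (forall t, is_derive t (1 : R) f (f' t)) ->
  is_derive x (delta_mx ord0 i : Tn R n) (trig f l phi)
    (2 * pi * (l ord0 i)%:~R * trig f' l phi x).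
Proof.
move=> df.
have d1 := df (2 * pi * dot x l + phi).
apply: (is_derive_along (phi := fun x => 2 * pi * dot x l + phi) (v := 2 * pi * (l ord0 i)%:~R)).
  by move=> r; rewrite dotDl dotZl dot_delta /GRing.scale/=; ring.
rewrite /trig; set v := 2 * pi * _%:~R; set a := 2 * pi * _ + phi in d1 *.
have [dd dv] := d1.
have d2 : differentiable f a by apply/derivable1_diffP.
apply: DeriveDef; first exact: diff_derivable.
rewrite deriveE// -[v in 'd f a v]mulr1 -[v * 1]/(v *: (1 : R)) linearZ /=.
by rewrite -deriveE// dv.
Qed.

Lemma continuous_char_Re l : continuous (fun x => complex.Re (e2pi (dot x l))).
Proof.
rewrite (_ : (fun x => _) = trig (@cos R) l 0); first exact/continuous_trig/continuous_cos.
by apply/funext => x; rewrite /trig addr0.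
Qed.

Lemma continuous_char_Im l : continuous (fun x => complex.Im (e2pi (dot x l))).
Proof.
rewrite (_ : (fun x => _) = trig (@sin R) l 0); first exact/continuous_trig/continuous_sin.
by apply/funext => x; rewrite /trig addr0.
Qed.

Lemma cmeas_char l : cmeasurable (fun x => e2pi (dot x l)).
Proof. by split; apply: continuous_meas; [exact: continuous_char_Re|exact: continuous_char_Im]. Qed.

Lemma trig_bound (f : R -> R) l phi x : (forall t, `|f t| <= 1) -> `|trig f l phi x| <= 1.
Proof. by move=> ?; rewrite /trig. Qed.

Lemma cos_norm_le1 (t : R) : `|cos t| <= 1.
Proof. by rewrite ler_norml cos_le1 cos_geN1. Qed.

Lemma sin_norm_le1 (t : R) : `|sin t| <= 1.
Proof. by rewrite ler_norml sin_le1 sin_geN1. Qed.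

                                                                             
                                                                 
Lemma integral_trig_eq0 (f f' : R -> R) l phi : l != 0 ->
  (forall t, is_derive t (1 : R) f (f' t)) -> continuous f' ->
  (forall t, `|f' t| <= 1) -> (forall t, f (t + 2 * pi) = f t) ->
  (\int[haar R n]_x (trig f' l phi x)%:E = 0)%E.
Proof.
move=> l0 df cf' bf' pf.
have [i li] : exists i, l ord0 i != 0.
  apply: contrapT => h; case/eqP: l0; apply/rowP => i; rewrite mxE.
  by apply/eqP; apply: contrapT => li; apply: h; exists i; apply/negP.
have pfz (z : int) t : f (t + 2 * pi * z%:~R) = f t.
  have pfn (m : nat) u : f (u + 2 * pi * m%:R) = f u.
    elim: m => [|m IH]; first by rewrite mulr0 addr0.
    by rewrite -(natr1 m) mulrDr mulr1 addrA pf.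
  case: z => m; first by rewrite -pmulrn pfn.
  by have := pfn m.+1 (t - 2 * pi * m.+1%:R); rewrite subrK => ->; rewrite NegzE rmorphN /= mulrN -pmulrn.
have h := @integral_derive_eq0 R n i (trig f l phi) (fun x => 2 * pi * (l ord0 i)%:~R * trig f' l phi x)
  `|2 * pi * (l ord0 i)%:~R|.
have {h} : (\int[haar R n]_x (2 * pi * (l ord0 i)%:~R * trig f' l phi x)%:E = 0)%E.
  apply: h.
  - by move=> x; exact: is_derive_trig.
  - by apply: fun_continuousM; [exact: cst_continuous|exact: continuous_trig].
  - by move=> x; rewrite normrM ler_piMr// trig_bound.
  - move=> x; rewrite /trig dotDl dot_delta mulrDr addrAC; exact: pfz.
under eq_integral do rewrite EFinM.
rewrite integralZl//; last first.
  apply: (@bounded_integrable_haar _ _ (trig f' l phi) 1).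
    exact: (continuous_meas (continuous_trig cf')).
  by move=> x; exact: trig_bound.
move/eqP; rewrite mule_eq0 eqe !mulf_eq0 intr_eq0 (negbTE li) pnatr_eq0 /= orbF.
by rewrite gt_eqF ?pi_gt0//= => /eqP.
Qed.

Lemma integral_trig_cos l phi : l != 0 -> (\int[haar R n]_x (trig (@cos R) l phi x)%:E = 0)%E.
Proof.
move=> l0; apply: (@integral_trig_eq0 (@sin R)) => //.
- exact: continuous_cos.
- exact: cos_norm_le1.
- by move=> t; rewrite mulr_natl sinD2pi.
Qed.

Lemma integral_trig_sin l phi : l != 0 -> (\int[haar R n]_x (trig (@sin R) l phi x)%:E = 0)%E.
Proof.
move=> l0; apply: (@integral_trig_eq0 (fun t => - cos t)) => //.
- by move=> t; rewrite -[sin t]opprK; apply: is_deriveN.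
- exact: continuous_sin.
- exact: sin_norm_le1.
- by move=> t; rewrite mulr_natl cosD2pi.
Qed.

Lemma cintegral_char l : cintegral (haar R n) (fun x => e2pi (dot x l)) = (l == 0)%:R.
Proof.
have [->|l0] := eqVneq l 0.
  rewrite (_ : (fun x => _) = (fun=> 1%:C)).
    rewrite cintegral_real Rintegral_cst// mul1r.
    by rewrite [X in fine X](_ : _ = 1%E) //; exact: probability_setT.
  by apply/funext => x; rewrite -[0](subrr 0) dotBr subrr e2pi0.
rewrite /cintegral /Rintegral.
rewrite (eq_integral (fun x => (trig (@cos R) l 0 x)%:E)); last by move=> x _; rewrite /trig addr0.
rewrite integral_trig_cos//.
rewrite (eq_integral (fun x => (trig (@sin R) l 0 x)%:E)); last by move=> x _; rewrite /trig addr0.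
by rewrite integral_trig_sin.
Qed.

Lemma char_orth k l :
  cintegral (haar R n) (fun x => e2pi (dot x k) * conjc (e2pi (dot x l))) = (k == l)%:R.
Proof.
rewrite -subr_eq0 -cintegral_char; apply: cintegral_ext => x.
by rewrite conj_e2pi -e2piD dotBr.
Qed.

Lemma char_orthN k l :
  cintegral (haar R n) (fun x => e2pi (- dot x k) * conjc (e2pi (- dot x l))) = (k == l)%:R.
Proof.
rewrite eq_sym -char_orth; apply: cintegral_ext => x.
by rewrite !conj_e2pi opprK mulrC.
Qed.

Lemma cmeas_charN l : cmeasurable (fun x => e2pi (- dot x l)).
Proof.
by have := cmeas_conj (cmeas_char l); under eq_fun do rewrite conj_e2pi.
Qed.

End characters.

                                                                         

Section sign_iteration.
Variable R : realType.

                                                                              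
                                                                      
                                                                               
Fixpoint sign_iter (N : nat) (t : R) : R :=
  if N is N.+1 then (3 * sign_iter N t - sign_iter N t ^+ 3) / 2 else t.

Lemma sign_iterN N t : sign_iter N (- t) = - sign_iter N t.
Proof. by elim: N => //= N ->; ring. Qed.

                                                                        
                                                                              
                                                     
Lemma sign_iter_gt0 N t : 0 < t -> t <= 1 ->
  t <= sign_iter N t <= 1 /\ 1 - sign_iter N t <= (1 - t / 2) ^+ N.
Proof.
move=> t0 t1; elim: N => [|N [/andP[ts s1] h]] /=; first by rewrite lexx t1 expr0; split => //; lra.
set s := sign_iter N t in ts s1 h *.
split.
  apply/andP; split; rewrite -subr_ge0.
    have -> : (3 * s - s ^+ 3) / 2 - t = (s - t) + s * (1 - s) * (1 + s) / 2 by field.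
    by rewrite addr_ge0 ?subr_ge0// divr_ge0// !mulr_ge0//; lra.
  have -> : 1 - (3 * s - s ^+ 3) / 2 = (1 - s) ^+ 2 * (2 + s) / 2 by field.
  by rewrite divr_ge0// mulr_ge0 ?sqr_ge0//; lra.
have -> : 1 - (3 * s - s ^+ 3) / 2 = (1 - s / 2 - s ^+ 2 / 2) * (1 - s) by field.
rewrite [leRHS]exprS; apply: (@le_trans _ _ ((1 - t / 2) * (1 - s))).
  by rewrite ler_wpM2r ?subr_ge0//; have := sqr_ge0 s; lra.
by rewrite ler_wpM2l//; lra.
Qed.

Lemma sign_iter0 N : sign_iter N 0 = 0.
Proof. by elim: N => //= N ->; rewrite expr0n mulr0 subr0 mul0r. Qed.

Lemma sign_iter_le1 N t : `|t| <= 1 -> `|sign_iter N t| <= 1.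
Proof.
move=> ht; have [t0|t0|->] := ltgtP t 0.
- have := @sign_iter_gt0 N (- t); rewrite sign_iterN oppr_gt0.
  rewrite ltr0_norm// in ht => /(_ t0 ht) [/andP[h1 h2] _].
  by rewrite -normrN ger0_norm//; lra.
- rewrite gtr0_norm// in ht; have [/andP[h1 h2] _] := @sign_iter_gt0 N t t0 ht.
  by rewrite ger0_norm//; lra.
- by rewrite sign_iter0 normr0.
Qed.

Lemma sign_iter_cvg t : `|t| <= 1 -> sign_iter N t @[N --> \oo] --> Num.sg t.
Proof.
have pos u : 0 < u -> u <= 1 -> sign_iter N u @[N --> \oo] --> (1 : R).
  move=> u0 u1; rewrite -[X in _ --> X]subr0.
  rewrite (_ : (fun N => _) = (fun N => 1 - (1 - sign_iter N u))); last first.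
    by apply/funext => N; rewrite opprB addrC subrK.
  apply: cvgB; first exact: cvg_cst.
  apply: (@squeeze_cvgr _ _ _ _ (cst 0) (fun N => (1 - u / 2) ^+ N)).
  - apply: nearW => N; have [/andP[_ h] h'] := @sign_iter_gt0 N u u0 u1.
    by rewrite subr_ge0 h h'.
  - exact: cvg_cst.
  - by apply: cvg_expr; rewrite ger0_norm; lra.
move=> ht; have [t0|t0|->] := ltgtP t 0.
- rewrite ltr0_norm// in ht; rewrite ltr0_sg//.
  rewrite (_ : (fun N => _) = (fun N => - sign_iter N (- t))); last first.
    by apply/funext => N; rewrite sign_iterN opprK.
  by apply: cvgN; apply: pos => //; rewrite oppr_gt0.
- by rewrite gtr0_norm// in ht; rewrite gtr0_sg//; exact: pos.
- by rewrite sgr0; under eq_fun do rewrite sign_iter0; exact: cvg_cst.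
Qed.

End sign_iteration.

Section fourier_uniqueness.
Variables (R : realType) (n : nat).
Implicit Types (f : Tn R n -> R) (l : Zn n).

                                                                         
                                                                           
                                                                         
                                                     
Definition trig_orth f := (haar R n).-integrable setT (EFin \o f) /\
  forall l phi, (\int[haar R n]_x (f x * trig (@cos R) l phi x)%:E = 0)%E.

Lemma integrable_mul_bounded f (h : Tn R n -> R) : (haar R n).-integrable setT (EFin \o f) ->
  measurable_fun setT h -> (forall x, `|h x| <= 1) ->
  (haar R n).-integrable setT (EFin \o (fun x => f x * h x)).
Proof.
move=> fi mh h1; apply: (le_integrable _ _ _ fi) => //.
  apply/measurable_EFinP; apply: measurable_funM => //.
  by apply/measurable_EFinP; exact: measurable_int fi.
by move=> x _ /=; rewrite lee_fin normrM ler_piMr.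
Qed.

Lemma measurable_trig_cos l phi : measurable_fun setT (trig (@cos R) l phi).
Proof. exact: (continuous_meas (continuous_trig (@continuous_cos R))). Qed.

Lemma trig_cos_le1 l phi (x : Tn R n) : `|trig (@cos R) l phi x| <= 1.
Proof. by apply: trig_bound; exact: cos_norm_le1. Qed.

Lemma integrable_trig f l phi : (haar R n).-integrable setT (EFin \o f) ->
  (haar R n).-integrable setT (EFin \o (fun x => f x * trig (@cos R) l phi x)).
Proof.
by move=> fi; apply: integrable_mul_bounded => //; [exact: measurable_trig_cos|move=> x; exact: trig_cos_le1].
Qed.

Lemma trig_orthD f g : trig_orth f -> trig_orth g -> trig_orth (fun x => f x + g x).
Proof.
move=> [fi fo] [gi go]; split; first exact: (integrableD measurableT fi gi).
move=> l phi; under eq_integral do rewrite mulrDl EFinD.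
rewrite integralD//; [|exact: (integrable_trig l phi fi)|exact: (integrable_trig l phi gi)].
by rewrite fo go adde0.
Qed.

Lemma trig_orthZ (r : R) f : trig_orth f -> trig_orth (fun x => r * f x).
Proof.
move=> [fi fo]; split; first exact: (integrableZl measurableT r fi).
move=> l phi; under eq_integral do rewrite -mulrA EFinM.
rewrite integralZl//; last exact: (integrable_trig l phi fi).
by rewrite fo mule0.
Qed.

Lemma trig_orth_lim (f_ : nat -> Tn R n -> R) f (g : Tn R n -> R) :
  (forall N, trig_orth (f_ N)) -> (haar R n).-integrable setT (EFin \o g) ->
  (forall N x, `|f_ N x| <= g x) -> (forall x, f_ N x @[N --> \oo] --> f x) ->
  trig_orth f.
Proof.
move=> fo gi fg fl.
have mf_ N : measurable_fun setT (f_ N).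
  by apply/measurable_EFinP; have [fi _] := fo N; exact: measurable_int fi.
have mf : measurable_fun setT f.
  by apply: (measurable_fun_cvg (h := f_)) => // x _; exact: fl.
split.
  apply: (le_integrable _ _ _ gi) => //; first exact/measurable_EFinP.
  move=> x _ /=; rewrite lee_fin (@ger0_norm _ (g x)); last by apply: le_trans (fg 0%N x).
  have fn : `|f_ N x| @[N --> \oo] --> `|f x| by apply: cvg_norm; exact: fl.
  rewrite -(cvg_lim (@Rhausdorff R) fn); apply: limr_le; first exact: cvgP fn.
  by apply: nearW => N /=; exact: fg.
move=> l phi.
have /(_ _ _ _)[] := @dominated_convergence _ _ _ (haar R n) setT measurableT
  (fun N x => (f_ N x * trig (@cos R) l phi x)%:E) (fun x => (f x * trig (@cos R) l phi x)%:E) (fun x => (g x)%:E).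
- move=> N; apply/measurable_EFinP; apply: measurable_funM => //; exact: measurable_trig_cos.
- apply/measurable_EFinP; apply: measurable_funM => //; exact: measurable_trig_cos.
- apply: aeW => x _; apply: cvg_EFin; first exact: nearW.
  by apply: cvgM; [exact: fl|exact: cvg_cst].
- exact: gi.
- apply: aeW => x N _; rewrite lee_fin normrM.
  apply: le_trans (fg N x); rewrite ler_piMr//; exact: trig_cos_le1.
move=> _ _; rewrite (_ : (fun N => _) = cst 0%E); last first.
  by apply/funext => N /=; have [_ ->] := fo N.
by move=> /(cvg_lim (@ereal_hausdorff R)) <-; exact: lim_cst.
Qed.

Lemma trig_orth_ae f f' : measurable_fun setT f' ->
  {ae haar R n, forall x, f x = f' x} -> trig_orth f -> trig_orth f'.
Proof.
move=> mf' ff' [fi fo].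
have mf : measurable_fun setT f by apply/measurable_EFinP; exact: measurable_int fi.
split.
  apply/integrableP; split; first exact/measurable_EFinP.
  case/integrableP : fi => _.
  rewrite (@ae_eq_integral _ _ _ (haar R n) setT (fun x => `|(EFin \o f') x|%E) (fun x => `|(EFin \o f) x|%E))//.
  - by apply: measurableT_comp => //; exact/measurable_EFinP.
  - by apply: measurableT_comp => //; exact/measurable_EFinP.
  - by apply: filterS ff' => x /= -> _.
move=> l phi; rewrite -(fo l phi).
apply: ae_eq_integral => //.
- by apply/measurable_EFinP; apply: measurable_funM => //; exact: measurable_trig_cos.
- by apply/measurable_EFinP; apply: measurable_funM => //; exact: measurable_trig_cos.
- by apply: filterS ff' => x /= -> _.
Qed.

                                                                      
                              
Lemma trig_orth_cos f e psi : trig_orth f ->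
  trig_orth (fun x => f x * trig (@cos R) e psi x).
Proof.
move=> [fi fo]; split; first exact: integrable_trig.
move=> l phi.
rewrite (eq_integral (fun x => ((2^-1)%:E * ((f x * trig (@cos R) (l + e) (phi + psi) x)%:E + (f x * trig (@cos R) (l - e) (phi - psi) x)%:E))%E)); last first.
  move=> x _; rewrite -EFinD -EFinM -mulrDr /trig dotDr dotBr; congr (_%:E).
  rewrite [X in cos X + _](_ : _ = (2 * pi * dot x l + phi) + (2 * pi * dot x e + psi)); last by ring.
  rewrite [X in _ + cos X](_ : _ = (2 * pi * dot x l + phi) - (2 * pi * dot x e + psi)); last by ring.
  set A := 2 * pi * dot x l + phi; set B := 2 * pi * dot x e + psi.
  by rewrite (cosD A B) (cosB A B); field.
rewrite integralZl//; last first.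
  by apply: integrableD => //; [exact: (integrable_trig (l + e) (phi + psi) fi)|exact: (integrable_trig (l - e) (phi - psi) fi)].
rewrite integralD//; [|exact: (integrable_trig (l + e) (phi + psi) fi)|exact: (integrable_trig (l - e) (phi - psi) fi)].
by rewrite !fo adde0 mule0.
Qed.

                                                                              
                                                                       
              
Lemma trig_orth_superlevel f e psi (theta : R) : `|theta| <= 1 -> trig_orth f ->
  trig_orth (fun x => f x * (theta < trig (@cos R) e psi x)%R%:R).
Proof.
move=> th fo.
pose t x := (trig (@cos R) e psi x - theta) / 2.
have t1 x : `|t x| <= 1.
  rewrite /t normrM (@ger0_norm _ 2^-1)// ler_pdivrMr// mul1r.
  by rewrite (le_trans (ler_normB _ _))//; have := trig_cos_le1 e psi x; lra.
                                                                         
              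
have step0 h : trig_orth h -> trig_orth (fun x => h x * t x).
  move=> ho; rewrite (_ : (fun x => _) = (fun x => 2^-1 * (h x * trig (@cos R) e psi x) + (- theta / 2) * h x)).
    by apply: trig_orthD; apply: trig_orthZ => //; exact: trig_orth_cos.
  by apply/funext => x; rewrite /t; field.
have stepN N : forall h, trig_orth h -> trig_orth (fun x => h x * sign_iter N (t x)).
  elim: N => [|N IH] h ho; first exact: step0.
  rewrite (_ : (fun x => _) = (fun x => (3 / 2) * (h x * sign_iter N (t x)) +
     (- 2^-1) * (h x * sign_iter N (t x) * sign_iter N (t x) * sign_iter N (t x)))).
    by apply: trig_orthD; apply: trig_orthZ; [exact: IH|exact: (IH _ (IH _ (IH _ ho)))].
  by apply/funext => x /=; field.
have step h : trig_orth h -> trig_orth (fun x => h x * Num.sg (t x)).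
  move=> ho; apply: (@trig_orth_lim (fun N x => h x * sign_iter N (t x)) _ (fun x => `|h x|)).
  - by move=> N; exact: stepN.
  - by case: ho => hi _; exact: integrable_norm hi.
  - by move=> N x; rewrite normrM ler_piMr// sign_iter_le1.
  - by move=> x; apply: cvgM; [exact: cvg_cst|exact: sign_iter_cvg].
rewrite (_ : (fun x => _) = (fun x => 2^-1 * (f x * Num.sg (t x)) + 2^-1 * (f x * Num.sg (t x) * Num.sg (t x)))).
  by apply: trig_orthD; apply: trig_orthZ; [exact: step|exact: (step _ (step _ fo))].
apply/funext => x.
have -> : Num.sg (t x) = Num.sg (trig (@cos R) e psi x - theta).
  by rewrite /t sgrM (@gtr0_sg _ 2^-1)// mulr1.
have [lt|lt|->] := ltgtP theta (trig (@cos R) e psi x).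
- by rewrite gtr0_sg ?subr_gt0//= !mulr1; field.
- by rewrite ltr0_sg ?subr_lt0//= mulr0; field.
- by rewrite subrr sgr0 !mulr0 addr0.
Qed.

Lemma dot0r (x : Tn R n) : dot x 0 = 0.
Proof. by rewrite /dot big1// => i _; rewrite mxE mulr0. Qed.

Lemma trig_orth_test f : trig_orth f -> (\int[haar R n]_x (f x)%:E = 0)%E.
Proof.
move=> [_ fo]; rewrite -(fo 0 0); apply: eq_integral => x _.
by rewrite /trig dot0r mulr0 addr0 cos0 mulr1.
Qed.

Lemma trig_orth_indic0 f : trig_orth f -> trig_orth (fun=> 0).
Proof. by move=> /(trig_orthZ 0); under eq_fun do rewrite mul0r. Qed.

Definition trig_orth_set (A : set (Tn R n)) := forall f, trig_orth f ->
  trig_orth (fun x => f x * \1_A x).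

                                                                       
                                      
Lemma sigma_algebra_trig_orth_set : sigma_algebra [set: Tn R n] trig_orth_set.
Proof.
split.
- move=> f fo; apply: trig_orth_ae (trig_orth_indic0 fo).
    by under eq_fun do rewrite indic0 /= mulr0; exact: measurable_cst.
  by apply: aeW => x; rewrite indic0 /= mulr0.
- move=> A AO f fo; rewrite (_ : (fun x => _) = (fun x => f x + (-1) * (f x * \1_A x))).
    by apply: trig_orthD => //; apply: trig_orthZ; exact: AO.
  by apply/funext => x; rewrite setTD !indicE in_setC; case: (x \in A) => /=; ring.
- move=> A AO.
  pose B N := \big[setU/set0]_(i < N) A i.
  have BO N : trig_orth_set (B N).
    rewrite /B; elim: N => [|N IH] f fo.
      rewrite (_ : (fun x => _) = (fun=> 0)); first exact: trig_orth_indic0 fo.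
      by apply/funext => x; rewrite big_ord0 indic0 mulr0.
    rewrite big_ord_recr /=.
    set C := \big[_/_]_(_ < _) _ in IH *.
    rewrite (_ : (fun x => _) = (fun x => (f x * \1_C x + f x * \1_(A N) x) + (-1) * (f x * \1_C x * \1_(A N) x))).
      apply: trig_orthD; first by apply: trig_orthD; [exact: IH|exact: AO].
      by apply: trig_orthZ; exact: AO (IH _ fo).
    apply/funext => x; rewrite !indicE in_setU.
    by case: (x \in C); case: (x \in A N) => /=; ring.
  move=> f fo; apply: (@trig_orth_lim (fun N x => f x * \1_(B N) x) _ (fun x => `|f x|)).
  + by move=> N; exact: BO.
  + by case: fo => fi _; exact: integrable_norm fi.
  + by move=> N x; rewrite normrM ler_piMr// indicE; case: (_ \in _); rewrite ?normr1 ?normr0.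
  + move=> x; apply: cvgM; first exact: cvg_cst.
    have [[k _ Akx]|no] := pselect ((\bigcup_k A k) x).
      apply: (@cvg_near_cst _ _ _ _ _); near=> N.
      have Bx : B N x.
        rewrite /B -bigcup_mkord; exists k => //=.
        by near: N; exists k.+1.
      by rewrite !indicE (mem_set Bx) mem_set//; exists k.
    apply: (@cvg_near_cst _ _ _ _ _); apply: nearW => N.
    have nB : ~ B N x.
      by rewrite /B -bigcup_mkord => -[k kN Akx]; apply: no; exists k.
    by rewrite !indicE !memNset.
Unshelve. all: by end_near. Qed.

End fourier_uniqueness.

Section haar_coordinates.
Variable R : realType.

Notation unif := (uniform_prob (@ltr01 R)).

Lemma haar_coord n (i : 'I_n) (B : set R) : measurable B ->
  haar R n [set x : Tn R n | B (x ord0 i)] = unif B.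
Proof.
elim: n i => [[]//|n IH] i mB.
have -> : haar R n.+1 [set x : Tn R n.+1 | B (x ord0 i)] =
   (unif \x haar R n)%E [set z | B ((consT z) ord0 i)] by [].
case: (unliftP ord0 i) => [j iE|iE].
  rewrite (_ : [set z | _] = setT `*` [set x : Tn R n | B (x ord0 j)]).
    rewrite product_measure1E//; last first.
      by rewrite -[X in measurable X]setTI; exact: measurable_coordT.
    rewrite [X in (X * _)%E](_ : _ = 1%E) ?mul1e; first exact: IH.
    exact: (@probability_setT _ _ _ unif).
  apply/seteqP; split => -[t x] /=; rewrite /consT mxE iE liftK//.
  by case.
rewrite (_ : [set z | _] = B `*` setT).
  rewrite product_measure1E//.
  rewrite [X in (_ * X)%E](_ : _ = 1%E) ?mule1//.
  exact: (@probability_setT _ _ _ (haar R n)).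
apply/seteqP; split => -[t x] /=; rewrite /consT mxE iE unlift_none//.
by case.
Qed.

Lemma unif_out : unif (~` `]0, 1[%classic) = 0%E.
Proof.
rewrite /uniform_prob integral_uniform_pdf.
have sub : ~` `]0%R, 1[%classic `&` `[0%R, 1]%classic `<=` [set 0; 1 : R].
  move=> t [/= h1]; rewrite !in_itv/= in h1 * => /andP[t0 t1].
  move/negP: h1; rewrite negb_and -!leNgt => /orP[h|h]; [left|right]; apply/eqP; lra.
rewrite null_set_integral//.
- by apply: measurableI => //; exact: measurableC.
- have m := @measurable_uniform_pdf R 0 1.
  by apply: measurable_funTS; exact: (measurableT_comp _ m).
- apply: countable_lebesgue_measure0.
  by apply: sub_countable (subset_card_le sub) _; exact: finite_set_countable.
Qed.

Lemma haar_interior n (i : 'I_n) :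
  {ae haar R n, forall x : Tn R n, 0 < x ord0 i < 1}.
Proof.
exists [set x : Tn R n | (~` `]0%R, 1[%classic) (x ord0 i)]; split.
- rewrite -[X in measurable X]setTI; apply: measurable_coordT => //.
  exact: measurableC.
- by rewrite -[RHS]unif_out; apply: haar_coord; exact: measurableC.
- by move=> x /=; rewrite in_itv /=.
Qed.

                                                                              
                                       
Lemma cos_arc (a x : R) : 0 < a < 1 -> 0 < x < 1 ->
  (cos (pi * a) < cos (2 * pi * x - pi * a)) = (x < a).
Proof.
move=> /andP[a0 a1] /andP[x0 x1]; have p0 := @pi_gt0 R.
have pa : pi * a \in `[0, pi].
  by rewrite in_itv/= mulr_ge0 ?ler_piMr// ltW.
set u := 2 * pi * x - pi * a.
have ua : u - pi * a = 2 * pi * (x - a) by rewrite /u; ring.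
have [xa|ax] := ltP x a.
  have : cos `|u| = cos u.
    by case: (ger0P u) => // _; rewrite cosN.
  have un : `|u| < pi * a.
    rewrite ltr_norml; apply/andP; split; rewrite -subr_gt0.
      have -> : u - - (pi * a) = 2 * pi * x by rewrite /u; ring.
      by rewrite !mulr_gt0.
    have -> : pi * a - u = 2 * pi * (a - x) by rewrite /u; ring.
    by rewrite !mulr_gt0// subr_gt0.
  move=> <-; rewrite ltr_cos// in_itv/= normr_ge0/=.
  by rewrite (le_trans (ltW un))// ler_piMr// ltW.
apply/negbTE; rewrite -leNgt.
have pu : pi * a <= u.
  by rewrite -subr_ge0 ua !mulr_ge0 ?subr_ge0// ltW.
have lec (v : R) : pi * a <= v -> v <= pi -> cos v <= cos (pi * a).
  rewrite le_eqVlt => /predU1P[<-//|av] vp; apply: ltW; rewrite ltr_cos//.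
  by rewrite in_itv/= vp andbT (le_trans _ (ltW av))// mulr_ge0 ?(ltW p0) ?(ltW a0).
have [up|up] := leP u pi; first exact: lec.
have -> : cos u = cos (2 * pi - u).
  by have := cosD2pi (u - 2 * pi); rewrite -(mulr_natl pi) subrK => ->; rewrite -cosN opprB.
apply: lec; last by lra.
rewrite -subr_ge0 (_ : _ - _ = 2 * pi * (1 - x)); last by rewrite /u; ring.
by rewrite !mulr_ge0 ?subr_ge0// ltW.
Qed.

Lemma dot_unit n (i : 'I_n) (x : Tn R n) : dot x (delta_mx ord0 i : Zn n) = x ord0 i.
Proof.
rewrite /dot (bigD1 i)//= mxE !eqxx mulr1 big1 ?addr0// => j ji.
by rewrite mxE (negbTE ji) andbF mulr0.
Qed.

                                                                         
                                
Lemma trig_orth_set_ray n (i : 'I_n) (a : R) :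
  trig_orth_set [set x : Tn R n | x ord0 i < a].
Proof.
move=> f fo.
have mf : measurable_fun setT f.
  by case: fo => fi _; apply/measurable_EFinP; exact: measurable_int fi.
have mfa : measurable_fun setT (fun x : Tn R n => f x * \1_[set x : Tn R n | x ord0 i < a] x).
  apply: measurable_funM => //; apply: measurable_indic.
  rewrite -[X in measurable X]setTI (_ : [set x | _] = (fun x : Tn R n => x ord0 i) @^-1` `]-oo, a[%classic).
    exact: measurable_coordT.
  by apply/seteqP; split => x /=; rewrite in_itv.
have [a0|a0] := leP a 0.
  apply: trig_orth_ae mfa _ (trig_orth_indic0 fo).
  apply: filterS (haar_interior i) => x /andP[x0 _].
  by rewrite indicE memNset ?mulr0//= => /lt_le_trans/(_ a0); rewrite ltNge (ltW x0).
have [a1|a1] := leP 1 a.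
  apply: trig_orth_ae mfa _ fo.
  apply: filterS (haar_interior i) => x /andP[_ x1].
  by rewrite indicE mem_set ?mulr1//=; exact: lt_le_trans x1 a1.
apply: trig_orth_ae mfa _ (@trig_orth_superlevel _ _ f (delta_mx ord0 i) (- (pi * a)) (cos (pi * a)) (cos_norm_le1 _) fo).
apply: filterS (haar_interior i) => x xi; congr (_ * _).
by rewrite /trig dot_unit cos_arc ?a0// indicE mem_setE.
Qed.

                                                                        
Lemma trig_orth_set_measurable n (A : set (Tn R n)) : measurable A -> trig_orth_set A.
Proof.
move=> mA; suff : measurable `<=` @trig_orth_set R n by exact.
apply: smallest_sub; first exact: sigma_algebra_trig_orth_set.
case: n A mA => [|n] A mA; first by rewrite big_ord0.
rewrite -bigcup_mkord_ord; apply: bigcup_sub => i Ii _ [D mD <-]; rewrite setTI.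
pose P := [set D : set R | trig_orth_set ((fun x : Tn R n.+1 => x ord0 (inord i)) @^-1` D)].
have sP : sigma_algebra setT P.
  have [s0 sC sU] := @sigma_algebra_trig_orth_set R n.+1; split.
  - by rewrite /P/= preimage_set0.
  - by move=> B PB; rewrite /P/= setTD preimage_setC -setTD; exact: sC.
  - by move=> B PB; rewrite /P/= preimage_bigcup; exact: sU.
suff : measurable `<=` P by move/(_ D mD).
rewrite [X in X `<=` _]RGenInftyO.measurableE.
apply: smallest_sub => // B [a ->]; rewrite /P/=.
rewrite (_ : _ @^-1` _ = [set x : Tn R n.+1 | x ord0 (inord i) < a]).
  exact: trig_orth_set_ray.
by apply/seteqP; split => x /=; rewrite in_itv.
Qed.

                                                                              
                    
Theorem trig_orth_eq0 n (f : Tn R n -> R) : trig_orth f ->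
  {ae haar R n, forall x, f x = 0}.
Proof.
move=> fo; have [fi _] := fo.
have := @integral_ae_eq _ _ _ (haar R n) setT measurableT (cst 0%E) (EFin \o f) fi (measurable_cst _).
have h E : E `<=` setT -> measurable E -> (\int[haar R n]_(x in E) (EFin \o f) x = \int[haar R n]_(x in E) cst 0 x)%E.
  move=> _ mE; rewrite integral0 integral_mkcond -[RHS](trig_orth_test (trig_orth_set_measurable mE fo)).
  by apply: eq_integral => x _; rewrite patchE indicE; case: (x \in E); rewrite ?mulr1 ?mulr0.
by move/(_ h); apply: filterS => x /= /(_ I) [].
Qed.

Lemma unif_itv_gt0 (a b : R) : 0 <= a -> a < 1 -> a < b -> (0 < unif `[a, b[%classic)%E.
Proof.
move=> a0 a1 ab.
have -> : unif `[a, b[%classic = lebesgue_measure (`[a, b[%classic `&` `[0%R, 1%R]%classic).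
  have <- : (\int[unif]_x (\1_(`[a, b[%classic : set R) x)%:E = unif `[a, b[%classic)%E.
    by rewrite integral_indic// setIT.
  have mi : measurable_fun setT (\1_(`[a, b[%classic : set R) : R -> R) by exact: measurable_indic.
  by rewrite integral_unif ?integral_indic//; exact: (measurableT_comp _ mi).
apply: (@lt_le_trans _ _ (lebesgue_measure `[a, Num.min b 1[%classic)).
  by rewrite lebesgue_measure_itv/= lte_fin lt_min ab a1 -EFinD lte_fin subr_gt0 lt_min ab.
apply: le_measure; rewrite ?inE//; first exact: measurableI.
move=> t /=; rewrite !in_itv/= lt_min => /andP[h /andP[h1 h2]].
by rewrite h h1 (le_trans a0 h) ltW.
Qed.

                                                                            
                                                                                 
Lemma haar_box_gt0 n (a b : 'I_n -> R) : (forall i, [/\ 0 <= a i, a i < 1 & a i < b i]) ->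
  measurable [set x : Tn R n | forall i, a i <= x ord0 i < b i] /\
  (0 < haar R n [set x : Tn R n | forall i, (a i <= x ord0 i < b i)%R])%E.
Proof.
have mbox m (c d : 'I_m -> R) : measurable [set x : Tn R m | forall i, c i <= x ord0 i < d i].
  rewrite (_ : [set x | _] = \bigcap_(i in [set: 'I_m]) ((fun x : Tn R m => x ord0 i) @^-1` `[c i, d i[%classic)).
    apply: fin_bigcap_measurable => // i _; rewrite -[X in measurable X]setTI.
    exact: measurable_coordT.
  by apply/seteqP; split => x /= h i => [_|]; have := h i; rewrite /= in_itv //; exact.
move=> ab; split => //.
elim: n a b ab => [|n IH] a b ab.
  rewrite (_ : [set x | _] = setT); first by rewrite [ltRHS](@probability_setT _ _ _ (haar R 0)).
  by apply/seteqP; split => // x _ [].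
have -> : haar R n.+1 [set x : Tn R n.+1 | forall i, a i <= x ord0 i < b i] =
   (unif \x haar R n)%E [set z | forall i, a i <= (consT z) ord0 i < b i] by [].
rewrite (_ : [set z | _] = `[a ord0, b ord0[%classic `*`
  [set x : Tn R n | forall j, a (lift ord0 j) <= x ord0 j < b (lift ord0 j)]).
  rewrite product_measure1E//; last exact: (mbox n).
  have [h1 h2 h3] := ab ord0.
  by apply: mule_gt0; [exact: unif_itv_gt0|apply: IH => j; exact: ab].
apply/seteqP; split => -[t x] /= h.
  split; first by have := h ord0; rewrite mxE unlift_none in_itv.
  by move=> j; have := h (lift ord0 j); rewrite mxE liftK.
move=> i; rewrite mxE; case: (unliftP ord0 i) => [j|] ->; first by case: h => _; exact.
by case: h; rewrite in_itv.
Qed.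

                                                                             
                                                                            
                             
Lemma continuous_periodic_ae0 n (f : Tn R n -> R) : continuous f ->
  (forall x l, f (x + intT R l) = f x) ->
  {ae haar R n, forall x, f x = 0} -> forall x, f x = 0.
Proof.
move=> cf pf [N [mN N0 sN]] x0; apply: contrapT => fx0.
pose y : Tn R n := x0 + intT R (- \row_i Num.floor (x0 ord0 i) : Zn n).
have fy : f y != 0 by apply/eqP; rewrite pf.
have y01 i : 0 <= y ord0 i < 1.
  rewrite !mxE rmorphN /= subr_ge0 floor_le/= ltrBlDl.
  by have := floorD1_gt (x0 ord0 i); rewrite intrD addrC.
have : \forall z \near nbhs y, f z != 0.
  have := cf y [set t | t != 0]; apply.
  apply: open_nbhs_nbhs; split => //; exact: open_neq.
move=> /(@nbhs_normP R (Tn R n))[e /= e0 he].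
have [|mB B0] := @haar_box_gt0 n (fun i => y ord0 i) (fun i => y ord0 i + e).
  by move=> i; have /andP[-> ->] := y01 i; rewrite ltrDl.
have : (0 < haar R n N)%E.
  apply: (lt_le_trans B0); apply: le_measure; rewrite ?inE//.
  move=> z /= hz; apply: sN => /= fz; have : f z != 0.
    apply: he; rewrite /ball_/= distrC /Num.norm/= mx_normrE.
    apply: bigmax_lt => // -[j i] _; rewrite !mxE (ord1 j).
    have := hz i; rewrite !mxE => /andP[h1 h2].
    by rewrite ger0_norm ?subr_ge0// ltrBlDl.
  by rewrite fz eqxx.
by rewrite N0 ltxx.
Qed.

End haar_coordinates.

                                   

Section lattice_summability.
Variable R : realType.

                                                                            
                               
Definition zigzag (j : nat) : int := if odd j then Negz j./2 else Posz j./2.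
Definition zagzig (z : int) : nat := match z with Posz m => m.*2 | Negz m => m.*2.+1 end.

Lemma zigzagK : cancel zigzag zagzig.
Proof.
move=> j; rewrite /zigzag; case: ifPn => oj /=.
  by rewrite -[RHS](odd_double_half j) oj.
by rewrite -[RHS](odd_double_half j) (negbTE oj).
Qed.

Lemma zagzigK : cancel zagzig zigzag.
Proof.
case=> m /=; rewrite /zigzag /= ?odd_double /= ?doubleK//.
by rewrite uphalf_double.
Qed.

Lemma zigzag_norm j : (j.+1%:R : R) <= 2 * (1 + `|(zigzag j)%:~R|).
Proof.
rewrite /zigzag -[in leLHS](odd_double_half j).
case: (odd j).
  rewrite NegzE rmorphN normrN /= -pmulrn ger0_norm//.
  by rewrite add1n -!natr1 -muln2 natrM; have := ler0n R j./2; lra.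
rewrite add0n -pmulrn ger0_norm// -natr1 -muln2 natrM.
by have := ler0n R j./2; lra.
Qed.

Definition muN : set nat -> \bar R := @counting nat R.

HB.instance Definition _ := Measure.on muN.

HB.instance Definition _ :=
  @Measure_isSigmaFinite.Build _ _ _ muN (sigma_finite_counting R).

Lemma counting_like_nat : counting_like muN.
Proof.
split => //; first by apply/countable_injP; exists id.
by move=> i; rewrite /muN /counting /= asboolT// fset_set1 finmap.cardfs1.
Qed.

                                                                       
Lemma integral_zigzag :
  (\int[muN]_j (((1 + `|(zigzag j)%:~R|) ^- 2)%:E) < +oo)%E.
Proof.
have a0 k : (0 <= ((1 + `|(zigzag k)%:~R|) ^- 2 : R)%:E)%E.
  by rewrite lee_fin invr_ge0 exprn_ge0// addr_ge0.
rewrite /muN ge0_integral_count//.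
apply: (@le_lt_trans _ _ (8%:E : \bar R)); last exact: ltry.
apply: lime_le; first by apply: is_cvg_nneseries.
apply: nearW => N /=.
rewrite sumEFin lee_fin.
apply: (@le_trans _ _ (\sum_(0 <= k < N) 8 * (k.+1%:R^-1 - k.+2%:R^-1))).
  apply: ler_sum => k _.
  have kz := zigzag_norm k.
  have z0 : (0 : R) < 1 + `|(zigzag k)%:~R| by rewrite ltr_pwDl.
  have k1 : (0 : R) < k.+1%:R by [].
  have k2 : (0 : R) < k.+2%:R by [].
  have -> : k.+1%:R^-1 - k.+2%:R^-1 = (k.+1%:R * k.+2%:R)^-1 :> R.
    rewrite -(natr1 k.+1) in k2 *; set a := k.+1%:R in k1 k2 *.
    by field; rewrite !gt_eqF.
  rewrite -[leLHS]mul1r ler_pdivrMr ?exprn_gt0// mulrAC ler_pdivlMr ?mulr_gt0// mul1r.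
  have : (k.+1%:R : R) ^+ 2 <= (2 * (1 + `|(zigzag k)%:~R|)) ^+ 2.
    by rewrite ler_sqr ?nnegrE ?mulr_ge0 ?(ltW z0).
  have : (k.+1%:R : R) * k.+2%:R <= 2 * k.+1%:R ^+ 2.
    have : (1 : R) <= k.+1%:R by rewrite ler1n.
    by rewrite -(natr1 k.+1); set a := k.+1%:R => a1; nra.
  by rewrite exprMn; lra.
rewrite -mulr_sumr.
under eq_bigr do rewrite -[X in X - _]opprK addrC.
rewrite (@telescope_sumr _ 0 N (fun k => - k.+1%:R^-1))// opprK invr1.
have : (0 : R) <= N.+1%:R^-1 by [].
by set a := _^-1 => a0'; lra.
Qed.

Lemma integral_zigzag_ge0 : (0 <= \int[muN]_j (((1 + `|(zigzag j)%:~R|) ^- 2)%:E))%E.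
Proof. by apply: integral_ge0 => k _; rewrite lee_fin invr_ge0 exprn_ge0// addr_ge0. Qed.

Definition consZ n (z : nat * Zn n) : Zn n.+1 :=
  \row_(i < n.+1) if unlift ord0 i is Some j then z.2 ord0 j else zigzag z.1.

Definition unconsZ n (k : Zn n.+1) : nat * Zn n :=
  (zagzig (k ord0 ord0), \row_j k ord0 (lift ord0 j)).

Lemma consZK n : cancel (@consZ n) (@unconsZ n).
Proof.
move=> [j k]; rewrite /unconsZ /consZ; congr pair.
  by rewrite mxE unlift_none zigzagK.
by apply/rowP => i; rewrite !mxE liftK.
Qed.

Lemma unconsZK n : cancel (@unconsZ n) (@consZ n).
Proof.
move=> k; apply/rowP => i; rewrite mxE /=.
by case: (unliftP ord0 i) => [j|] ->; rewrite ?mxE ?zagzigK.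
Qed.

                                                                         
                                                                 
Definition weight n (k : Zn n) : R := \prod_i (1 + `|(k ord0 i)%:~R|) ^- 2.

Lemma weight_ge0 n (k : Zn n) : 0 <= weight k.
Proof. by apply: prodr_ge0 => i _; rewrite invr_ge0 exprn_ge0// addr_ge0. Qed.

Lemma integral_weight n : (\int[muZ R n]_k (weight k)%:E < +oo)%E.
Proof.
elim: n => [|n IH].
  rewrite (integral_delta (counting_like_muZ R 0) (i := 0)) ?ltry//.
  by move=> x /eqP[]; apply/rowP => -[].
have cl := counting_like_prod counting_like_nat (counting_like_muZ R n).
rewrite -(counting_like_bij cl (counting_like_muZ R n.+1) (@consZK n) (@unconsZK n)); last first.
  by move=> x; rewrite lee_fin weight_ge0.
have mN d (Y : measurableType d) (f : nat -> Y) : measurable_fun setT f.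
  exact: (counting_like_meas counting_like_nat).
have mZ d (Y : measurableType d) (f : Zn n -> Y) : measurable_fun setT f.
  exact: (counting_like_meas (counting_like_muZ R n)).
rewrite fubini_tonelli1//; last 2 first.
- exact: (counting_like_meas cl).
- by move=> x; rewrite lee_fin weight_ge0.
rewrite (eq_integral (fun j => ((1 + `|(zigzag j)%:~R|) ^- 2)%:E * \int[muZ R n]_k (weight k)%:E)%E); last first.
  move=> j _; rewrite -ge0_integralZl; [|by []|exact: mZ|by move=> k _; rewrite lee_fin weight_ge0|by rewrite lee_fin invr_ge0 exprn_ge0// addr_ge0].
  apply: eq_integral => k _; rewrite -EFinM /weight big_ord_recl; congr (_ * _)%:E.
    by rewrite mxE unlift_none.
  by apply: eq_bigr => i _; rewrite mxE liftK.
rewrite ge0_integralZr; [|by []|exact: mN|by move=> j _; rewrite lee_fin invr_ge0 exprn_ge0// addr_ge0|by apply: integral_ge0 => k _; rewrite lee_fin weight_ge0].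
apply: lte_mul_pinfty.
- exact: integral_zigzag_ge0.
- by rewrite ge0_fin_numE ?integral_zigzag// integral_zigzag_ge0.
- exact: IH.
Qed.

Lemma znorm_ge0 n (k : Zn n) : 0 <= znorm R k.
Proof. by apply: sumr_ge0. Qed.

Definition bracket n (k : Zn n) : R := 1 + znorm R k.

Lemma bracket_ge1 n (k : Zn n) : 1 <= bracket k.
Proof. by rewrite lerDl znorm_ge0. Qed.

Lemma bracket_gt0 n (k : Zn n) : 0 < bracket k.
Proof. exact: lt_le_trans ltr01 (bracket_ge1 k). Qed.

Lemma bracketX_gt0 n (k : Zn n) N : 0 < bracket k ^+ N.
Proof. by rewrite exprn_gt0// bracket_gt0. Qed.

Lemma bracketX_ge1 n (k : Zn n) N : 1 <= bracket k ^+ N.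
Proof. by rewrite exprn_ege1// bracket_ge1. Qed.

Lemma bracket_coord n (k : Zn n) i : 1 + `|(k ord0 i)%:~R| <= bracket k.
Proof.
rewrite lerD2l /znorm (bigD1 i)//= lerDl.
by apply: sumr_ge0.
Qed.

Lemma bracketD n (k l : Zn n) : bracket (k + l) <= bracket k * bracket l.
Proof.
apply: (@le_trans _ _ (1 + (znorm R k + znorm R l))).
  rewrite lerD2l /znorm -big_split /=; apply: ler_sum => i _.
  by rewrite mxE rmorphD ler_normD.
by rewrite /bracket; have := znorm_ge0 k; have := znorm_ge0 l; nra.
Qed.

Lemma bracketX_le n (k : Zn n) N M : (N <= M)%N -> bracket k ^+ N <= bracket k ^+ M.
Proof. by move=> NM; apply: ler_weXn2l => //; exact: bracket_ge1. Qed.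

                                                                             
                             
Lemma bracket_weight n (k : Zn n) : bracket k ^- (n.*2) <= weight k.
Proof.
have w0 i : 0 < 1 + `|(k ord0 i)%:~R| :> R by rewrite ltr_pwDl.
rewrite /weight prodfV lef_pV2 ?posrE ?bracketX_gt0//; last first.
  by apply: prodr_gt0 => i _; rewrite exprn_gt0.
rewrite -muln2 mulnC exprM -[X in _ ^+ X](card_ord n) -prodr_const.
apply: ler_prod => i _; rewrite exprn_ge0 ?(ltW (w0 i))//=.
by rewrite ler_sqr ?nnegrE ?(ltW (w0 i)) ?(ltW (bracket_gt0 _)) ?bracket_coord.
Qed.

Lemma integrable_bracket n : (muZ R n).-integrable setT (fun k => (bracket k ^- (n.*2))%:E).
Proof.
have cl := counting_like_muZ R n.
apply/integrableP; split; first exact: (counting_like_meas cl).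
apply: le_lt_trans (integral_weight n).
apply: ge0_le_integral => //; try exact: (counting_like_meas cl).
by move=> k _; rewrite /= lee_fin ger0_norm ?bracket_weight// invr_ge0 ltW// bracketX_gt0.
Qed.

End lattice_summability.

                                                       

Section square_norms.
Context d (T : measurableType d) (R : realType).
Variable mu : {measure set T -> \bar R}.

                                                            
Definition sqnorm (f : T -> R[i]) : \bar R := (\int[mu]_x (cmod (f x) ^+ 2)%:E)%E.

Lemma sqnorm_ge0 f : (0 <= sqnorm f)%E.
Proof. by apply: integral_ge0 => x _; rewrite lee_fin sqr_ge0. Qed.

Lemma normLp2E f : normLp mu 2%:E f = (sqnorm f `^ 2^-1)%E.
Proof.
rewrite /normLp unlock; congr (_ `^ _)%E; apply: eq_integral => x _.
by rewrite /= ger0_norm ?cmod_ge0// powR_mulrn ?cmod_ge0.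
Qed.

Lemma normLp2_fin f : (sqnorm f < +oo)%E ->
  normLp mu 2%:E f = (Num.sqrt (fine (sqnorm f)))%:E.
Proof.
move=> fl; rewrite normLp2E -[in LHS](@fineK _ (sqnorm f)) ?ge0_fin_numE ?sqnorm_ge0//.
by rewrite poweR_EFin powR12_sqrt// fine_ge0// sqnorm_ge0.
Qed.

Lemma normLp2_lty f : ((normLp mu 2%:E f < +oo) = (sqnorm f < +oo))%E.
Proof.
have [l|] := ltP (sqnorm f) +oo%E; first by rewrite normLp2_fin// ltry.
by rewrite leye_eq normLp2E => /eqP ->; rewrite poweRyr ?ltxx// invr_eq0 pnatr_eq0.
Qed.

Lemma inLp2P f : inLp mu 2%:E f <-> cmeasurable f /\ (sqnorm f < +oo)%E.
Proof. by rewrite /inLp normLp2_lty. Qed.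

Lemma normLp1E f : normLp mu 1%:E f = (\int[mu]_x (cmod (f x))%:E)%E.
Proof.
rewrite /normLp Lnorm1; apply: eq_integral => x _.
by rewrite /= ger0_norm ?cmod_ge0.
Qed.

End square_norms.

Section counting_sqnorm.
Context d (I : measurableType d) (R : realType).
Variable mu : {measure set I -> \bar R}.
Hypothesis muI : counting_like mu.

                                                                             
           
Lemma counting_like_sqnorm_lty (c : I -> R[i]) : cintegrable mu c -> (sqnorm mu c < +oo)%E.
Proof.
move=> ci; apply: le_lt_trans (_ : \int[mu]_k ((\int[mu]_k cmod (c k))%:E * (cmod (c k))%:E) < +oo)%E.
  apply: ge0_le_integral => //; try exact: (counting_like_meas muI).
  - by move=> k _; rewrite lee_fin sqr_ge0.
  - move=> k _; rewrite -EFinM lee_fin expr2 ler_wpM2r ?cmod_ge0//.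
    by apply: (point_le_Rintegral muI k (integrable_cmod ci)) => x; exact: cmod_ge0.
exact: (integrable_lty measurableT (integrableZl measurableT _ (integrable_cmod ci))).
Qed.

Lemma counting_like_sqnorm_gt0 (c : I -> R[i]) i : c i != 0 -> (0 < sqnorm mu c)%E.
Proof.
move=> ci; apply: (@lt_le_trans _ _ (cmod (c i) ^+ 2)%:E).
  by rewrite lte_fin exprn_gt0// lt_def cmod_ge0 andbT cmod_eq0.
by apply: (point_le_integral muI (f := fun i => (cmod (c i) ^+ 2)%:E)) => x; rewrite lee_fin sqr_ge0.
Qed.

Lemma counting_like_sqnorm_bound (c : I -> R[i]) i : (sqnorm mu c < +oo)%E ->
  cmod (c i) <= Num.sqrt (fine (sqnorm mu c)).
Proof.
move=> cl; rewrite -[leLHS]ger0_norm ?cmod_ge0// -sqrtr_sqr ler_wsqrtr//.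
rewrite -lee_fin fineK ?ge0_fin_numE ?sqnorm_ge0//.
by apply: (point_le_integral muI (f := fun i => (cmod (c i) ^+ 2)%:E)) => x; rewrite lee_fin sqr_ge0.
Qed.

End counting_sqnorm.

Section schwartz_lattice.
Variables (R : realType) (n : nat).
Implicit Types (f h : Zn n -> R[i]) (u : (Zn n -> R[i]) -> R[i]) (k m : Zn n).

Local Notation muZ := (muZ R n).
Let muZc := counting_like_muZ R n.

Lemma seminormZ_le N f (C : R) : (forall k, bracket R k ^+ N * cmod (f k) <= C) ->
  (seminormZ N f <= C%:E)%E.
Proof. by move=> fC; apply: ge_ereal_sup => _ [k _ <-]; rewrite lee_fin; exact: fC. Qed.

Lemma schwartzZP f : schwartzZ f <->
  (forall N, exists C : R, forall k, bracket R k ^+ N * cmod (f k) <= C).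
Proof.
split=> fS N; last by have [C fC] := fS N; apply: le_lt_trans (seminormZ_le fC) (ltry _).
exists (fine (seminormZ N f)) => k.
have le k' : ((bracket R k' ^+ N * cmod (f k'))%:E <= seminormZ N f)%E.
  by apply: ereal_sup_ubound; exists k'.
rewrite -lee_fin fineK//; rewrite ge0_fin_numE; first exact: fS.
by apply: le_trans (le 0); rewrite lee_fin mulr_ge0 ?cmod_ge0// ltW// bracketX_gt0.
Qed.

Lemma schwartzZ_lin (a : R[i]) f h : schwartzZ f -> schwartzZ h ->
  schwartzZ (fun k => a * f k + h k).
Proof.
move=> /schwartzZP fS /schwartzZP hS; apply/schwartzZP => N.
have [C1 f1] := fS N; have [C2 h2] := hS N.
exists (cmod a * C1 + C2) => k.
apply: le_trans (ler_wpM2l _ (cmodD _ _)) _; first by rewrite ltW// bracketX_gt0.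
rewrite mulrDr lerD// cmodM mulrCA ler_wpM2l ?cmod_ge0//.
Qed.

Definition deltaZ k : Zn n -> R[i] := fun j => (j == k)%:R.

Lemma cmod_nat (b : bool) : cmod (b%:R : R[i]) = b%:R.
Proof. by case: b; rewrite ?cmod1 ?cmod0. Qed.

Lemma schwartzZ_delta k : schwartzZ (deltaZ k).
Proof.
apply/schwartzZP => N; exists (bracket R k ^+ N) => j.
rewrite /deltaZ cmod_nat; have [->|_] := eqVneq j k; first by rewrite mulr1.
by rewrite mulr0 ltW// bracketX_gt0.
Qed.

Lemma schwartzZ0 : schwartzZ (fun _ : Zn n => 0 : R[i]).
Proof. by apply/schwartzZP => N; exists 0 => k; rewrite cmod0 mulr0. Qed.

                                                                            
Lemma schwartzZ_weighted f N : schwartzZ f ->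
  muZ.-integrable setT (EFin \o (fun k => bracket R k ^+ N * cmod (f k))).
Proof.
move=> /schwartzZP/(_ (N + n.*2)%N)[C fC].
have iC := integrableZl measurableT C (integrable_bracket R n).
apply: (le_integrable _ _ _ iC) => //.
move=> k _ /=; rewrite lee_fin !ger0_norm.
- rewrite -ler_pdivrMr ?invr_gt0 ?bracketX_gt0// invrK mulrAC -exprD.
  exact: fC.
- rewrite mulr_ge0 ?invr_ge0 ?(ltW (bracketX_gt0 _ _ _))//.
  by apply: le_trans (fC 0); rewrite mulr_ge0 ?cmod_ge0// ltW// bracketX_gt0.
- by rewrite mulr_ge0 ?cmod_ge0// ltW// bracketX_gt0.
Qed.

Lemma schwartzZ_integrable f : schwartzZ f -> cintegrable muZ f.
Proof.
move=> fS; apply: (cintegrable_le (g := fun k => bracket R k ^+ 0 * cmod (f k))).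
- exact: (counting_like_cmeas muZc).
- exact: schwartzZ_weighted.
- by move=> k; rewrite expr0 mul1r.
Qed.

Lemma temperedZ_bound u : temperedZ u -> exists (N : nat) (c : R), 0 <= c /\
  forall f C, schwartzZ f -> (forall k, bracket R k ^+ N * cmod (f k) <= C) ->
    cmod (u f) <= c * C.
Proof.
move=> [_ [N [c uc]]]; exists N, `|c|; split=> // f C fS fC.
have C0 : 0 <= C.
  by apply: le_trans (fC 0); rewrite mulr_ge0 ?cmod_ge0// ltW// bracketX_gt0.
have s0 : (0 <= seminormZ N f)%E.
  apply: (@le_trans _ _ (bracket R (0 : Zn n) ^+ N * cmod (f 0))%:E).
    by rewrite lee_fin mulr_ge0 ?cmod_ge0// ltW// bracketX_gt0.
  by apply: ereal_sup_ubound; exists 0.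
rewrite -lee_fin; apply: le_trans (uc f fS) _.
rewrite EFinM; apply: (@le_trans _ _ (`|c|%:E * seminormZ N f)%E).
  by apply: lee_wpmul2r => //; rewrite lee_fin ler_norm.
by apply: lee_wpmul2l; [rewrite lee_fin|exact: seminormZ_le].
Qed.

                                                                         
                                 
Lemma temperedZ_expansion u f : temperedZ u -> schwartzZ f ->
  cintegrable muZ (fun k => f k * funZ u k) /\
  u f = cintegral muZ (fun k => f k * funZ u k).
Proof.
move=> ut fS; have [N [c [c0 uc]]] := temperedZ_bound ut.
have [ul _] := ut.
have iw := @schwartzZ_weighted f N fS.
have fui : cintegrable muZ (fun k => f k * funZ u k).
  apply: (cintegrable_le (g := fun k => c * (bracket R k ^+ N * cmod (f k)))).
  - exact: (counting_like_cmeas muZc).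
  - exact: (integrableZl measurableT c iw).
  - move=> k; rewrite cmodM mulrA mulrC ler_wpM2r ?cmod_ge0//.
    apply: uc; first exact: schwartzZ_delta.
    move=> j; rewrite cmod_nat; have [->|_] := eqVneq j k; first by rewrite mulr1.
    by rewrite mulr0 ltW// bracketX_gt0.
split => //.
have [p [q [pK qK]]] := counting_like_index muZc.
apply: (@functional_expansion _ _ _ muZ muZc p q pK qK _ (@schwartzZ R n) u deltaZ f f _ c) => //.
- exact: schwartzZ0.
- exact: schwartzZ_lin.
- exact: schwartzZ_delta.
- exact: iw.
move=> L.
have PE y : - partial_sum q deltaZ f L y + f y = f y * (L <= p y)%:R.
  rewrite (@partial_sumE _ _ _ muZ muZc p q pK qK _ deltaZ f L y); last first.
    apply: (cintegrable_le (g := fun k => cmod (f k))).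
    - exact: (counting_like_cmeas muZc).
    - exact/integrable_cmod/schwartzZ_integrable.
    - by move=> k; rewrite cmodM cmod_nat ler_piMr ?cmod_ge0//; case: (_ == _).
  rewrite (cintegral_delta muZc (i := y)); last first.
    by move=> x xy; rewrite /deltaZ eq_sym (negbTE xy) mulr0 mul0r.
  rewrite /deltaZ eqxx mulr1 (leqNgt L); case: (p y < L)%N => /=.
    by rewrite mulr1 mulr0 addNr.
  by rewrite mulr1 mulr0 oppr0 add0r.
apply: uc.
  have := schwartzZ_lin (-1) (partial_sum_closed q f L schwartzZ0 schwartzZ_lin schwartzZ_delta) fS.
  by under eq_fun do rewrite mulN1r.
move=> k; rewrite PE cmodM cmod_nat mulrA.
apply: (point_le_Rintegral muZc k (integrable_above muZc p L iw)) => x.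
by rewrite !mulr_ge0 ?cmod_ge0// ltW// bracketX_gt0.
Qed.

Lemma schwartzZ_test g (m : Zn n) (w : Tn R n) : schwartzZ g ->
  schwartzZ (fun k => conjc (modulation w (translation m g) k)).
Proof.
move=> /schwartzZP gS; apply/schwartzZP => N; have [C gC] := gS N.
exists (bracket R m ^+ N * C) => k.
rewrite cmod_conj cmodM cmod_e2pi mul1r /translation.
apply: (@le_trans _ _ (bracket R m ^+ N * bracket R (k - m) ^+ N * cmod (g (k - m)))).
  rewrite ler_wpM2r ?cmod_ge0// -exprMn lerXn2r ?nnegrE ?mulr_ge0 ?(ltW (bracket_gt0 _ _))//.
  by rewrite -{1}(subrK m k) mulrC bracketD.
by rewrite -mulrA ler_wpM2l// ltW// bracketX_gt0.
Qed.

Lemma stft_distE g u (z : Zn n * Tn R n) : schwartzZ g -> temperedZ u ->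
  cintegrable muZ (fun k => funZ u k * conjc (g (k - z.1))) /\
  stft_dist g u z = cintegral muZ (fun k => funZ u k * conjc (g (k - z.1)) * e2pi (- dot z.2 k)).
Proof.
move=> gS ut; have [i1 e1] := temperedZ_expansion ut (@schwartzZ_test g z.1 z.2 gS).
split.
  apply: (cintegrable_le (g := fun k => cmod (conjc (modulation z.2 (translation z.1 g) k) * funZ u k))).
  - exact: (counting_like_cmeas muZc).
  - exact: integrable_cmod i1.
  - by move=> k; rewrite !cmodM !cmod_conj !cmodM cmod_e2pi mul1r mulrC.
rewrite /stft_dist e1; apply: cintegral_ext => k.
by rewrite /modulation /translation conjcM conj_e2pi; ring.
Qed.

                                                                              
                                                                             
                               
Theorem modulZ_coef g u : schwartzZ g -> (exists k, g k <> 0) -> modulZ g 1%E u ->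
  [/\ cintegrable muZ (funZ u), (sqnorm muZ (funZ u) < +oo)%E,
      (normMZ g 1%E u < +oo)%E &
      (sqnorm muZ (funZ u) * sqnorm muZ g <= normMZ g 1%E u * normMZ g 1%E u)%E].
Proof.
move=> gS [i0 gi0] [ut [mV VL]].
have VE := fun z => stft_distE z gS ut.
have X0 : (0 <= normMZ g 1%E u)%E.
  by rewrite /normMZ normLp1E; apply: integral_ge0 => x _; rewrite lee_fin cmod_ge0.
have XF : normMZ g 1%E u = (fine (normMZ g 1%E u))%:E by rewrite fineK// ge0_fin_numE.
set X := fine _ in XF.
have XE : (\int[muZ]_m \int[haar R n]_w (cmod (cintegral muZ
     (fun k => funZ u k * conjc (g (k - m)) * e2pi (- dot w k))))%:E = X%:E)%E.
  have mcV : measurable_fun setT (fun z => (cmod (stft_dist g u z))%:E).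
    exact/measurable_EFinP/cmeas_cmod.
  have cV0 z : (0 <= (cmod (stft_dist g u z))%:E)%E by rewrite lee_fin cmod_ge0.
  rewrite -XF /normMZ normLp1E [RHS](@fubini_tonelli1 _ _ _ _ R muZ (haar R n) _ mcV cV0).
  apply: eq_integral => m _; apply: eq_integral => w _.
  by have [_ ->] := VE (m, w).
have sl m : exists h : Zn n -> Zn n, cancel (fun k => k - m) h /\ cancel h (fun k => k - m).
  by exists (fun k => k + m); split => k; rewrite ?subrK ?addrK.
have sr (k : Zn n) : cancel (fun m => k - m) (fun m => k - m).
  by move=> m; rewrite opprB addrC subrK.
have gi := schwartzZ_integrable gS.
have cgi m : cintegrable muZ (fun k => funZ u k * conjc (g (k - m))).
  by have [] := VE (m, 0).
have mc (m k : Zn n) := @cmeas_charN R n k.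
have mc1 (m k : Zn n) (w : Tn R n) := cmod_e2pi (- dot w k).
have mco (m k l : Zn n) := @char_orthN R n k l.
have gi0' : g i0 != 0 by apply/eqP.
have fin := stft_coef_integrable muZc sl sr mc mc1 mco gi0' cgi XE.
have l2b := stft_coef_l2 muZc sl sr mc mc1 mco gi gi0' cgi XE.
split => //; first exact: (counting_like_sqnorm_lty muZc fin).
by rewrite XF -EFinM -expr2.
Qed.

End schwartz_lattice.

                                                            

Section smooth_functions.
Variables (R : realType) (n : nat).
Local Notation T := (Tn R n).
Implicit Types (a b h : T -> R) (s : seq 'I_n) (x : T).

Local Notation dir i := (delta_mx ord0 i : T).

Lemma is_derive_lin (c : R) a b x (v : T) da db : is_derive x v a da -> is_derive x v b db ->
  is_derive x v (fun y => c * a y + b y) (c * da + db).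
Proof. by move=> ha hb; exact: (is_deriveD (is_deriveZ c ha) hb). Qed.

Lemma is_derive_mul a b x (v : T) da db : is_derive x v a da -> is_derive x v b db ->
  is_derive x v (fun y => a y * b y) (a x * db + da * b x).
Proof.
by move=> ha hb; rewrite [X in _ + X]mulrC; exact: (is_deriveM ha hb).
Qed.

Lemma partialR_rcons s i h : partialR (rcons s i) h = partialR s ('D_(dir i) h).
Proof. by rewrite /partialR foldr_rcons. Qed.

                                                                            
                                                                           
                 
Definition smooth_upto N h := forall s, (size s <= N)%N ->
  continuous (partialR s h) /\ forall i x, derivable (partialR s h) x (dir i).

Lemma smoothRP h : smoothR h <-> forall N, smooth_upto N h.
Proof. by split=> [hs N s _|hN s]; [exact: hs|exact: (hN (size s))]. Qed.

Lemma smooth_uptoW N M h : (N <= M)%N -> smooth_upto M h -> smooth_upto N h.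
Proof. by move=> NM hM s sN; apply: hM; exact: leq_trans NM. Qed.

Lemma smooth_upto_derive N h i : smooth_upto N.+1 h -> smooth_upto N ('D_(dir i) h).
Proof. by move=> hN s sN; rewrite -partialR_rcons; apply: hN; rewrite size_rcons. Qed.

Lemma smoothR_derive h i : smoothR h -> smoothR ('D_(dir i) h).
Proof. by move=> hs s; rewrite -partialR_rcons; exact: hs. Qed.

Lemma smooth_upto_is_derive N h s i x : smooth_upto N h -> (size s <= N)%N ->
  is_derive x (dir i) (partialR s h) (partialR (i :: s) h x).
Proof. by move=> hN sN; apply: DeriveDef => //; have [_] := hN s sN; apply. Qed.

Lemma smoothR_is_derive h i x : smoothR h -> is_derive x (dir i) h ('D_(dir i) h x).
Proof. by move=> hs; have [_ d] := hs [::]; apply: DeriveDef => //; exact: d. Qed.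

Lemma partialR_lin_upto N (c : R) a b s : smooth_upto N a -> smooth_upto N b ->
  (size s <= N.+1)%N ->
  partialR s (fun x => c * a x + b x) = (fun x => c * partialR s a x + partialR s b x).
Proof.
move=> aN bN; elim: s => //= i s IH sN.
rewrite -/(partialR s _) IH ?(ltnW sN)//; apply/funext => x.
have da := @smooth_upto_is_derive N a s i x aN sN.
have db := @smooth_upto_is_derive N b s i x bN sN.
by have := is_derive_lin c da db; move=> [_ ->].
Qed.

Lemma smooth_upto_lin N (c : R) a b : smooth_upto N a -> smooth_upto N b ->
  smooth_upto N (fun x => c * a x + b x).
Proof.
move=> aN bN s sN; rewrite (partialR_lin_upto c aN bN) ?(leqW sN)//; split.
  have [ca _] := aN s sN; have [cb _] := bN s sN.
  by apply: fun_continuousD => //; apply: fun_continuousM => //; exact: cst_continuous.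
move=> i x.
have da := @smooth_upto_is_derive N a s i x aN sN.
have db := @smooth_upto_is_derive N b s i x bN sN.
by have := is_derive_lin c da db; move=> [].
Qed.

                                                                        
                                       
Lemma derive_mulE a b i : (forall x, derivable a x (dir i)) -> (forall x, derivable b x (dir i)) ->
  'D_(dir i) (fun x => a x * b x) =
  (fun x => 1 * (a x * 'D_(dir i) b x) + 'D_(dir i) a x * b x).
Proof.
move=> da db; apply/funext => x; rewrite mul1r.
by have [_ ->] := is_derive_mul (DeriveDef (da x) erefl) (DeriveDef (db x) erefl).
Qed.

Lemma smooth_upto_mul N a b : smooth_upto N a -> smooth_upto N b ->
  smooth_upto N (fun x => a x * b x).
Proof.
elim: N a b => [|N IH] a b aN bN s sN.
  case: s sN => // _; have [ca da] := aN [::] isT; have [cb db] := bN [::] isT.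
  split; first exact: fun_continuousM.
  move=> i x.
  by have [] := is_derive_mul (DeriveDef (da i x) erefl) (DeriveDef (db i x) erefl).
have [_ da] := aN [::] isT; have [_ db] := bN [::] isT.
case/lastP: s sN => [_|s i].
  have [ca _] := aN [::] isT; have [cb _] := bN [::] isT.
  split; first exact: fun_continuousM.
  move=> i x.
  by have [] := is_derive_mul (DeriveDef (da i x) erefl) (DeriveDef (db i x) erefl).
rewrite size_rcons ltnS => sN; rewrite partialR_rcons (derive_mulE (da i) (db i)).
have aD := IH _ _ (smooth_uptoW (leqnSn N) aN) (smooth_upto_derive i bN).
exact: smooth_upto_lin aD (IH _ _ (smooth_upto_derive i aN) (smooth_uptoW (leqnSn N) bN)) _ sN.
Qed.

Lemma smoothR_lin (c : R) a b : smoothR a -> smoothR b -> smoothR (fun x => c * a x + b x).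
Proof.
by move=> /smoothRP ha /smoothRP hb; apply/smoothRP => N; exact: smooth_upto_lin.
Qed.

Lemma smoothR_mul a b : smoothR a -> smoothR b -> smoothR (fun x => a x * b x).
Proof.
by move=> /smoothRP ha /smoothRP hb; apply/smoothRP => N; exact: smooth_upto_mul.
Qed.

Lemma partialR_lin (c : R) a b s : smoothR a -> smoothR b ->
  partialR s (fun x => c * a x + b x) = (fun x => c * partialR s a x + partialR s b x).
Proof. by move=> /smoothRP ha /smoothRP hb; exact: (partialR_lin_upto c (ha _) (hb _) (leqnSn _)). Qed.

Lemma partialR_cst (c : R) s : partialR s (fun _ : T => c) = (fun=> if s is [::] then c else 0).
Proof.
elim: s => //= i s IH; rewrite -/(partialR s _) IH.
by apply/funext => x; exact: derive_cst.
Qed.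

Lemma smoothR_cst (c : R) : smoothR (fun _ : T => c).
Proof.
move=> s; rewrite partialR_cst; split; first exact: cst_continuous.
by move=> i x; exact: derivable_cst.
Qed.

Lemma partialR_shift (v : T) h s :
  partialR s (fun x => h (x + v)) = (fun x => partialR s h (x + v)).
Proof.
elim: s => //= i s IH; rewrite -/(partialR s _) IH; apply/funext => x.
have E : (fun r : R => r^-1 *: (((fun y => partialR s h (y + v)) \o shift x) (r *: dir i) - partialR s h (x + v))) =
    (fun r : R => r^-1 *: ((partialR s h \o shift (x + v)) (r *: dir i) - partialR s h (x + v))).
  by apply/funext => r; rewrite /= addrA.
by rewrite /derive E.
Qed.

Lemma smoothR_shift (v : T) h : smoothR h -> smoothR (fun x => h (x + v)).
Proof.
move=> hs s; have [ch dh] := hs s; rewrite partialR_shift; split.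
  move=> x; apply: (@continuous_comp _ _ _ (fun x => x + v) (partialR s h)); last exact: ch.
  by apply: continuousD; [exact: cvg_id|exact: cst_continuous].
move=> i x; have := dh i (x + v); rewrite /derivable.
rewrite (_ : (fun r : R => _) = (fun r : R => r^-1 *: (((fun x => partialR s h (x + v)) \o shift x) (r *: dir i) - partialR s h (x + v))))//.
by apply/funext => r; rewrite /= addrA.
Qed.

                                                                     
Lemma partialR_trig (l : Zn n) phi s : partialR s (trig (@cos R) l phi) =
  (fun x => \prod_(i <- s) (2 * pi * (l ord0 i)%:~R) * trig (@cos R) l (phi + (size s)%:R * (pi / 2)) x).
Proof.
elim: s => [|i s IH] /=; first by apply/funext => x; rewrite big_nil mul1r mul0r addr0.
rewrite -/(partialR s _) IH; apply/funext => x.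
have d := @is_derive_trig R n (@cos R) _ l (phi + (size s)%:R * (pi / 2)) x i (@is_derive_cos R).
have d2 := is_deriveZ (\prod_(i <- s) (2 * pi * (l ord0 i)%:~R)) d.
rewrite [LHS](_ : _ = 'D_(dir i) (\prod_(i <- s) (2 * pi * (l ord0 i)%:~R) \*: trig (@cos R) l (phi + (size s)%:R * (pi / 2))) x)//.
rewrite derive_val big_cons /GRing.scale /= /trig.
set p := \prod_(_ <- _) _.
rewrite (_ : 2 * pi * dot x l + (phi + (size s).+1%:R * (pi / 2)) =
   (2 * pi * dot x l + (phi + (size s)%:R * (pi / 2))) + pi / 2); last by rewrite -natr1; ring.
by rewrite cosDpihalf; ring.
Qed.

Lemma smoothR_trig (l : Zn n) phi : smoothR (trig (@cos R) l phi).
Proof.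
move=> s; rewrite partialR_trig; split.
  by apply: fun_continuousM; [exact: cst_continuous|exact/continuous_trig/continuous_cos].
move=> i x.
have d := @is_derive_trig R n (@cos R) _ l (phi + (size s)%:R * (pi / 2)) x i (@is_derive_cos R).
by have [] := is_deriveZ (\prod_(i <- s) (2 * pi * (l ord0 i)%:~R)) d.
Qed.

Lemma trig_sinE (l : Zn n) phi : trig (@sin R) l phi = trig (@cos R) l (phi - pi / 2).
Proof.
apply/funext => x; rewrite /trig addrA -cosN opprB cosB cos_pihalf sin_pihalf.
by rewrite mul0r mul1r add0r.
Qed.

End smooth_functions.

Section decaying_families.
Variables (R : realType) (n : nat) (J : Type).
Local Notation T := (Tn R n).
Implicit Types (W : J -> R) (a b : J -> T -> R).
Local Notation dir i := (delta_mx ord0 i : T).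

                                                                            
                                                                              
                                                                          
                           
Definition decay W a := (forall j, smoothR (a j)) /\
  forall s, exists C, forall j x, W j * `|partialR s (a j) x| <= C.

Lemma decay_lin W (c : R) a b : (forall j, 0 <= W j) -> decay W a -> decay W b ->
  decay W (fun j x => c * a j x + b j x).
Proof.
move=> W0 [as_ ab] [bs bb]; split=> [j|s]; first exact: smoothR_lin.
have [C1 h1] := ab s; have [C2 h2] := bb s; exists (`|c| * C1 + C2) => j x.
rewrite partialR_lin//; apply: le_trans (ler_wpM2l (W0 j) (ler_normD _ _)) _.
by rewrite mulrDr lerD// normrM mulrCA ler_wpM2l.
Qed.

Lemma decay_derive W a i : decay W a -> decay W (fun j => 'D_(dir i) (a j)).
Proof.
move=> [as_ ab]; split=> [j|s]; first exact: smoothR_derive.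
by have [C h] := ab (rcons s i); exists C => j x; have := h j x; rewrite partialR_rcons.
Qed.

Lemma decay_mul W a b : (forall j, 0 <= W j) -> decay W a -> decay (fun=> 1) b ->
  decay W (fun j x => a j x * b j x).
Proof.
move=> W0 da db; split=> [j|s].
  by case: da => as_ _; case: db => bs _; exact: smoothR_mul.
elim/last_ind: s a b da db => [|s i IH] a b da db.
  case: da => _ /(_ [::])[C1 h1]; case: db => _ /(_ [::])[C2 h2].
  exists (C1 * C2) => j x /=; rewrite normrM mulrA.
  have := h2 j x; rewrite mul1r /= => h2'; have h1' := h1 j x.
  by apply: ler_pM => //; rewrite mulr_ge0.
have [as_ _] := da; have [bs _] := db.
have [C1 h1] := IH a (fun j => 'D_(dir i) (b j)) da (decay_derive i db).
have [C2 h2] := IH (fun j => 'D_(dir i) (a j)) b (decay_derive i da) db.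
exists (C1 + C2) => j x; rewrite partialR_rcons derive_mulE; last 2 first.
- by move=> y; have [_] := as_ j [::]; apply.
- by move=> y; have [_] := bs j [::]; apply.
rewrite partialR_lin; last 2 first.
- by apply: smoothR_mul => //; exact: smoothR_derive.
- by apply: smoothR_mul => //; exact: smoothR_derive.
rewrite mul1r; apply: le_trans (ler_wpM2l (W0 j) (ler_normD _ _)) _.
by rewrite mulrDr lerD.
Qed.

Lemma decay_cst W (c : J -> R) (C : R) : (forall j, 0 <= W j) ->
  (forall j, W j * `|c j| <= C) -> decay W (fun j _ => c j).
Proof.
move=> W0 cC; split=> [j|s]; first exact: smoothR_cst.
exists `|C| => j x; rewrite partialR_cst; case: s => [|_ _].
  by apply: le_trans (cC j) _; exact: ler_norm.
by rewrite normr0 mulr0.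
Qed.

Lemma decay_trig (l : Zn n) phi : decay (fun=> 1) (fun _ : J => trig (@cos R) l phi).
Proof.
split=> [j|s]; first exact: smoothR_trig.
exists `|\prod_(i <- s) (2 * pi * (l ord0 i)%:~R)| => j x.
rewrite mul1r partialR_trig normrM ler_piMr//; exact: trig_cos_le1.
Qed.

End decaying_families.

Section decaying_complex_families.
Variables (R : realType) (n : nat) (J : Type).
Local Notation T := (Tn R n).
Implicit Types (W : J -> R) (F H : J -> T -> R[i]).
Local Notation dir i := (delta_mx ord0 i : T).

Definition cdecay W F := decay W (fun j x => complex.Re (F j x)) /\
  decay W (fun j x => complex.Im (F j x)).

Lemma cdecay_ext W F H : (forall j x, F j x = H j x) -> cdecay W F -> cdecay W H.
Proof. by move=> FH; rewrite (_ : F = H)//; apply/funext => j; apply/funext. Qed.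

Lemma cdecay_lin W (c : R[i]) F H : (forall j, 0 <= W j) -> cdecay W F -> cdecay W H ->
  cdecay W (fun j x => c * F j x + H j x).
Proof.
move=> W0 [F1 F2] [H1 H2]; case: c => a b; split.
  rewrite (_ : (fun j x => _) = (fun j x => a * complex.Re (F j x) + ((- b) * complex.Im (F j x) + complex.Re (H j x)))).
    by do 2 apply: decay_lin => //.
  by apply/funext => j; apply/funext => x; case: (F j x); case: (H j x) => * /=; ring.
rewrite (_ : (fun j x => _) = (fun j x => a * complex.Im (F j x) + (b * complex.Re (F j x) + complex.Im (H j x)))).
  by do 2 apply: decay_lin => //.
by apply/funext => j; apply/funext => x; case: (F j x); case: (H j x) => * /=; ring.
Qed.

Lemma cdecay_mul W F H : (forall j, 0 <= W j) -> cdecay W F -> cdecay (fun=> 1) H ->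
  cdecay W (fun j x => F j x * H j x).
Proof.
move=> W0 [F1 F2] [H1 H2]; split.
  rewrite (_ : (fun j x => _) = (fun j x => (-1) * (complex.Im (F j x) * complex.Im (H j x)) + complex.Re (F j x) * complex.Re (H j x))).
    by apply: decay_lin => //; exact: decay_mul.
  by apply/funext => j; apply/funext => x; case: (F j x); case: (H j x) => * /=; ring.
rewrite (_ : (fun j x => _) = (fun j x => 1 * (complex.Im (F j x) * complex.Re (H j x)) + complex.Re (F j x) * complex.Im (H j x))).
  by apply: decay_lin => //; exact: decay_mul.
by apply/funext => j; apply/funext => x; case: (F j x); case: (H j x) => * /=; ring.
Qed.

Lemma cdecay_cst W (c : J -> R[i]) (C : R) : (forall j, 0 <= W j) ->
  (forall j, W j * cmod (c j) <= C) -> cdecay W (fun j _ => c j).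
Proof.
move=> W0 cC; split; apply: (@decay_cst _ _ _ _ _ C) => // j;
  apply: le_trans (cC j); apply: ler_wpM2l => //; [exact: Re_le_cmod|exact: Im_le_cmod].
Qed.

Lemma cdecay_conj W F : (forall j, 0 <= W j) -> cdecay W F -> cdecay W (fun j x => conjc (F j x)).
Proof.
move=> W0 [F1 F2]; split.
  rewrite (_ : (fun j x => _) = (fun j x => complex.Re (F j x)))//.
  by apply/funext => j; apply/funext => x; case: (F j x).
                                                                   
                 
rewrite (_ : (fun j x => _) = (fun j x => (-1 - 1) * complex.Im (F j x) + complex.Im (F j x))).
  exact: decay_lin.
by apply/funext => j; apply/funext => x; case: (F j x) => a b /=; ring.
Qed.

Lemma e2pi_dotE (l : Zn n) (x : T) : e2pi (dot x l) = trig (@cos R) l 0 x +i* trig (@sin R) l 0 x.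
Proof. by rewrite /e2pi /trig addr0. Qed.

Lemma cdecay_char (l : Zn n) : cdecay (fun=> 1) (fun (_ : J) x => e2pi (dot x l)).
Proof.
split.
  rewrite [X in decay _ X](_ : _ = (fun _ : J => trig (@cos R) l 0)); first exact: decay_trig.
  by apply/funext => j; apply/funext => x; rewrite e2pi_dotE.
rewrite [X in decay _ X](_ : _ = (fun _ : J => trig (@cos R) l (0 - pi / 2))); first exact: decay_trig.
by apply/funext => j; rewrite -trig_sinE; apply/funext => x; rewrite e2pi_dotE.
Qed.

Lemma cdecay_charN (l : Zn n) : cdecay (fun=> 1) (fun (_ : J) x => e2pi (- dot x l)).
Proof. by apply: cdecay_ext (cdecay_char (- l)) => j x; rewrite dotNr. Qed.

Lemma cdecay_bound W F : (forall j, 0 <= W j) -> cdecay W F ->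
  forall s, exists C, forall j x, W j * cmod (partialC s (F j) x) <= C.
Proof.
move=> W0 [[_ h1] [_ h2]] s; have [C1 h1'] := h1 s; have [C2 h2'] := h2 s.
exists (C1 + C2) => j x; apply: le_trans (ler_wpM2l (W0 j) (cmod_le_ReIm _)) _.
by rewrite mulrDr; apply: lerD; [exact: h1'|exact: h2'].
Qed.

Lemma cdecay_smooth W F j : cdecay W F -> smoothC (F j).
Proof. by move=> [[h1 _] [h2 _]]; split; [exact: h1|exact: h2]. Qed.

Lemma cdecayP W F : (forall j, 0 <= W j) -> (forall j, smoothC (F j)) ->
  (forall s, exists C, forall j x, W j * cmod (partialC s (F j) x) <= C) -> cdecay W F.
Proof.
move=> W0 sF bF; split; (split; [move=> j|move=> s]).
- by case: (sF j).
- have [C h] := bF s; exists C => j x; apply: le_trans (h j x).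
  by apply: ler_wpM2l => //; exact: (Re_le_cmod (partialC s (F j) x)).
- by case: (sF j).
- have [C h] := bF s; exists C => j x; apply: le_trans (h j x).
  by apply: ler_wpM2l => //; exact: (Im_le_cmod (partialC s (F j) x)).
Qed.

End decaying_complex_families.

Section complex_partial.
Variables (R : realType) (n : nat).
Local Notation T := (Tn R n).
Implicit Types (h f : T -> R[i]).
Local Notation dir i := (delta_mx ord0 i : T).

Lemma complex_eta (z : R[i]) : complex.Re z +i* complex.Im z = z.
Proof. by case: z. Qed.

Definition deriveC (i : 'I_n) h x : R[i] :=
  'D_(dir i) (fun y => complex.Re (h y)) x +i* 'D_(dir i) (fun y => complex.Im (h y)) x.

Lemma partialC_cons i s h : partialC (i :: s) h = deriveC i (partialC s h).
Proof. by []. Qed.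

Lemma smoothC_lin (c : R[i]) h f : smoothC h -> smoothC f -> smoothC (fun x => c * h x + f x).
Proof.
move=> [h1 h2] [f1 f2]; case: c => a b; split.
  rewrite (_ : (fun x => _) = (fun x => a * complex.Re (h x) + ((- b) * complex.Im (h x) + complex.Re (f x)))).
    exact: smoothR_lin h1 (smoothR_lin (- b) h2 f1).
  by apply/funext => x; case: (h x); case: (f x) => * /=; ring.
rewrite (_ : (fun x => _) = (fun x => a * complex.Im (h x) + (b * complex.Re (h x) + complex.Im (f x)))).
  exact: smoothR_lin h2 (smoothR_lin b h1 f2).
by apply/funext => x; case: (h x); case: (f x) => * /=; ring.
Qed.

Lemma partialC_lin (c : R[i]) h f s : smoothC h -> smoothC f ->
  partialC s (fun x => c * h x + f x) = (fun x => c * partialC s h x + partialC s f x).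
Proof.
move=> [h1 h2] [f1 f2]; case: c => a b; apply/funext => x; rewrite /partialC.
rewrite (_ : (fun y => complex.Re _) = (fun x => a * complex.Re (h x) + ((- b) * complex.Im (h x) + complex.Re (f x)))); last first.
  by apply/funext => y; case: (h y); case: (f y) => * /=; ring.
rewrite (_ : (fun y => complex.Im _) = (fun x => a * complex.Im (h x) + (b * complex.Re (h x) + complex.Im (f x)))); last first.
  by apply/funext => y; case: (h y); case: (f y) => * /=; ring.
have f1' := smoothR_lin (- b) h2 f1; have f2' := smoothR_lin b h1 f2.
rewrite (partialR_lin a s h1 f1') (partialR_lin a s h2 f2').
rewrite (partialR_lin (- b) s h2 f1) (partialR_lin b s h1 f2).
by apply/eqP; rewrite eq_complex /=; apply/andP; split; apply/eqP; ring.
Qed.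

Lemma smoothC0 : smoothC (fun _ : T => 0 : R[i]).
Proof. by split; exact: smoothR_cst. Qed.

Lemma partialC0 s : partialC s (fun _ : T => 0 : R[i]) = (fun=> 0).
Proof. by apply/funext => x; rewrite /partialC !partialR_cst; case: s. Qed.

Lemma partialC_shift (v : T) h s : partialC s (fun x => h (x + v)) = (fun x => partialC s h (x + v)).
Proof.
apply/funext => x; rewrite /partialC.
by rewrite (partialR_shift v (fun y => complex.Re (h y))) (partialR_shift v (fun y => complex.Im (h y))).
Qed.

Lemma smoothC_shift (v : T) h : smoothC h -> smoothC (fun x => h (x + v)).
Proof.
move=> [h1 h2]; split; first exact: (@smoothR_shift _ _ v (fun x => complex.Re (h x))).
exact: (@smoothR_shift _ _ v (fun x => complex.Im (h x))).
Qed.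

                                                                                 
                                                        
Definition symbol (s : seq 'I_n) (l : Zn n) : R[i] :=
  \prod_(i <- s) (0 -i* (2 * pi * (l ord0 i)%:~R)).

Lemma smoothC_charN (l : Zn n) : smoothC (fun x : T => e2pi (- dot x l)).
Proof. exact: (cdecay_smooth tt (@cdecay_charN R n unit l)). Qed.

Lemma is_derive_charN (c : R[i]) (l : Zn n) (i : 'I_n) x :
  is_derive x (dir i) (fun y => complex.Re (c * e2pi (- dot y l)))
     (complex.Re ((0 -i* (2 * pi * (l ord0 i)%:~R)) * c * e2pi (- dot x l))) /\
  is_derive x (dir i) (fun y => complex.Im (c * e2pi (- dot y l)))
     (complex.Im ((0 -i* (2 * pi * (l ord0 i)%:~R)) * c * e2pi (- dot x l))).
Proof.
case: c => a b.
have dc := @is_derive_trig R n (@cos R) _ (- l) 0 x i (@is_derive_cos R).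
have ds := @is_derive_trig R n (@sin R) _ (- l) 0 x i (@is_derive_sin R).
have E y : e2pi (- dot y l) = trig (@cos R) (- l) 0 y +i* trig (@sin R) (- l) 0 y.
  by rewrite -dotNr e2pi_dotE.
have lN : ((- l) ord0 i)%:~R = - (l ord0 i)%:~R :> R by rewrite mxE rmorphN.
split.
  rewrite (_ : (fun y => _) = (fun y => a * trig (@cos R) (- l) 0 y + (0 + - b * trig (@sin R) (- l) 0 y))).
    apply: is_derive_eq (is_derive_lin a dc (is_deriveD (is_derive_cst 0 _ _) (is_deriveZ (- b) ds))) _.
    by rewrite E /= lN /GRing.scale /= /trig; ring.
  by apply/funext => y; rewrite E /=; ring.
rewrite (_ : (fun y => _) = (fun y => a * trig (@sin R) (- l) 0 y + (0 + b * trig (@cos R) (- l) 0 y))).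
  apply: is_derive_eq (is_derive_lin a ds (is_deriveD (is_derive_cst 0 _ _) (is_deriveZ b dc))) _.
  by rewrite E /= lN /GRing.scale /= /trig; ring.
by apply/funext => y; rewrite E /=; ring.
Qed.

Lemma partialC_charN (s : seq 'I_n) (l : Zn n) :
  partialC s (fun x => e2pi (- dot x l)) = (fun x => symbol s l * e2pi (- dot x l)).
Proof.
elim: s => [|i s IH].
  by apply/funext => x; rewrite /symbol big_nil mul1r; exact: complex_eta.
rewrite partialC_cons IH; apply/funext => x; rewrite /symbol big_cons -/(symbol s l) /deriveC.
have [[_ ->] [_ ->]] := is_derive_charN (symbol s l) l i x.
by case: (_ * _ * _).
Qed.

Lemma cmod_symbol (s : seq 'I_n) (l : Zn n) N : (size s <= N)%N ->
  cmod (symbol s l) <= (2 * pi) ^+ N * bracket R l ^+ N.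
Proof.
have p1 : 1 <= 2 * pi :> R by have := @pi_ge2 R; lra.
rewrite -exprMn => sN; apply: (@le_trans _ _ ((2 * pi * bracket R l) ^+ size s)); last first.
  apply: ler_weXn2l => //; by rewrite -[leLHS]mulr1 ler_pM// bracket_ge1.
elim: s {sN} => [|i s IH]; first by rewrite /symbol big_nil cmod1 expr0.
rewrite /symbol big_cons -/(symbol s l) cmodM exprS ler_pM ?cmod_ge0//.
rewrite cmodE /= expr0n add0r sqrrN sqrtr_sqr normrM ger0_norm ?mulr_ge0 ?pi_ge0//.
rewrite ler_wpM2l ?mulr_ge0 ?pi_ge0//; apply: le_trans (bracket_coord R l i).
by rewrite lerDr.
Qed.

End complex_partial.

                                                             

Section schwartz_phase_space.
Variables (R : realType) (n : nat).
Local Notation Z := (Zn n).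
Local Notation T := (Tn R n).
Implicit Types (F H : Z * T -> R[i]) (s : seq 'I_n).

Local Notation W N := (fun j : Z => bracket R j ^+ N).

Lemma bracketX_ge0 N (j : Z) : 0 <= bracket R j ^+ N.
Proof. by rewrite ltW// bracketX_gt0. Qed.

                                                                             
                            
Lemma uniform_bound_size (Q : seq 'I_n -> R -> Prop) :
  (forall s C C', C <= C' -> Q s C -> Q s C') -> (forall s, exists C, Q s C) ->
  forall N, exists C, forall s, (size s <= N)%N -> Q s C.
Proof.
move=> mono ex N; elim: N Q mono ex => [|N IH] Q mono ex.
  by have [C QC] := ex [::]; exists C => -[].
have [C0 Q0] := ex [::].
have h i : exists C, forall s, (size s <= N)%N -> Q (i :: s) C.
  by apply: (IH (fun s => Q (i :: s))) => [s C C'|s]; [exact: mono|exact: ex].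
have [C hC] := choice h.
exists (`|C0| + \sum_i `|C i|) => -[_|i s sN].
  by apply: mono Q0; apply: le_trans (ler_norm _) _; rewrite lerDl sumr_ge0.
apply: mono (hC i s sN); apply: le_trans (ler_norm _) _.
by rewrite (bigD1 i)//= addrCA lerDl addr_ge0// sumr_ge0.
Qed.

Lemma seminormZT_le N F (C : R) :
  (forall s j x, (size s <= N)%N ->
     bracket R j ^+ N * cmod (partialC s (fun t => F (j, t)) x) <= C) ->
  (seminormZT N F <= C%:E)%E.
Proof. by move=> FC; apply: ge_ereal_sup => _ [s [j [x [sN ->]]]]; rewrite lee_fin; exact: FC. Qed.

                                                                            
                                                                              
                     
Lemma schwartzZTP F : schwartzZT F <->
  (forall j x l, F (j, x + intT R l) = F (j, x)) /\
  forall N, cdecay (W N) (fun j x => F (j, x)).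
Proof.
split=> [[pF sF bF]|[pF dF]]; split => //.
- move=> N; apply: cdecayP => [j|//|s]; first exact: bracketX_ge0.
  pose M := maxn N (size s); exists (fine (seminormZT M F)) => j x.
  apply: (@le_trans _ _ (bracket R j ^+ M * cmod (partialC s (fun t => F (j, t)) x))).
    by rewrite ler_wpM2r ?cmod_ge0// bracketX_le// leq_maxl.
  have le : ((bracket R j ^+ M * cmod (partialC s (fun t => F (j, t)) x))%:E <= seminormZT M F)%E.
    by apply: ereal_sup_ubound; exists s, j, x; split => //; exact: leq_maxr.
  rewrite -lee_fin fineK// ge0_fin_numE; first exact: bF.
  by apply: le_trans le; rewrite lee_fin mulr_ge0 ?cmod_ge0// bracketX_ge0.
- by move=> j; exact: (cdecay_smooth j (dF 0%N)).
- move=> N.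
  have [s C C' CC' h|s|C hC] := @uniform_bound_size (fun s C => forall j x,
     bracket R j ^+ N * cmod (partialC s (fun t => F (j, t)) x) <= C) _ _ N.
  + by move=> j x; exact: le_trans (h j x) CC'.
  + by apply: cdecay_bound (dF N) s => j; exact: bracketX_ge0.
  + apply: le_lt_trans (@seminormZT_le N F C _) (ltry _) => s j x sN.
    exact: hC.
Qed.

Lemma schwartzZT_lin (a : R[i]) F H : schwartzZT F -> schwartzZT H ->
  schwartzZT (fun z => a * F z + H z).
Proof.
move=> /schwartzZTP[pF dF] /schwartzZTP[pH dH]; apply/schwartzZTP; split.
  by move=> j x l; rewrite pF pH.
by move=> N; apply: cdecay_lin => // j; exact: bracketX_ge0.
Qed.

Lemma schwartzZT0 : schwartzZT (fun _ : Z * T => 0 : R[i]).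
Proof.
apply/schwartzZTP; split => // N.
apply: (@cdecay_cst _ _ _ _ (fun=> 0) 0) => j; first exact: bracketX_ge0.
by rewrite cmod0 mulr0.
Qed.

Lemma e2piN_periodic (x : T) (k l : Z) : e2pi (- dot (x + intT R l) k) = e2pi (- dot x k).
Proof. by rewrite dotDl opprD e2piD -(conj_e2pi (dot (intT _ _) _)) dot_intT conjc1 mulr1. Qed.

                                                                            
                                                                    
Definition atomZT (i : Z * Z) : Z * T -> R[i] :=
  fun z => (z.1 == i.1)%:R * e2pi (- dot z.2 i.2).

Lemma schwartzZT_atom i : schwartzZT (atomZT i).
Proof.
apply/schwartzZTP; split=> [j x l|N]; first by rewrite /atomZT /= e2piN_periodic.
apply: (@cdecay_mul _ _ _ _ (fun j x => (j == i.1)%:R) (fun j x => e2pi (- dot x i.2))).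
- by move=> j; exact: bracketX_ge0.
- apply: (@cdecay_cst _ _ _ _ (fun j => (j == i.1)%:R) (bracket R i.1 ^+ N)) => j; first exact: bracketX_ge0.
  rewrite cmod_nat; have [->|_] := eqVneq j i.1; first by rewrite mulr1.
  by rewrite mulr0 bracketX_ge0.
- exact: cdecay_charN.
Qed.

                                                                          
                                               
Lemma schwartzZT_test (G : Z * T -> R[i]) (m k : Z) (omega xi : T) : schwartzZT G ->
  schwartzZT (fun z => e2pi (- dot xi z.1) * e2pi (- dot z.2 k) *
              conjc (G (z.1 - m, z.2 - omega))).
Proof.
move=> /schwartzZTP[pG dG]; apply/schwartzZTP; split=> [j x l|N].
  by rewrite /= e2piN_periodic addrAC pG.
have d1 : cdecay (W N) (fun (j : Z) (x : T) => G (j - m, x - omega)).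
  apply: cdecayP => [j|j|s]; first exact: bracketX_ge0.
    exact: (smoothC_shift (- omega) (cdecay_smooth (j - m) (dG 0%N))).
  have [C hC] := cdecay_bound (fun j => bracketX_ge0 N j) (dG N) s.
  exists (bracket R m ^+ N * C) => j x.
  rewrite (partialC_shift (- omega) (fun t => G (j - m, t))).
  apply: (@le_trans _ _ (bracket R m ^+ N * bracket R (j - m) ^+ N * cmod (partialC s (fun t => G (j - m, t)) (x - omega)))).
    rewrite ler_wpM2r ?cmod_ge0// -exprMn lerXn2r ?nnegrE ?mulr_ge0 ?(ltW (bracket_gt0 _ _))//.
    by rewrite -{1}(subrK m j) mulrC bracketD.
  by rewrite -mulrA ler_wpM2l// bracketX_ge0.
have d2 := cdecay_conj (fun j => bracketX_ge0 N j) d1.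
have d3 := cdecay_mul (fun j => bracketX_ge0 N j) d2 (@cdecay_charN R n Z k).
have d4 : cdecay (fun=> 1) (fun (j : Z) (x : T) => e2pi (- dot xi j) : R[i]).
  by apply: (@cdecay_cst _ _ _ _ (fun j => e2pi (- dot xi j)) 1) => // j; rewrite cmod_e2pi mulr1.
apply: cdecay_ext (cdecay_mul (fun j => bracketX_ge0 N j) d3 d4) => j x /=; ring.
Qed.

End schwartz_phase_space.

Section fourier_coefficients.
Variables (R : realType) (n : nat).
Local Notation Z := (Zn n).
Local Notation T := (Tn R n).
Implicit Types (h : T -> R[i]) (s : seq 'I_n).
Local Notation dir i := (delta_mx ord0 i : T).
Local Notation muZ := (muZ R n).
Let muZc := counting_like_muZ R n.

Definition periodic h := forall x l, h (x + intT R l) = h x.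

Definition torus_smooth h := periodic h /\ cdecay (fun _ : unit => 1) (fun _ => h).

Lemma torus_smooth_smooth h : torus_smooth h -> smoothC h.
Proof. by move=> [_ d]; exact: (cdecay_smooth tt d). Qed.

Lemma torus_smooth_meas h : torus_smooth h -> cmeasurable h.
Proof.
move=> /torus_smooth_smooth[h1 h2]; split; apply: continuous_meas.
  by have [] := h1 [::].
by have [] := h2 [::].
Qed.

Lemma torus_smooth_bound h s : torus_smooth h -> exists C, forall x, cmod (partialC s h x) <= C.
Proof.
move=> [_ d]; have [C hC] := cdecay_bound (fun=> ler01) d s.
by exists C => x; have := hC tt x; rewrite mul1r.
Qed.

Lemma torus_smooth_integrable h : torus_smooth h -> cintegrable (haar R n) h.
Proof.
move=> hs; have [C hC] := torus_smooth_bound [::] hs.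
apply: (@cintegrable_bounded _ _ _ (haar R n) h C); first exact: torus_smooth_meas.
by move=> x; have := hC x; rewrite /partialC /= complex_eta.
Qed.

Lemma torus_smooth_mul h f : torus_smooth h -> torus_smooth f ->
  torus_smooth (fun x => h x * f x).
Proof.
move=> [ph dh] [pf df]; split; first by move=> x l; rewrite ph pf.
exact: cdecay_mul.
Qed.

Lemma e2pi_periodic (x : T) (k l : Z) : e2pi (dot (x + intT R l) k) = e2pi (dot x k).
Proof. by rewrite dotDl e2piD dot_intT mulr1. Qed.

Lemma torus_smooth_char (l : Z) : torus_smooth (fun x => e2pi (dot x l)).
Proof. by split; [move=> x k; exact: e2pi_periodic|exact: cdecay_char]. Qed.

Lemma delta_intT i : dir i = intT R (delta_mx ord0 i : Z).
Proof. by apply/rowP => j; rewrite !mxE; case: (_ && _). Qed.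

Lemma torus_smooth_derive i h : torus_smooth h -> torus_smooth (deriveC i h).
Proof.
move=> [ph [d1 d2]]; split; last by split; exact: decay_derive.
move=> x l.
have E : (fun y => h (y + intT R l)) = h by apply/funext => y; exact: ph.
have := partialC_shift (intT R l) h [:: i]; rewrite E.
by move=> /(congr1 (fun f => f x)).
Qed.

Lemma torus_smooth_partial s h : torus_smooth h -> torus_smooth (partialC s h).
Proof.
move=> hs; elim: s => [|i s IH].
  by rewrite (_ : partialC [::] h = h)//; apply/funext => x; exact: complex_eta.
by rewrite partialC_cons; exact: torus_smooth_derive.
Qed.

Lemma cintegral_deriveC i h : torus_smooth h -> cintegral (haar R n) (deriveC i h) = 0.
Proof.
move=> hs; have [h1 h2] := torus_smooth_smooth hs.
have [C hC] := torus_smooth_bound [:: i] hs.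
have [ph _] := hs.
have e1 : (\int[haar R n]_x (complex.Re (deriveC i h x))%:E = 0)%E.
  apply: (@integral_derive_eq0 R n i (fun y => complex.Re (h y)) (fun x => complex.Re (deriveC i h x)) C).
  - by move=> x; exact: smoothR_is_derive.
  - by have [] := h1 [:: i].
  - by move=> x; exact: le_trans (Re_le_cmod (partialC [:: i] h x)) (hC x).
  - by move=> x; rewrite delta_intT ph.
have e2 : (\int[haar R n]_x (complex.Im (deriveC i h x))%:E = 0)%E.
  apply: (@integral_derive_eq0 R n i (fun y => complex.Im (h y)) (fun x => complex.Im (deriveC i h x)) C).
  - by move=> x; exact: smoothR_is_derive.
  - by have [] := h2 [:: i].
  - by move=> x; exact: le_trans (Im_le_cmod (partialC [:: i] h x)) (hC x).
  - by move=> x; rewrite delta_intT ph.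
by rewrite /cintegral /Rintegral e1 e2.
Qed.

Lemma deriveC_mul i h f x : smoothC h -> smoothC f ->
  deriveC i (fun y => h y * f y) x = deriveC i h x * f x + h x * deriveC i f x.
Proof.
move=> [h1 h2] [f1 f2].
have dh1 := @smoothR_is_derive _ _ _ i x h1; have dh2 := @smoothR_is_derive _ _ _ i x h2.
have df1 := @smoothR_is_derive _ _ _ i x f1; have df2 := @smoothR_is_derive _ _ _ i x f2.
rewrite {1}/deriveC.
rewrite (_ : (fun y => complex.Re _) = (fun y => (-1) * (complex.Im (h y) * complex.Im (f y)) + complex.Re (h y) * complex.Re (f y))); last first.
  by apply/funext => y; case: (h y); case: (f y) => * /=; ring.
rewrite (_ : (fun y => complex.Im _) = (fun y => 1 * (complex.Im (h y) * complex.Re (f y)) + complex.Re (h y) * complex.Im (f y))); last first.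
  by apply/funext => y; case: (h y); case: (f y) => * /=; ring.
have [_ ->] := is_derive_lin (-1) (is_derive_mul dh2 df2) (is_derive_mul dh1 df1).
have [_ ->] := is_derive_lin 1 (is_derive_mul dh2 df1) (is_derive_mul dh1 df2).
rewrite /deriveC; case: (h x) => ? ?; case: (f x) => ? ?.
by apply/eqP; rewrite eq_complex /=; apply/andP; split; apply/eqP; ring.
Qed.

Lemma deriveC_char i (l : Z) x :
  deriveC i (fun y : T => e2pi (dot y l)) x = (0 +i* (2 * pi * (l ord0 i)%:~R)) * e2pi (dot x l).
Proof.
have [[_ d1] [_ d2]] := @is_derive_charN R n 1 (- l) i x.
have E (y : T) : e2pi (dot y l) = 1 * e2pi (- dot y (- l)) by rewrite mul1r dotNr opprK.
rewrite /deriveC.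
rewrite (_ : (fun y => complex.Re _) = (fun y => complex.Re (1 * e2pi (- dot y (- l))))); last first.
  by apply/funext => y; rewrite E.
rewrite (_ : (fun y => complex.Im _) = (fun y => complex.Im (1 * e2pi (- dot y (- l))))); last first.
  by apply/funext => y; rewrite E.
by rewrite d1 d2 complex_eta mulr1 dotNr opprK mxE rmorphN /= mulrN opprK.
Qed.

                                                                      
Definition coefT h (l : Z) : R[i] := cintegral (haar R n) (fun x => h x * e2pi (dot x l)).

Lemma cintegrable_mul_char h l : cintegrable (haar R n) h ->
  cintegrable (haar R n) (fun x => h x * e2pi (dot x l)).
Proof.
move=> hi; apply: (cintegrable_le _ (integrable_cmod hi)).
  by apply: cmeasM; [exact: cintegrable_meas hi|exact: cmeas_char].
by move=> x; rewrite cmodM cmod_e2pi mulr1.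
Qed.

Lemma coefT_integrable h l : torus_smooth h ->
  cintegrable (haar R n) (fun x => h x * e2pi (dot x l)).
Proof. by move=> hs; exact: cintegrable_mul_char (torus_smooth_integrable hs). Qed.

Lemma coefT_derive i h l : torus_smooth h ->
  coefT (deriveC i h) l = (0 -i* (2 * pi * (l ord0 i)%:~R)) * coefT h l.
Proof.
move=> hs; have := cintegral_deriveC i (torus_smooth_mul hs (torus_smooth_char l)).
rewrite (_ : deriveC _ _ = (fun x => deriveC i h x * e2pi (dot x l) +
   (0 +i* (2 * pi * (l ord0 i)%:~R)) * (h x * e2pi (dot x l)))); last first.
  apply/funext => x; rewrite deriveC_mul.
  - by congr (_ + _); rewrite [in LHS]deriveC_char mulrCA.
  - exact: torus_smooth_smooth.
  - exact: torus_smooth_smooth (torus_smooth_char l).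
rewrite cintegralD; last 2 first.
- exact: coefT_integrable (torus_smooth_derive i hs).
- exact: cintegrableZ (coefT_integrable l hs).
rewrite cintegralZ; last exact: coefT_integrable.
rewrite /coefT => /eqP; rewrite addr_eq0 => /eqP ->; rewrite -mulNr; congr (_ * _).
by apply/eqP; rewrite eq_complex /= oppr0 !eqxx.
Qed.

Lemma coefT_partial s h l : torus_smooth h -> coefT (partialC s h) l = symbol R s l * coefT h l.
Proof.
move=> hs; elim: s => [|i s IH].
  rewrite /symbol big_nil mul1r; congr (coefT _ _).
  by apply/funext => x; exact: complex_eta.
rewrite partialC_cons coefT_derive; last exact: torus_smooth_partial.
by rewrite IH /symbol big_cons mulrA.
Qed.

Lemma cmod_coefT_le h l C : torus_smooth h -> (forall x, cmod (h x) <= C) -> cmod (coefT h l) <= C.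
Proof.
move=> hs hC; apply: le_trans (cmod_cintegral_le (coefT_integrable l hs)) _.
rewrite -lee_fin fineK; last first.
  by apply: integrable_fin_num => //; exact: (integrable_cmod (coefT_integrable l hs)).
have -> : C%:E = (\int[haar R n]_x (cst C%:E) x)%E.
  rewrite integral_cst// [X in (_ * X)%E](_ : _ = 1%E) ?mule1//.
  exact: probability_setT.
apply: ge0_le_integral => //.
- by move=> x _; rewrite lee_fin cmod_ge0.
- by apply/measurable_EFinP/cmeas_cmod; exact: cintegrable_meas (coefT_integrable l hs).
- by move=> x _; rewrite lee_fin cmodM cmod_e2pi mulr1.
Qed.

                                                                          
                     
Lemma bracket_pow_le (l : Z) M :
  bracket R l ^+ M <= n.+1%:R ^+ M * (1 + \sum_i `|(l ord0 i)%:~R| ^+ M).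
Proof.
pose B := \big[Num.max/1]_(i < n) `|(l ord0 i)%:~R| : R.
have B1 : 1 <= B by apply: bigmax_ge_id.
have bB : bracket R l <= n.+1%:R * B.
  rewrite -(natr1 n) mulrDl mul1r addrC /bracket lerD//.
  rewrite /znorm; apply: (@le_trans _ _ (\sum_(i < n) B)).
    by apply: ler_sum => i _; apply: le_bigmax.
  by rewrite sumr_const card_ord mulr_natl.
apply: (@le_trans _ _ ((n.+1%:R * B) ^+ M)).
  by rewrite lerXn2r ?nnegrE ?(ltW (bracket_gt0 _ _))// mulr_ge0// (le_trans ler01 B1).
rewrite exprMn ler_wpM2l ?exprn_ge0//.
suff [] : B ^+ M <= 1 + \sum_i `|(l ord0 i)%:~R| ^+ M /\ 0 <= \sum_i `|(l ord0 i)%:~R| ^+ M :> R by [].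
rewrite /B; elim/big_rec2 : _ => [|i y x _ [h x0]]; first by rewrite expr1n addr0.
have l0 : 0 <= `|(l ord0 i)%:~R| ^+ M :> R by rewrite exprn_ge0.
by case: (leP `|(l ord0 i)%:~R| x) => _; split; lra.
Qed.

Lemma nseq_symbol M i (l : Z) : `|(l ord0 i)%:~R| ^+ M <= cmod (symbol R (nseq M i) l).
Proof.
have p1 : 1 <= 2 * pi :> R by have := @pi_ge2 R; lra.
rewrite /symbol; elim: M => [|M IH]; first by rewrite big_nil cmod1 expr0.
rewrite /= big_cons cmodM exprS ler_pM ?exprn_ge0//.
rewrite cmodE /= expr0n add0r sqrrN sqrtr_sqr normrM ger0_norm ?mulr_ge0 ?pi_ge0//.
by rewrite ler_peMl.
Qed.

                                                                            
                                                                            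
                                                                         
                                       
Lemma coefT_decay (J : Type) (V : J -> R) (F : J -> T -> R[i]) M :
  (forall j, 0 <= V j) -> cdecay V F ->
  (forall j, torus_smooth (F j)) ->
  exists C, forall j l, V j * (bracket R l ^+ M * cmod (coefT (F j) l)) <= C.
Proof.
move=> V0 dF sF.
have b s : exists C, forall j l, V j * (cmod (symbol R s l) * cmod (coefT (F j) l)) <= C.
  have [C hC] := cdecay_bound V0 dF s; exists C => j l.
  have [V00|V1] := eqVneq (V j) 0.
    by have := hC j 0; rewrite V00 !mul0r.
  have Vgt : 0 < V j by rewrite lt_def V1 V0.
  rewrite -cmodM -coefT_partial// mulrC -ler_pdivlMr//.
  apply: cmod_coefT_le; first exact: torus_smooth_partial.
  by move=> x; rewrite ler_pdivlMr// mulrC.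
have [C0 h0] := b [::]; have [C hC] := choice (fun i => b (nseq M i)).
exists (n.+1%:R ^+ M * (C0 + \sum_i C i)) => j l.
have cV : 0 <= V j * cmod (coefT (F j) l) by rewrite mulr_ge0 ?cmod_ge0.
apply: (@le_trans _ _ ((n.+1%:R ^+ M * (1 + \sum_i `|(l ord0 i)%:~R| ^+ M)) * (V j * cmod (coefT (F j) l)))).
  by rewrite mulrCA ler_wpM2r// bracket_pow_le.
rewrite -mulrA ler_wpM2l ?exprn_ge0// mulrDl mul1r lerD//.
  by have := h0 j l; rewrite /symbol big_nil cmod1 mul1r.
rewrite mulr_suml; apply: ler_sum => i _.
apply: le_trans (hC i j l); rewrite mulrCA ler_wpM2l// ler_wpM2r ?cmod_ge0//.
exact: nseq_symbol.
Qed.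

Lemma torus_smooth_summable h : torus_smooth h -> cintegrable muZ (coefT h).
Proof.
move=> hs; have [_ dh] := hs.
have [C hC] := @coefT_decay unit (fun=> 1) (fun _ => h) (n.*2) (fun=> ler01) dh (fun=> hs).
apply: (cintegrable_le (g := fun l => C * bracket R l ^- (n.*2))).
- exact: (counting_like_cmeas muZc).
- exact: (integrableZl measurableT C (integrable_bracket R n)).
- by move=> l; rewrite ler_pdivlMr ?bracketX_gt0// mulrC; have := hC tt l; rewrite mul1r.
Qed.

                                                                            
                                                                                 
Lemma fourier_unique (d : T -> R[i]) : cintegrable (haar R n) d ->
  (forall l, coefT d l = 0) -> {ae haar R n, forall x, d x = 0}.
Proof.
move=> di d0.
have dei l := cintegrable_mul_char l di.
have key l phi : cintegrable (haar R n) (fun x => d x * (trig (@cos R) l phi x)%:C) /\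
   cintegral (haar R n) (fun x => d x * (trig (@cos R) l phi x)%:C) = 0.
  pose u : R[i] := cos phi +i* sin phi.
  have E : (fun x => d x * (trig (@cos R) l phi x)%:C) =
     (fun x => (2^-1 * u) * (d x * e2pi (dot x l)) + (2^-1 * conjc u) * (d x * e2pi (dot x (- l)))).
    apply/funext => x.
    have -> : (trig (@cos R) l phi x)%:C = 2^-1 * (u * e2pi (dot x l) + conjc (u * e2pi (dot x l))).
      rewrite addcJ mulrA mulVf ?pnatr_eq0// mul1r; congr (_%:C).
      by rewrite /u /e2pi /trig /= cosD mulrC [X in _ - X]mulrC.
    by rewrite conjcM conj_e2pi dotNr; ring.
  have i1 := cintegrableZ (2^-1 * u) (dei l).
  have i2 := cintegrableZ (2^-1 * conjc u) (dei (- l)).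
  rewrite E; split; first exact: cintegrableD.
  rewrite cintegralD// cintegralZ// cintegralZ//.
  by rewrite [X in _ * X + _](d0 l) [X in _ + _ * X](d0 (- l)) !mulr0 addr0.
have [d1 d2] := di.
have t1 : trig_orth (fun x => complex.Re (d x)).
  split => // l phi; have [[k1 _] k] := key l phi.
  have := congr1 (@complex.Re R) k; rewrite /= /Rintegral => h.
  rewrite -[LHS]fineK; last first.
    apply: integrable_fin_num => //.
    rewrite (_ : (fun x => _) = (fun x => (complex.Re (d x * (trig (@cos R) l phi x)%:C))%:E))//.
    by apply/funext => x; case: (d x) => a b /=; rewrite mulr0 subr0.
  rewrite -[RHS]/((0 : R)%:E) -h; congr (fine _)%:E; apply: eq_integral => x _.
  by case: (d x) => a b /=; rewrite mulr0 subr0.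
have t2 : trig_orth (fun x => complex.Im (d x)).
  split => // l phi; have [[_ k1] k] := key l phi.
  have := congr1 (@complex.Im R) k; rewrite /= /Rintegral => h.
  rewrite -[LHS]fineK; last first.
    apply: integrable_fin_num => //.
    rewrite (_ : (fun x => _) = (fun x => (complex.Im (d x * (trig (@cos R) l phi x)%:C))%:E))//.
    by apply/funext => x; case: (d x) => a b /=; rewrite mulr0 add0r mulrC.
  rewrite -[RHS]/((0 : R)%:E) -h; congr (fine _)%:E; apply: eq_integral => x _.
  by case: (d x) => a b /=; rewrite mulr0 add0r mulrC.
apply: filterS2 (trig_orth_eq0 t1) (trig_orth_eq0 t2) => x h1 h2.
by rewrite -(complex_eta (d x)) h1 h2.
Qed.

Lemma continuous_uniform_limit (f : T -> R) :
  (forall e : R, 0 < e -> exists g : T -> R, continuous g /\ forall x, `|f x - g x| <= e) ->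
  continuous f.
Proof.
move=> H x; apply/(@cvgrPdist_le _ _ _ (nbhs x) (nbhs_filter x)) => e e0.
have e3 : 0 < e / 3 by rewrite divr_gt0.
have [g [cg hg]] := H (e / 3) e3.
have := @cvgr_dist_le _ _ _ (nbhs x) (nbhs_filter x) g (g x) (cg x) (e / 3) e3.
apply: filterS => y h.
have -> : f x - f y = (f x - g x) + (g x - g y) - (f y - g y) by ring.
apply: le_trans (ler_normB _ _) _; apply: le_trans (lerD (ler_normD _ _) (lexx _)) _.
by have := hg x; have := hg y; lra.
Qed.

Lemma continuous_partial_sum (q : nat -> option Z) (c : Z -> R[i]) L :
  continuous (fun x => complex.Re (partial_sum q (fun l (x : T) => e2pi (- dot x l)) c L x)) /\
  continuous (fun x => complex.Im (partial_sum q (fun l (x : T) => e2pi (- dot x l)) c L x)).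
Proof.
have sm : smoothC (partial_sum q (fun l (x : T) => e2pi (- dot x l)) c L).
  apply: (@partial_sum_closed _ _ _ q T (@smoothC R n)).
  - exact: smoothC0.
  - by move=> a F H; exact: smoothC_lin.
  - by move=> l; exact: smoothC_charN.
case: sm => s1 s2; split; first by have [] := s1 [::].
by have [] := s2 [::].
Qed.

                                                                          
                                           
Lemma continuous_series (c : Z -> R[i]) : cintegrable muZ c ->
  continuous (fun x : T => complex.Re (cintegral muZ (fun l => c l * e2pi (- dot x l)))) /\
  continuous (fun x : T => complex.Im (cintegral muZ (fun l => c l * e2pi (- dot x l)))).
Proof.
move=> ci.
have [p [q [pK qK]]] := counting_like_index muZc.
have chi1 (l : Z) (x : T) := cmod_e2pi (- dot x l).
have approx (e : R) : 0 < e -> exists L, forall x : T,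
  cmod (cintegral muZ (fun l => c l * e2pi (- dot x l)) -
        partial_sum q (fun l (x : T) => e2pi (- dot x l)) c L x) <= e.
  move=> e0.
  have tl := @cvg_tail _ _ _ muZ muZc p (fun l => cmod (c l)) (integrable_cmod ci).
  have /cvgrPdist_le/(_ e e0) := tl => -[L _ /(_ L (leqnn _)) hL]; exists L => x.
  have si := cintegrable_series muZc chi1 ci x.
  rewrite (partial_sumE muZc pK qK L si).
  rewrite -cintegralB//; last exact: (cintegrable_below muZc).
  have di := cintegrableB si (cintegrable_below muZc p L si).
  apply: le_trans (cmod_cintegral_le di) _.
  apply: le_trans hL; rewrite sub0r normrN; apply: le_trans (ler_norm _).
  rewrite le_eqVlt; apply/orP; left; apply/eqP/eq_Rintegral => l _.
  rewrite (leqNgt L); case: (p l < L)%N => /=; rewrite ?mulr1 ?mulr0 ?subrr ?cmod0 ?subr0//.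
  by rewrite cmodM chi1 mulr1.
split; apply: continuous_uniform_limit => e e0; have [L hL] := approx e e0.
  exists (fun x => complex.Re (partial_sum q (fun l (x : T) => e2pi (- dot x l)) c L x)).
  split; first by have [] := continuous_partial_sum q c L.
  by move=> x; rewrite -raddfB; exact: le_trans (Re_le_cmod _) (hL x).
exists (fun x => complex.Im (partial_sum q (fun l (x : T) => e2pi (- dot x l)) c L x)).
split; first by have [] := continuous_partial_sum q c L.
by move=> x; rewrite -raddfB; exact: le_trans (Im_le_cmod _) (hL x).
Qed.

Lemma series_coefT (c : Z -> R[i]) l : cintegrable muZ c ->
  coefT (fun x => cintegral muZ (fun l => c l * e2pi (- dot x l))) l = c l.
Proof.
move=> ci.
have := @series_coef _ _ _ muZ muZc _ _ (haar R n) (fun l (x : T) => e2pi (- dot x l))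
  (@cmeas_charN R n) (fun l x => cmod_e2pi _) (@char_orthN R n) c ci l.
move=> <-; apply: cintegral_ext => x; congr (_ * _).
by rewrite conj_e2pi opprK.
Qed.

Lemma series_cintegrable (c : Z -> R[i]) : cintegrable muZ c ->
  cintegrable (haar R n) (fun x => cintegral muZ (fun l => c l * e2pi (- dot x l))).
Proof.
move=> ci.
exact: (@cintegrable_seriesP _ _ _ muZ muZc _ _ (haar R n) (fun l (x : T) => e2pi (- dot x l))
  (@cmeas_charN R n) (fun l x => cmod_e2pi _) c ci).
Qed.

                                                                    
                    
Theorem fourier_inversion h x : torus_smooth h ->
  h x = cintegral muZ (fun l => coefT h l * e2pi (- dot x l)).
Proof.
move=> hs; have ci := torus_smooth_summable hs.
pose V y := cintegral muZ (fun l => coefT h l * e2pi (- dot y l)).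
pose d y := h y - V y.
have Vi : cintegrable (haar R n) V := series_cintegrable ci.
have hi := torus_smooth_integrable hs.
have di : cintegrable (haar R n) d := cintegrableB hi Vi.
have d0 l : coefT d l = 0.
  rewrite /coefT; under cintegral_ext do rewrite mulrBl.
  rewrite cintegralB.
  - by rewrite [X in _ - X](series_coefT l ci) subrr.
  - exact: coefT_integrable.
  - exact: cintegrable_mul_char.
have ae := fourier_unique di d0.
have [c1 c2] := continuous_series ci.
have [h1 h2] := torus_smooth_smooth hs.
have [ph _] := hs.
have pV y l : V (y + intT R l) = V y.
  by apply: cintegral_ext => k; rewrite e2piN_periodic.
have pd y l : d (y + intT R l) = d y by rewrite /d ph pV.
suff : d x = 0 by move/eqP; rewrite subr_eq0 => /eqP.
rewrite -(complex_eta (d x)).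
rewrite (@continuous_periodic_ae0 R n (fun y => complex.Re (d y))); last 3 first.
- rewrite (_ : (fun y => _) = (fun y => complex.Re (h y) + (-1) * complex.Re (V y))).
    apply: fun_continuousD; first by have [] := h1 [::].
    by apply: fun_continuousM; [exact: cst_continuous|exact: c1].
  by apply/funext => y; rewrite /d raddfB /= mulN1r.
- by move=> y l; rewrite pd.
- by apply: filterS ae => y ->.
rewrite (@continuous_periodic_ae0 R n (fun y => complex.Im (d y)))//.
- rewrite (_ : (fun y => _) = (fun y => complex.Im (h y) + (-1) * complex.Im (V y))).
    apply: fun_continuousD; first by have [] := h2 [::].
    by apply: fun_continuousM; [exact: cst_continuous|exact: c2].
  by apply/funext => y; rewrite /d raddfB /= mulN1r.
- by move=> y l; rewrite pd.
- by apply: filterS ae => y ->.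
Qed.

End fourier_coefficients.

                                     

Section discrete_sections.
Context d1 d2 (I : measurableType d1) (T : measurableType d2) (R : realType).
Variable mu : {sigma_finite_measure set I -> \bar R}.
Variable nu : {sigma_finite_measure set T -> \bar R}.
Hypothesis muI : counting_like mu.

Lemma cintegrable_slice (f : I * T -> R[i]) i : cintegrable (mu \x nu)%E f ->
  cintegrable nu (fun y => f (i, y)).
Proof.
move=> fi; have mf := cintegrable_meas fi.
apply: cintegrable_lty; first exact: cmeas_section1.
apply: le_lt_trans (integral_cmod_lty fi).
rewrite fubini_tonelli1//; last 2 first.
- exact/measurable_EFinP/cmeas_cmod.
- by move=> z; rewrite lee_fin cmod_ge0.
apply: (point_le_integral muI (f := fubini_F nu (fun z => (cmod (f z))%:E)) i) => j.
by apply: integral_ge0 => y _; rewrite lee_fin cmod_ge0.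
Qed.

Lemma cintegral_sum_slices (f : I * T -> R[i]) : cintegrable (mu \x nu)%E f ->
  cintegrable mu (fun i => cintegral nu (fun y => f (i, y))) /\
  cintegral (mu \x nu)%E f = cintegral mu (fun i => cintegral nu (fun y => f (i, y))).
Proof.
move=> fi; have [h1 h2] := cFubini1 fi (fun i => cintegrable_slice i fi).
by split.
Qed.

                                                                
Lemma cintegral_supp_slice (f : I * T -> R[i]) j : cintegrable (mu \x nu)%E f ->
  (forall i y, i != j -> f (i, y) = 0) ->
  cintegral (mu \x nu)%E f = cintegral nu (fun y => f (j, y)).
Proof.
move=> fi f0; have [_ ->] := cintegral_sum_slices fi.
apply: (cintegral_delta muI) => i ij.
rewrite (_ : (fun y => f (i, y)) = (fun=> 0)) ?cintegral0//.
by apply/funext => y; exact: f0.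
Qed.

End discrete_sections.

Section phase_space_expansion.
Variables (R : realType) (n : nat).
Local Notation Z := (Zn n).
Local Notation T := (Tn R n).
Local Notation muZ := (muZ R n).
Local Notation muI := (muZ \x muZ)%E.
Implicit Types (F H : Z * T -> R[i]) (u : (Z * T -> R[i]) -> R[i]) (i : Z * Z).

Let muZc := counting_like_muZ R n.

Lemma counting_like_ZZ : counting_like muI.
Proof. exact: counting_like_prod. Qed.

Let muIc := counting_like_ZZ.

Definition fcoef F i : R[i] := coefT (fun x => F (i.1, x)) i.2.

Lemma schwartzZT_slice F j : schwartzZT F -> torus_smooth (fun x => F (j, x)).
Proof.
move=> /schwartzZTP[pF dF]; split; first by move=> x l; exact: pF.
apply: cdecayP => // [_|s]; first exact: (cdecay_smooth j (dF 0%N)).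
have [C hC] := cdecay_bound (fun j => bracketX_ge0 R 0 j) (dF 0%N) s.
by exists C => _ x; have := hC j x; rewrite expr0.
Qed.

Lemma fcoef_decay F N M : schwartzZT F -> exists C, forall i,
  bracket R i.1 ^+ N * (bracket R i.2 ^+ M * cmod (fcoef F i)) <= C.
Proof.
move=> FS; have /schwartzZTP[_ dF] := FS.
have [C hC] := coefT_decay M (fun j => bracketX_ge0 R N j) (dF N) (fun j => schwartzZT_slice j FS).
by exists C => -[j l]; exact: hC.
Qed.

Lemma integrable_bracket2 : muI.-integrable setT
  (fun i => (bracket R i.1 ^- (n.*2) * bracket R i.2 ^- (n.*2))%:E).
Proof.
have p0 (k : Z) : 0 <= bracket R k ^- (n.*2) by rewrite invr_ge0 bracketX_ge0.
have [] // := @cintegrable_prod _ _ _ _ R muZ muZ (fun i => (bracket R i.1 ^- (n.*2) * bracket R i.2 ^- (n.*2))%:C)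
  (fun k => bracket R k ^- (n.*2)) (fun k => bracket R k ^- (n.*2)).
- exact: (counting_like_cmeas muIc).
- exact: integrable_bracket.
- exact: integrable_bracket.
- by move=> j l; rewrite cmod_real ger0_norm// mulr_ge0.
Qed.

                                                                              
                                                                             
                             
Lemma fcoef_weighted F N : schwartzZT F -> muI.-integrable setT
  (EFin \o (fun i => bracket R i.1 ^+ N * (((2 * pi) ^+ N * bracket R i.2 ^+ N) * cmod (fcoef F i)))).
Proof.
move=> FS; have [C hC] := fcoef_decay (N + n.*2) (N + n.*2) FS.
have iC := integrableZl measurableT ((2 * pi) ^+ N * C) integrable_bracket2.
have p0 (k : Z) M : 0 < bracket R k ^+ M := bracketX_gt0 R k M.
have pp : 0 <= (2 * pi) ^+ N :> R by rewrite exprn_ge0// mulr_ge0// pi_ge0.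
have c0 : 0 <= C.
  by apply: le_trans (hC (0, 0)); rewrite !mulr_ge0 ?cmod_ge0 ?(ltW (p0 _ _)).
apply: (le_integrable _ _ _ iC) => //; first exact: (counting_like_meas muIc).
move=> [j l] _ /=; rewrite lee_fin !ger0_norm; last 2 first.
- by rewrite !mulr_ge0 ?invr_ge0 ?(ltW (p0 _ _)).
- by rewrite !mulr_ge0 ?cmod_ge0 ?(ltW (p0 _ _)).
have := hC (j, l) => /=; rewrite !exprD => h.
rewrite -[leRHS]mulrA [leLHS](_ : _ = (2 * pi) ^+ N * (bracket R j ^+ N * (bracket R l ^+ N * cmod (fcoef F (j, l))))); last by ring.
rewrite ler_wpM2l// [leRHS]mulrA ler_pdivlMr// ler_pdivlMr//.
by apply: le_trans h; rewrite le_eqVlt; apply/orP; left; apply/eqP; ring.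
Qed.

Lemma fcoef_integrable F : schwartzZT F -> cintegrable muI (fcoef F).
Proof.
move=> FS; have iw := fcoef_weighted 0 FS.
apply: cintegrable_le iw _; first exact: (counting_like_cmeas muIc).
by move=> i; rewrite !expr0 !mul1r.
Qed.

Lemma temperedZT_bound u : temperedZT u -> exists (N : nat) (c : R), 0 <= c /\
  forall F C, schwartzZT F -> (forall s j x, (size s <= N)%N ->
     bracket R j ^+ N * cmod (partialC s (fun t => F (j, t)) x) <= C) ->
    cmod (u F) <= c * C.
Proof.
move=> [_ [N [c uc]]]; exists N, `|c|; split=> // F C FS FC.
have s0 : (0 <= seminormZT N F)%E.
  apply: (@le_trans _ _ (bracket R (0 : Z) ^+ N * cmod (partialC [::] (fun t => F (0, t)) 0))%:E).
    by rewrite lee_fin mulr_ge0 ?cmod_ge0// bracketX_ge0.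
  by apply: ereal_sup_ubound; exists [::], 0, 0.
rewrite -lee_fin; apply: le_trans (uc F FS) _.
rewrite EFinM; apply: (@le_trans _ _ (`|c|%:E * seminormZT N F)%E).
  by apply: lee_wpmul2r => //; rewrite lee_fin ler_norm.
by apply: lee_wpmul2l; [rewrite lee_fin|exact: seminormZT_le].
Qed.

Lemma partialC_atom i j s : partialC s (fun t => atomZT i (j, t)) =
  (fun x : T => (j == i.1)%:R * (symbol R s i.2 * e2pi (- dot x i.2))).
Proof.
rewrite (_ : (fun t => _) = (fun t : T => (j == i.1)%:R * e2pi (- dot t i.2) + 0)); last first.
  by apply/funext => t; rewrite addr0.
rewrite partialC_lin; [|exact: smoothC_charN|exact: smoothC0].
by apply/funext => x; rewrite partialC0 addr0 partialC_charN.
Qed.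

Lemma partialC_partial_sum (q : nat -> option (Z * Z)) (c : Z * Z -> R[i]) L j s :
  smoothC (fun t : T => partial_sum q (@atomZT R n) c L (j, t)) /\
  partialC s (fun t : T => partial_sum q (@atomZT R n) c L (j, t)) =
  partial_sum q (fun i (x : T) => (j == i.1)%:R * (symbol R s i.2 * e2pi (- dot x i.2))) c L.
Proof.
elim: L => [|L [IHs IH]] /=; first by rewrite partialC0; split => //; exact: smoothC0.
case: (q L) => [i|]; last first.
  by under eq_fun do rewrite add0r; split => //; rewrite IH; apply/funext => x; rewrite add0r.
have sa : smoothC (fun t => @atomZT R n i (j, t)).
  exact: torus_smooth_smooth (schwartzZT_slice j (schwartzZT_atom R i)).
split; first exact: smoothC_lin.
by rewrite (partialC_lin (c i) s sa IHs) IH partialC_atom.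
Qed.

Lemma atom_expansion_integrable F j s (x : T) : schwartzZT F ->
  cintegrable muI (fun i => fcoef F i * ((j == i.1)%:R * (symbol R s i.2 * e2pi (- dot x i.2)))).
Proof.
move=> FS; apply: (cintegrable_le _ (fcoef_weighted (size s) FS)).
  exact: (counting_like_cmeas muIc).
move=> i; rewrite !cmodM cmod_nat cmod_e2pi mulr1.
have h := cmod_symbol R i.2 (leqnn (size s)).
rewrite mulrCA [X in _ * X]mulrC; apply: ler_pM; rewrite ?mulr_ge0 ?cmod_ge0//.
- by case: (_ == _) => //=; rewrite ?bracketX_ge1// (le_trans ler01)// bracketX_ge1.
- by rewrite ler_wpM2r ?cmod_ge0.
Qed.

                                                                            
                                  
Lemma partialC_expansion F j s (x : T) : schwartzZT F ->
  partialC s (fun t => F (j, t)) x =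
  cintegral muI (fun i => fcoef F i * ((j == i.1)%:R * (symbol R s i.2 * e2pi (- dot x i.2)))).
Proof.
move=> FS; rewrite (cintegral_supp_slice muZc (j := j)); last 2 first.
- exact: atom_expansion_integrable.
- by move=> i y ij; rewrite /= eq_sym (negbTE ij) mul0r mulr0.
rewrite (fourier_inversion x (torus_smooth_partial s (schwartzZT_slice j FS))).
apply: cintegral_ext => l; rewrite coefT_partial ?eqxx ?mul1r; last exact: schwartzZT_slice.
by rewrite /fcoef /=; ring.
Qed.

                                                                        
                                                                        
                                                                             
                          
Theorem temperedZT_expansion u F : temperedZT u -> schwartzZT F ->
  cintegrable muI (fun i => fcoef F i * u (atomZT i)) /\
  u F = cintegral muI (fun i => fcoef F i * u (atomZT i)).
Proof.
move=> ut FS; have [N [c [c0 uc]]] := temperedZT_bound ut.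
have [ul _] := ut.
have iw := fcoef_weighted N FS.
have fui : cintegrable muI (fun i => fcoef F i * u (atomZT i)).
  apply: (cintegrable_le _ (integrableZl measurableT c iw)).
    exact: (counting_like_cmeas muIc).
  move=> i; rewrite cmodM /= [X in c * X](_ : _ = cmod (fcoef F i) * (bracket R i.1 ^+ N * ((2 * pi) ^+ N * bracket R i.2 ^+ N))); last by ring.
  rewrite mulrCA ler_wpM2l ?cmod_ge0//.
  apply: uc; first exact: schwartzZT_atom.
  move=> s j x sN; rewrite partialC_atom !cmodM cmod_e2pi mulr1 cmod_nat.
  have [->|_] := eqVneq j i.1; first by rewrite mul1r ler_wpM2l ?bracketX_ge0// cmod_symbol.
  by rewrite mul0r mulr0 !mulr_ge0 ?exprn_ge0 ?mulr_ge0 ?pi_ge0 ?(ltW (bracket_gt0 _ _)).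
split => //.
have [p [q [pK qK]]] := counting_like_index muIc.
apply: (@functional_expansion _ _ _ muI muIc p q pK qK _ (@schwartzZT R n) u (@atomZT R n) (fcoef F) F _ c) => //.
- exact: schwartzZT0.
- exact: schwartzZT_lin.
- exact: schwartzZT_atom.
- exact: iw.
move=> L; apply: uc.
  have := schwartzZT_lin (-1) (partial_sum_closed q (fcoef F) L (@schwartzZT0 R n) (@schwartzZT_lin R n) (@schwartzZT_atom R n)) FS.
  by under eq_fun do rewrite mulN1r.
move=> s j x sN.
have [ps pE] := partialC_partial_sum q (fcoef F) L j s.
rewrite [X in partialC s X](_ : _ = (fun t => (-1) * partial_sum q (@atomZT R n) (fcoef F) L (j, t) + F (j, t))); last first.
  by apply/funext => t; rewrite mulN1r.
rewrite (partialC_lin _ s ps (torus_smooth_smooth (schwartzZT_slice j FS))).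
rewrite pE mulN1r (partialC_expansion j s x FS).
have ei := atom_expansion_integrable j s x FS.
rewrite (@partial_sumE _ _ _ muI muIc p q pK qK T _ (fcoef F) L x ei).
have eiL := cintegrable_below muIc p L ei.
rewrite addrC -cintegralB//.
have di := cintegrableB ei eiL.
apply: le_trans (ler_wpM2l (bracketX_ge0 R N j) (cmod_cintegral_le di)) _.
rewrite -RintegralZl//; last exact: integrable_cmod.
apply: le_Rintegral => //.
- exact: (integrableZl measurableT _ (integrable_cmod di)).
- exact: (integrable_above muIc p L iw).
move=> i _; rewrite (leqNgt L); case: (p i < L)%N => /=.
  by rewrite mulr1 subrr cmod0 !mulr0.
rewrite mulr0 subr0 mulr1 !cmodM cmod_nat cmod_e2pi mulr1.
have [->|_] := eqVneq j i.1.
  rewrite mul1r ler_wpM2l ?bracketX_ge0// mulrC ler_wpM2r ?cmod_ge0//.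
  exact: cmod_symbol.
by rewrite mul0r !mulr0 !mulr_ge0 ?cmod_ge0 ?exprn_ge0 ?mulr_ge0 ?pi_ge0 ?(ltW (bracket_gt0 _ _)).
Qed.

End phase_space_expansion.

                                            

Section product_sigma_finite.
Context d1 d2 (T1 : measurableType d1) (T2 : measurableType d2) (R : realType).
Variable m1 : {sigma_finite_measure set T1 -> \bar R}.
Variable m2 : {sigma_finite_measure set T2 -> \bar R}.

                                                                              
                
Definition sfprod : set (T1 * T2)%type -> \bar R := (m1 \x m2)%E.

HB.instance Definition _ := Measure.on sfprod.

Lemma sigma_finite_sfprod : sigma_finite setT sfprod.
Proof.
have /sigma_finiteP[F [TF ndF Foo]] := sigma_finiteT m1.
have /sigma_finiteP[G [TG ndG Goo]] := sigma_finiteT m2.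
exists (fun n => F n `*` G n).
  apply/seteqP; split => // -[x y] _.
  have [n _ Fnx] : (\bigcup_i F i) x by rewrite -TF.
  have [k _ Gky] : (\bigcup_i G i) y by rewrite -TG.
  exists (maxn n k) => //; split => /=.
    by move: x Fnx; exact/subsetPset/ndF/leq_maxl.
  by move: y Gky; exact/subsetPset/ndG/leq_maxr.
move=> k; have [? ?] := Foo k; have [? ?] := Goo k.
split; first exact: measurableX.
by rewrite [sfprod _]product_measure1E// lte_mul_pinfty// ge0_fin_numE.
Qed.

HB.instance Definition _ :=
  @Measure_isSigmaFinite.Build _ _ _ sfprod sigma_finite_sfprod.

End product_sigma_finite.

Section phase_space_stft.
Variables (R : realType) (n : nat).
Local Notation Z := (Zn n).
Local Notation T := (Tn R n).
Local Notation muZ := (muZ R n).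
Local Notation muI := (muZ \x muZ)%E.
Local Notation haar2 := (haar R n \x haar R n)%E.
Implicit Types (F H G : Z * T -> R[i]) (u : (Z * T -> R[i]) -> R[i]) (i : Z * Z).

Let muZc := counting_like_muZ R n.
Let muIc := counting_like_ZZ R n.

                                                                       
                                            
Lemma coefT_translate (h : T -> R[i]) (omega : T) l : torus_smooth h ->
  coefT (fun x => h (x - omega)) l = e2pi (dot omega l) * coefT h l.
Proof.
move=> hs; have ci := torus_smooth_summable hs.
have ci' : cintegrable muZ (fun l => e2pi (dot omega l) * coefT h l).
  apply: (cintegrable_le _ (integrable_cmod ci)); first exact: (counting_like_cmeas muZc).
  by move=> k; rewrite cmodM cmod_e2pi mul1r.
rewrite -[RHS](series_coefT l ci'); apply: cintegral_ext => x; congr (_ * _).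
rewrite (fourier_inversion _ hs); apply: cintegral_ext => k.
by rewrite dotBl opprB e2piD; ring.
Qed.

Lemma torus_smooth_translate (h : T -> R[i]) (omega : T) : torus_smooth h ->
  torus_smooth (fun x => h (x - omega)).
Proof.
move=> hs; have [ph _] := hs; split; first by move=> x l; rewrite addrAC ph.
apply: cdecayP => // [_|s].
  exact: smoothC_shift (torus_smooth_smooth hs).
have [C hC] := torus_smooth_bound s hs; exists C => _ x.
by rewrite mul1r (partialC_shift (- omega) h).
Qed.

                                                                  
                                                                            
                                                         
Lemma fcoef_test G (m k : Z) (omega xi : T) i : schwartzZT G ->
  fcoef (fun z => e2pi (- dot xi z.1) * e2pi (- dot z.2 k) *
              conjc (G (z.1 - m, z.2 - omega))) i =
  conjc (fcoef G (i.1 - m, - (i.2 - k))) *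
  (e2pi (dot omega (i.2 - k)) * e2pi (- dot xi i.1)).
Proof.
move=> GS; case: i => j l /=.
have gs := schwartzZT_slice (j - m) GS.
have hi := coefT_integrable (- (l - k)) (torus_smooth_translate omega gs).
transitivity (e2pi (- dot xi j) * conjc (coefT (fun x => G (j - m, x - omega)) (- (l - k)))).
  rewrite /coefT -cintegral_conj// -cintegralZ; last exact: cintegrable_conj.
  apply: cintegral_ext => x /=; rewrite conjcM conj_e2pi dotNr opprK dotBr e2piD; ring.
rewrite (coefT_translate _ _ gs) conjcM conj_e2pi dotNr opprK /fcoef /=; ring.
Qed.

                                                                        
                                                                           
                                                              
Lemma stftZTE G u m k (w : T * T) : schwartzZT G -> temperedZT u ->
  cintegrable muI (fun i => u (atomZT i) * conjc (fcoef G (i.1 - m, - (i.2 - k)))) /\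
  stftZT G u (m, w.1, w.2, k) =
  cintegral muI (fun i => u (atomZT i) * conjc (fcoef G (i.1 - m, - (i.2 - k))) *
    (e2pi (dot w.1 (i.2 - k)) * e2pi (- dot w.2 i.1))).
Proof.
move=> GS ut; have [i1 e1] := temperedZT_expansion ut (schwartzZT_test m k w.1 w.2 GS).
split.
  apply: (cintegrable_le _ (integrable_cmod i1)); first exact: (counting_like_cmeas muIc).
  by move=> i /=; rewrite fcoef_test// !cmodM !cmod_e2pi mulr1 mulr1 mulrC.
by rewrite /= e1; apply: cintegral_ext => i; rewrite fcoef_test// [LHS]mulrC !mulrA.
Qed.

Let phase (m i : Z * Z) (w : T * T) : R[i] :=
  e2pi (dot w.1 (i.2 - m.2)) * e2pi (- dot w.2 i.1).

Let cmeas_phase m i : cmeasurable (phase m i).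
Proof.
apply: cmeasM; first exact: (@cmeas_fst _ _ T T R _ (@cmeas_char R n (i.2 - m.2))).
exact: (@cmeas_snd _ _ T T R _ (@cmeas_charN R n i.1)).
Qed.

Let cmod_phase2 m i w : cmod (phase m i w) = 1.
Proof. by rewrite cmodM !cmod_e2pi mulr1. Qed.

Let phase_orth m i i' :
  cintegral haar2 (fun w => phase m i w * conjc (phase m i' w)) = (i == i')%:R.
Proof.
pose a (x : T) := e2pi (dot x (i.2 - m.2)) * conjc (e2pi (dot x (i'.2 - m.2))).
pose b (x : T) := e2pi (- dot x i.1) * conjc (e2pi (- dot x i'.1)).
have ai : cintegrable (haar R n) a.
  apply: (@cintegrable_bounded _ _ _ _ _ 1) => [|x].
    by apply: cmeasM; [exact: cmeas_char|exact/cmeas_conj/cmeas_char].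
  by rewrite cmodM cmod_conj !cmod_e2pi mulr1.
have bi : cintegrable (haar R n) b.
  apply: (@cintegrable_bounded _ _ _ _ _ 1) => [|x].
    by apply: cmeasM; [exact: cmeas_charN|exact/cmeas_conj/cmeas_charN].
  by rewrite cmodM cmod_conj !cmod_e2pi mulr1.
pose f (w : T * T) := phase m i w * conjc (phase m i' w).
have fE (x y : T) : f (x, y) = a x * b y by rewrite /f /phase /a /b conjcM /=; ring.
have fi : cintegrable haar2 f.
  apply: (@cintegrable_bounded _ _ _ _ _ 1) => [|x].
    by apply: cmeasM => //; exact: cmeas_conj.
  by rewrite cmodM cmod_conj !cmod_phase2 mulr1.
have si x : cintegrable (haar R n) (fun y => f (x, y)).
  by under eq_fun do rewrite fE; exact: cintegrableZ.
have [_ <-] := cFubini1 fi si.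
transitivity (cintegral (haar R n) (fun x => a x * (i.1 == i'.1)%:R)).
  apply: cintegral_ext => x; under cintegral_ext do rewrite fE.
  by rewrite cintegralZ// char_orthN.
rewrite cintegralZr// char_orth (inj_eq (addIr _)).
by case: i i' {fE fi si f a b ai bi} => [i1 i2] [j1 j2]; rewrite xpair_eqE /= -natrM mulnb andbC.
Qed.

                                                                           
                                                                
Lemma integral_muZTTZ (f : Z * T * T * Z -> \bar R) : measurable_fun setT f ->
  (forall y, 0 <= f y)%E ->
  (\int[muZTTZ R n]_y f y = \int[muI]_m \int[haar2]_w f (m.1, w.1, w.2, m.2))%E.
Proof.
move=> mf f0; pose rho (m : Z * Z) (w : T * T) : Z * T * T * Z := (m.1, w.1, w.2, m.2).
have mrho m : measurable_fun setT (rho m).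
 apply: measurable_fun_pair; last exact: measurable_cst.
 apply: measurable_fun_pair; last exact: measurable_snd.
 by apply: measurable_fun_pair; [exact: measurable_cst|exact: measurable_fst].
have mfr m : measurable_fun setT (f \o rho m) by exact: measurableT_comp.


pose m2 := sfprod muZ (haar R n).
pose m3 := sfprod m2 (haar R n).
have e1 := @fubini_tonelli2 _ _ _ _ R m3 muZ f mf f0.
have e2 : (\int[muZTTZ R n]_y f y = \int[m3 \x muZ]_y f y)%E by [].
rewrite e2 e1.
rewrite [RHS]fubini_tonelli2; last 2 first.
- exact: (counting_like_meas muIc).
- by move=> m; apply: integral_ge0 => w _.
apply: eq_integral => k _.
have mk : measurable_fun setT (fun y => f (y, k)).
  by apply: measurableT_comp mf _; exact: pair2_measurable.
have g0 y : (0 <= f (y, k))%E by [].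
have e3 := @fubini_tonelli1 _ _ _ _ R m2 (haar R n) (fun y => f (y, k)) mk g0.
have mF := @measurable_fun_fubini_tonelli_F _ _ _ _ R (haar R n) (fun y => f (y, k)) mk g0.
have F0 y : (0 <= fubini_F (haar R n) (fun y => f (y, k)) y)%E by apply: integral_ge0.
have e4 := @fubini_tonelli1 _ _ _ _ R muZ (haar R n) _ mF F0.
transitivity (\int[m2 \x haar R n]_z f (z, k))%E; first by [].
rewrite e3; transitivity (\int[muZ \x haar R n]_z (fubini_F (haar R n) (fun y => f (y, k)) z))%E; first by [].
rewrite e4; apply: eq_integral => m _.
have h0 w : (0 <= (f \o rho (m, k)) w)%E by exact: f0.
exact: (esym (@fubini_tonelli1 _ _ _ _ R (haar R n) (haar R n) _ (mfr (m, k)) h0)).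
Qed.

                                                                           
                                                                              
              
Definition dcoef u i : R[i] := u (atomZT (i.1, - i.2)).

Let refl i : Z * Z := (i.1, - i.2).

Let reflK : cancel refl refl.
Proof. by case=> j l; rewrite /refl /= opprK. Qed.

Lemma sqnorm_refl (c : Z * Z -> R[i]) : sqnorm muI (fun i => c (i.1, - i.2)) = sqnorm muI c.
Proof.
apply: (@counting_like_bij _ _ _ _ _ _ _ refl refl (fun i => (cmod (c i) ^+ 2)%:E) muIc muIc reflK reflK).
by move=> i; rewrite lee_fin sqr_ge0.
Qed.

Lemma cintegrable_refl (c : Z * Z -> R[i]) : cintegrable muI c ->
  cintegrable muI (fun i => c (i.1, - i.2)).
Proof.
move=> ci; apply: cintegrable_lty; first exact: (counting_like_cmeas muIc).
rewrite (@counting_like_bij _ _ _ _ _ _ _ refl refl (fun i => (cmod (c i))%:E) muIc muIc reflK reflK).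
  exact: integral_cmod_lty.
by move=> i; rewrite lee_fin cmod_ge0.
Qed.

Lemma cintegral_refl (c : Z * Z -> R[i]) : 
  cintegral muI (fun i => c (i.1, - i.2)) = cintegral muI c.
Proof.
suff h (f : Z * Z -> R) : (\int[muI]_i f (refl i) = \int[muI]_i f i)%R.
  by rewrite /cintegral (h (fun i => complex.Re (c i))) (h (fun i => complex.Im (c i))).
rewrite /Rintegral; congr fine; rewrite integralE [in RHS]integralE.
have hb (g : Z * Z -> \bar R) := @counting_like_bij _ _ _ _ _ _ _ refl refl g muIc muIc reflK reflK.
have h0 (g : Z * Z -> R) x : (0 <= maxe (g x)%:E 0)%E by rewrite le_max lexx orbT.
congr (_ - _)%E.
  transitivity (\int[muI]_x maxe (f (refl x))%:E 0)%E; first by apply: eq_integral => x _; rewrite funeposE.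
  rewrite (hb (fun x => maxe (f x)%:E 0) (h0 f)).
  by apply: eq_integral => x _; rewrite funeposE.
transitivity (\int[muI]_x maxe (- f (refl x))%:E 0)%E; first by apply: eq_integral => x _; rewrite funenegE.
rewrite (hb (fun x => maxe (- f x)%:E 0) (h0 (fun x => - f x))).
by apply: eq_integral => x _; rewrite funenegE.
Qed.

                                                            
Definition synth (c : Z * Z -> R[i]) (z : Z * T) : R[i] :=
  cintegral muZ (fun l => c (z.1, l) * e2pi (- dot z.2 l)).

Section synthesis.
Variable c : Z * Z -> R[i].
Hypothesis ci : cintegrable muI c.

Let cj j : cintegrable muZ (fun l => c (j, l)) := cintegrable_slice muZc j ci.

Lemma cmeas_synth : cmeasurable (synth c).
Proof.
apply: (cmeas_slices muZc) => j.
exact: cintegrable_meas (series_cintegrable (cj j)).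
Qed.

Let b j := (\int[muZ]_l cmod (c (j, l)))%R.

Let b_ge0 j : 0 <= b j.
Proof. by apply: Rintegral_ge0 => l _; exact: cmod_ge0. Qed.

Let b_int : muZ.-integrable setT (EFin \o b).
Proof.
have := integrable_fubini_F (integrable_cmod ci).
apply: eq_integrable => // j _; rewrite /fubini_F /= /b /Rintegral fineK//.
exact: integrable_fin_num (integrable_cmod (cj j)).
Qed.

Let synth_le j x : cmod (synth c (j, x)) <= b j.
Proof. exact: (cmod_series_le muZc (chi := fun l (x : T) => e2pi (- dot x l)) (fun l x => cmod_e2pi _) (cj j)). Qed.

Lemma cintegrable_synth : cintegrable (muZT R n) (synth c).
Proof.
apply: (cintegrable_prod cmeas_synth b_int (integrable_unit (haar R n))) => // j x.
by rewrite mulr1 synth_le.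
Qed.

Lemma sqnorm_synth : sqnorm (muZT R n) (synth c) = sqnorm muI c.
Proof.
have sq0 (C : R[i]) : (0 <= (cmod C ^+ 2)%:E)%E by rewrite lee_fin sqr_ge0.
rewrite /sqnorm /muZT fubini_tonelli1//; last first.
  apply/measurable_EFinP/measurable_funX/cmeas_cmod; exact: cmeas_synth.
rewrite [RHS]fubini_tonelli1//; last exact: (counting_like_meas muIc).
apply: eq_integral => j _.
exact: (@parseval _ _ _ muZ muZc _ _ (haar R n) (fun l (x : T) => e2pi (- dot x l))
  (@cmeas_charN R n) (fun l x => cmod_e2pi _) (@char_orthN R n) _ (cj j)).
Qed.

End synthesis.

Lemma synth_fcoef G : schwartzZT G -> synth (fcoef G) = G.
Proof.
move=> GS; apply/funext => -[j x]; rewrite /synth /=.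
by rewrite [RHS](fourier_inversion x (schwartzZT_slice j GS)).
Qed.

Lemma sqnorm_fcoef G : schwartzZT G -> sqnorm muI (fcoef G) = sqnorm (muZT R n) G.
Proof. by move=> GS; rewrite -sqnorm_synth ?synth_fcoef//; exact: fcoef_integrable. Qed.

Lemma fcoef_neq0 G : schwartzZT G -> (exists z, G z <> 0) -> exists i, fcoef G i != 0.
Proof.
move=> GS [z Gz]; apply: contrapT => h; apply: Gz; rewrite -(synth_fcoef GS).
rewrite /synth (_ : (fun _ => _) = (fun=> 0)) ?cintegral0//.
apply/funext => l; suff -> : fcoef G (z.1, l) = 0 by rewrite mul0r.
by apply/eqP/negP => /negP ?; apply: h; exists (z.1, l).
Qed.

                                                                           
                                                                         
              
Theorem modulZT_coef G u : schwartzZT G -> (exists z, G z <> 0) -> modulZT G 1%E u ->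
  [/\ cintegrable muI (dcoef u),
      (normMZT G 1%E u < +oo)%E &
      (sqnorm muI (dcoef u) * sqnorm (muZT R n) G <= normMZT G 1%E u * normMZT G 1%E u)%E].
Proof.
move=> GS G0 [ut [mV VL]].
have [[j0 l0] gi0] := fcoef_neq0 GS G0.
have VE := fun m k w => stftZTE m k w GS ut.
have X0 : (0 <= normMZT G 1%E u)%E.
  by rewrite /normMZT normLp1E; apply: integral_ge0 => x _; rewrite lee_fin cmod_ge0.
have XF : normMZT G 1%E u = (fine (normMZT G 1%E u))%:E by rewrite fineK// ge0_fin_numE.
set X := fine _ in XF.
pose gam i := fcoef G (refl i).
have gi : cintegrable (sfprod muZ muZ) gam := cintegrable_refl (fcoef_integrable GS).
have gi0' : gam (j0, - l0) != 0 by rewrite /gam /refl /= opprK.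
pose s (i m : Z * Z) := i - m.
have XE : (\int[sfprod muZ muZ]_m \int[haar2]_w (cmod (cintegral (sfprod muZ muZ)
     (fun i => u (atomZT i) * conjc (gam (s i m)) * phase m i w)))%:E = X%:E)%E.
  rewrite -XF /normMZT normLp1E integral_muZTTZ; last 2 first.
  - exact/measurable_EFinP/cmeas_cmod.
  - by move=> z; rewrite lee_fin cmod_ge0.
  apply: eq_integral => -[m k] _; apply: eq_integral => w _.
  by have [_ ->] := VE m k w.
have sl m : exists h : Z * Z -> Z * Z, cancel (fun k => s k m) h /\ cancel h (fun k => s k m).
  by exists (fun k => k + m); split => k; rewrite /s ?subrK ?addrK.
have sr (k : Z * Z) : cancel (s k) (s k).
  by move=> m; rewrite /s opprB addrC subrK.
have cgi m : cintegrable (sfprod muZ muZ) (fun i => u (atomZT i) * conjc (gam (s i m))).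
  by case: m => m k; have [h _] := VE m k (0, 0).
pose P2 : probability (T * T)%type R := (haar R n \x haar R n)%E.
have muIs : counting_like (sfprod muZ muZ) := muIc.
have fin := @stft_coef_integrable _ _ R _ muIs _ _ P2 s sl sr phase cmeas_phase cmod_phase2
  phase_orth _ gam _ gi0' cgi X XE.
have l2b := @stft_coef_l2 _ _ R _ muIs _ _ P2 s sl sr phase cmeas_phase cmod_phase2
  phase_orth _ gam gi _ gi0' cgi X XE.
split; [exact: (cintegrable_refl fin)|by []|].
rewrite -(sqnorm_fcoef GS) -(sqnorm_refl (dcoef u)) -(sqnorm_refl (fcoef G)) XF -EFinM -expr2.
rewrite (_ : (fun i => dcoef u _) = (fun i => u (atomZT i))); first exact: l2b.
by apply/funext => -[j l]; rewrite /dcoef /= opprK.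
Qed.

End phase_space_stft.

                                              

Section representation.
Variables (R : realType) (n : nat).
Local Notation Z := (Zn n).
Local Notation T := (Tn R n).
Local Notation muZ := (muZ R n).
Local Notation muI := (muZ \x muZ)%E.
Implicit Types (F G s : Z * T -> R[i]) (u : (Z * T -> R[i]) -> R[i]) (i : Z * Z).

Let muZc := counting_like_muZ R n.
Let muIc := counting_like_ZZ R n.

Lemma schwartzZT_meas F : schwartzZT F -> cmeasurable F.
Proof.
by move=> FS; apply: (cmeas_slices muZc) => j; exact: torus_smooth_meas (schwartzZT_slice j FS).
Qed.

Lemma schwartzZT_bound F : schwartzZT F -> exists M, forall z, cmod (F z) <= M.
Proof.
move=> /schwartzZTP[_ dF]; have [C hC] := cdecay_bound (fun j => bracketX_ge0 R 0 j) (dF 0%N) [::].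
by exists C => -[j x]; have := hC j x; rewrite expr0 mul1r /partialC /= complex_eta.
Qed.

                                                                              
                                                                              
Lemma synth_represents u : temperedZT u -> cintegrable muI (dcoef u) ->
  represented u (synth (dcoef u)).
Proof.
move=> ut ci; have sm := cmeas_synth ci; have si := cintegrable_synth ci.
split => // F FS; have [M FM] := schwartzZT_bound FS.
have mF := schwartzZT_meas FS.
have sFi : cintegrable (muZT R n) (fun z => synth (dcoef u) z * F z).
  apply: (cintegrable_le _ (integrableZl measurableT M (integrable_cmod si))).
    exact: cmeasM.
  by move=> z; rewrite cmodM mulrC ler_wpM2r ?cmod_ge0.
split => //.
have [fui ->] := temperedZT_expansion ut FS.
have [_ ->] := cintegral_sum_slices muZc sFi.
rewrite -cintegral_refl.
have [_ ->] := cintegral_sum_slices muZc (cintegrable_refl fui).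
apply: cintegral_ext => j /=.
have cj := cintegrable_slice muZc j ci.
have Fj := torus_smooth_integrable (schwartzZT_slice j FS).
have [_] := @series_pairing _ _ _ muZ muZc _ _ (haar R n) (fun l (x : T) => e2pi (- dot x l))
  (@cmeas_charN R n) (fun l x => cmod_e2pi _) _ cj _ Fj.
rewrite /synth /= => ->; apply: cintegral_ext => l.
rewrite mulrC /dcoef /= /fcoef /coefT /=; congr (_ * _).
by apply: cintegral_ext => x; rewrite dotNr mulrC.
Qed.

                                                                             
Lemma represented_slice u s j : represented u s ->
  cintegrable (haar R n) (fun x => s (j, x)) /\
  forall l, coefT (fun x => s (j, x)) l = u (atomZT (j, - l)).
Proof.
move=> [sm su].
have key l : cintegrable (haar R n) (fun x => s (j, x) * atomZT (j, l) (j, x)) /\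
    u (atomZT (j, l)) = cintegral (haar R n) (fun x => s (j, x) * atomZT (j, l) (j, x)).
  have [si ->] := su _ (schwartzZT_atom R (j, l)); split.
    exact: (cintegrable_slice muZc j si).
  rewrite (cintegral_supp_slice muZc (j := j))// => i y ij.
  by rewrite /atomZT /= (negbTE ij) mul0r mulr0.
split=> [|l].
  have [k _] := key 0; move: k.
  by under eq_fun do rewrite /atomZT /= eqxx mul1r -dotNr oppr0 dot0r e2pi0 mulr1.
have [_ ->] := key (- l); apply: cintegral_ext => x.
by rewrite /atomZT /= eqxx mul1r dotNr opprK.
Qed.

                                                                        
Theorem represented_unique u s s' : represented u s -> represented u s' ->
  {ae muZT R n, forall z, s z = s' z}.
Proof.
move=> us us'; have [sm _] := us; have [sm' _] := us'.
have dm := cmeasB sm sm'.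
have mcd : measurable_fun setT (fun z => (cmod (s z - s' z))%:E).
  exact/measurable_EFinP/cmeas_cmod.
suff : (\int[muZT R n]_z `|(cmod (s z - s' z))%:E| = 0)%E.
  move=> /(ae_eq_integral_abs _ measurableT mcd); apply: filterS => z /(_ I) [].
  by move/eqP; rewrite cmod_eq0 subr_eq0 => /eqP.
under eq_integral do rewrite abse_EFin ger0_norm ?cmod_ge0//.
rewrite fubini_tonelli1//; last by move=> z; rewrite lee_fin cmod_ge0.
rewrite integral0_eq// => j _; rewrite /fubini_F.
have [ij cj] := represented_slice j us; have [ij' cj'] := represented_slice j us'.
have di := cintegrableB ij ij'.
have d0 l : coefT (fun x => s (j, x) - s' (j, x)) l = 0.
  rewrite /coefT; under cintegral_ext do rewrite mulrBl.
  rewrite cintegralB; try exact: cintegrable_mul_char.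
  by move: (cj l) (cj' l); rewrite /coefT => -> ->; rewrite subrr.
have m0 := cmeas_section1 j dm.
rewrite (@ae_eq_integral _ _ _ (haar R n) setT (cst 0)%E (fun x => (cmod (s (j, x) - s' (j, x)))%:E))//.
- by rewrite integral0.
- exact/measurable_EFinP/cmeas_cmod.
- by apply: filterS (fourier_unique di d0) => x -> _; rewrite cmod0.
Qed.

End representation.

                               

Section cauchy_schwarz.
Context d (T : measurableType d) (R : realType).
Variable mu : {measure set T -> \bar R}.
Implicit Types f g : T -> R[i].

Definition nrm2 f : R := Num.sqrt (fine (sqnorm mu f)).

Lemma nrm2_ge0 f : 0 <= nrm2 f.
Proof. exact: sqrtr_ge0. Qed.

Lemma cauchy_schwarz f g : cmeasurable f -> cmeasurable g ->
  (sqnorm mu f < +oo)%E -> (sqnorm mu g < +oo)%E ->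
  (\int[mu]_x (cmod (f x) * cmod (g x))%:E <=
   (nrm2 f * nrm2 g)%:E)%E.
Proof.
move=> mf mg fl gl.
have z2 : 0 < 2 :> R by rewrite ltr0n.
have := @hoelder _ T R mu (fun x => cmod (f x)) (fun x => cmod (g x)) 2 2
  (cmeas_cmod mf) (cmeas_cmod mg) z2 z2.
have h2 : 2^-1 + 2^-1 = 1 :> R by lra.
move=> /(_ h2).
rewrite -[X in (_ <= X * _)%E]/(normLp mu 2%:E f) -[X in (_ <= _ * X)%E]/(normLp mu 2%:E g).
rewrite !normLp2_fin// EFinM Lnorm1; apply: le_trans.
rewrite le_eqVlt; apply/orP; left; apply/eqP/eq_integral => x _.
by rewrite /= ger0_norm// mulr_ge0 ?cmod_ge0.
Qed.

Lemma cintegrable_mul2 f g : cmeasurable f -> cmeasurable g ->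
  (sqnorm mu f < +oo)%E -> (sqnorm mu g < +oo)%E ->
  cintegrable mu (fun x => f x * g x) /\
  cmod (cintegral mu (fun x => f x * g x)) <=
    nrm2 f * nrm2 g.
Proof.
move=> mf mg fl gl; have cs := cauchy_schwarz mf mg fl gl.
have fgi : cintegrable mu (fun x => f x * g x).
  apply: cintegrable_lty; first exact: cmeasM.
  by under eq_integral do rewrite cmodM; exact: le_lt_trans cs (ltry _).
split => //; rewrite -lee_fin.
apply: le_trans (cmod_cintegral_lee fgi) _.
by under eq_integral do rewrite cmodM.
Qed.

End cauchy_schwarz.

Section localization.
Variables (R : realType) (n : nat).
Local Notation Z := (Zn n).
Local Notation T := (Tn R n).
Local Notation muZ := (muZ R n).
Local Notation muZT := (muZT R n).
Implicit Types (g f h : Z -> R[i]) (s : Z * T -> R[i]).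

Let muZc := counting_like_muZ R n.

Lemma l2P f : l2 f <-> (sqnorm muZ f < +oo)%E.
Proof.
rewrite /l2 inLp2P; by split => [[]//|]; split => //; exact: (counting_like_cmeas muZc).
Qed.

Lemma sqnorm_shift g (m : Z) : sqnorm muZ (fun k => g (k - m)) = sqnorm muZ g.
Proof.
apply: (@counting_like_bij _ _ _ _ _ _ _ (fun k : Z => k - m) (fun k => k + m)
  (fun k => (cmod (g k) ^+ 2)%:E) muZc muZc (subrK m) (addrK m)).
by move=> k; rewrite lee_fin sqr_ge0.
Qed.

Lemma sqnorm_reflect g (k : Z) : sqnorm muZ (fun m => g (k - m)) = sqnorm muZ g.
Proof.
have sr : cancel (fun m : Z => k - m) (fun m : Z => k - m) by move=> m; rewrite opprB addrC subrK.
apply: (@counting_like_bij _ _ _ _ _ _ _ (fun m : Z => k - m) (fun m : Z => k - m)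
  (fun m => (cmod (g m) ^+ 2)%:E) muZc muZc sr sr).
by move=> m; rewrite lee_fin sqr_ge0.
Qed.

Lemma stft_kernelE g f (z : Z * T) k :
  f k * conjc (modulation z.2 (translation z.1 g) k) =
  (f k * conjc (g (k - z.1))) * e2pi (- dot z.2 k).
Proof. by rewrite /modulation /translation conjcM conj_e2pi mulrCA mulrC. Qed.

Section windows.
Variable g : Z -> R[i].
Hypothesis gi : cintegrable muZ g.

Let g2 : (sqnorm muZ g < +oo)%E := counting_like_sqnorm_lty muZc gi.

Section signal.
Variable f : Z -> R[i].
Hypothesis f2 : (sqnorm muZ f < +oo)%E.

Let gconj2 (m : Z) : sqnorm muZ (fun k => conjc (g (k - m))) = sqnorm muZ g.
Proof.
by rewrite -(sqnorm_shift g m); apply: eq_integral => k _; rewrite cmod_conj.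
Qed.

Lemma stft_slice m : cintegrable muZ (fun k => f k * conjc (g (k - m))).
Proof.
by have [] := @cintegrable_mul2 _ _ R muZ f (fun k => conjc (g (k - m)))
  (counting_like_cmeas muZc _) (counting_like_cmeas muZc _) f2; rewrite ?gconj2.
Qed.

Lemma stft_integrable (z : Z * T) :
  cintegrable muZ (fun k => f k * conjc (modulation z.2 (translation z.1 g) k)).
Proof.
apply: (cintegrable_le _ (integrable_cmod (stft_slice z.1))).
  exact: (counting_like_cmeas muZc).
by move=> k; rewrite stft_kernelE cmodM cmod_e2pi mulr1.
Qed.

Lemma stftE m (w : T) : stft g f (m, w) =
  cintegral muZ (fun k => f k * conjc (g (k - m)) * e2pi (- dot w k)).
Proof. by apply: cintegral_ext => k; rewrite stft_kernelE. Qed.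

Lemma cmeas_stft : cmeasurable (stft (R := R) g f).
Proof.
apply: (cmeas_slices muZc) => m; under eq_fun do rewrite stftE.
exact: cintegrable_meas (series_cintegrable (stft_slice m)).
Qed.

                                                                         
Lemma stft_bound (z : Z * T) : cmod (stft g f z) <= nrm2 muZ f * nrm2 muZ g.
Proof.
have E : sqnorm muZ (fun k => conjc (modulation z.2 (translation z.1 g) k)) = sqnorm muZ g.
  rewrite -(gconj2 z.1); apply: eq_integral => k _.
  by rewrite !cmod_conj cmodM cmod_e2pi mul1r.
have := @cintegrable_mul2 _ _ R muZ f (fun k => conjc (modulation z.2 (translation z.1 g) k))
  (counting_like_cmeas muZc _) (counting_like_cmeas muZc _) f2.
by rewrite /nrm2 E => /(_ g2) [].
Qed.

                                                                               
Lemma sqnorm_stft : sqnorm muZT (stft (R := R) g f) = (sqnorm muZ f * sqnorm muZ g)%E.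
Proof.
rewrite /sqnorm /muZT fubini_tonelli1//; last 2 first.
- apply/measurable_EFinP/measurable_funX/cmeas_cmod; exact: cmeas_stft.
- by move=> z; rewrite lee_fin sqr_ge0.
transitivity (\int[muZ]_m \int[muZ]_k (cmod (f k) ^+ 2 * cmod (g (k - m)) ^+ 2)%:E)%E.
  apply: eq_integral => m _; rewrite /fubini_F.
  under eq_integral do rewrite stftE.
  rewrite (@parseval _ _ _ muZ muZc _ _ (haar R n) (fun l (x : T) => e2pi (- dot x l))
    (@cmeas_charN R n) (fun l x => cmod_e2pi _) (@char_orthN R n) _ (stft_slice m)).
  by apply: eq_integral => k _; rewrite cmodM cmod_conj exprMn.
have mk : measurable_fun setT (fun z : Z * Z => (cmod (f z.2) ^+ 2 * cmod (g (z.2 - z.1)) ^+ 2)%:E).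
  exact: (counting_like_meas (counting_like_ZZ R n)).
have k0 (z : Z * Z) : (0 <= (cmod (f z.2) ^+ 2 * cmod (g (z.2 - z.1)) ^+ 2)%:E)%E.
  by rewrite lee_fin mulr_ge0 ?sqr_ge0.
rewrite (@fubini_tonelli _ _ _ _ _ muZ muZ (fun z : Z * Z => (cmod (f z.2) ^+ 2 * cmod (g (z.2 - z.1)) ^+ 2)%:E) mk k0).
rewrite -ge0_integralZr//; last 2 first.
- by move=> x _; rewrite lee_fin sqr_ge0.
- exact: sqnorm_ge0.
apply: eq_integral => k _ /=.
under eq_integral do rewrite EFinM.
rewrite ge0_integralZl//; last 2 first.
- by move=> x _; rewrite lee_fin sqr_ge0.
- by rewrite lee_fin sqr_ge0.
by congr (_ * _)%E; exact: (sqnorm_reflect g k).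
Qed.

End signal.
End windows.


Section operator.
Variable s : Z * T -> R[i].
Hypothesis sm : cmeasurable s.
Hypothesis si : cintegrable muZT s.
Hypothesis s2 : (sqnorm muZT s < +oo)%E.
Variables g1 g2 : Z -> R[i].
Hypothesis g1i : cintegrable muZ g1.
Hypothesis g2i : cintegrable muZ g2.

Let SF := sfprod muZ (haar R n).

Let g2l : (sqnorm muZ g2 < +oo)%E := counting_like_sqnorm_lty muZc g2i.


Lemma cmeas_window g k :
  cmeasurable (fun z : Z * T => modulation z.2 (translation z.1 g) k).
Proof.
apply: (cmeas_slices muZc) => m; apply: cmeasM; first exact: cmeas_char.
by rewrite /translation /=; exact: cmeas_cst.
Qed.

Section fixed_signal.
Variable f : Z -> R[i].
Hypothesis f2 : (sqnorm muZ f < +oo)%E.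

Lemma locop_kernel_integrable k : cintegrable muZT (locop_kernel s g1 g2 f k).
Proof.
apply: (cintegrable_le _ (integrableZl measurableT (nrm2 muZ f * nrm2 muZ g1 * nrm2 muZ g2) (integrable_cmod si))).
  by apply: cmeasM; [apply: cmeasM => //; exact: cmeas_stft|exact: cmeas_window].
move=> z; rewrite /locop_kernel !cmodM cmod_e2pi mul1r mulrAC [leRHS]mulrC -mulrA ler_wpM2l ?cmod_ge0//.
rewrite mulrC; apply: ler_pM; rewrite ?cmod_ge0 ?stft_bound//.
exact: (counting_like_sqnorm_bound muZc (c := g2)).
Qed.

                                                                            
                                                                             
                                                                             
                                    
Lemma weighted_kernel_integrable h (M : R) : (forall k, cmod (h k) <= M) ->
  cintegrable (muZ \x SF)%E
    (fun y : Z * (Z * T) => locop_kernel s g1 g2 f y.1 y.2 * conjc (h y.1)).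
Proof.
move=> hM; pose A := nrm2 muZ f * nrm2 muZ g1.
have M0 : 0 <= M by exact: le_trans (cmod_ge0 _) (hM 0).
have A0 : 0 <= A by rewrite mulr_ge0 ?nrm2_ge0.
pose F (y : Z * (Z * T)) := locop_kernel s g1 g2 f y.1 y.2 * conjc (h y.1).
have mF : cmeasurable F.
  apply: (cmeas_slices muZc) => k; apply: cmeasM; last by rewrite /=; exact: cmeas_cst.
  exact: cintegrable_meas (locop_kernel_integrable k).
have mcF : measurable_fun setT (fun y => (cmod (F y))%:E).
  exact/measurable_EFinP/cmeas_cmod.
have cF0 y : (0 <= (cmod (F y))%:E)%E by rewrite lee_fin cmod_ge0.
apply: (cintegrable_lty mF).
rewrite (@fubini_tonelli2 _ _ _ _ R muZ SF _ mcF cF0).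
pose N1 := (\int[muZ]_k cmod (g2 k))%R.
apply: (@le_lt_trans _ _ (\int[muZT]_z ((A * M * N1)%:E * (cmod (s z))%:E))%E); last first.
  exact: (integrable_lty measurableT (integrableZl measurableT (A * M * N1) (integrable_cmod si))).
apply: ge0_le_integral => //.
- by move=> z _; apply: integral_ge0.
- exact: (@measurable_fun_fubini_tonelli_G _ _ _ _ R muZ _ mcF cF0).
- by apply: emeasurable_funM; [exact: measurable_cst|exact/measurable_EFinP/cmeas_cmod].
move=> z _; rewrite /fubini_G.
apply: (@le_trans _ _ (\int[muZ]_k ((A * M * cmod (s z))%:E * (cmod (g2 (k - z.1)))%:E))%E).
  apply: ge0_le_integral => //; try exact: (counting_like_meas muZc).
  move=> k _; rewrite -EFinM lee_fin /F /locop_kernel !cmodM cmod_e2pi mul1r cmod_conj /=.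
  rewrite [leLHS](_ : _ = (cmod (stft g1 f z) * cmod (h k)) * (cmod (s z) * cmod (g2 (k - z.1)))); last by ring.
  rewrite -[leRHS]mulrA ler_wpM2r ?mulr_ge0 ?cmod_ge0//.
  by apply: ler_pM; rewrite ?cmod_ge0 ?stft_bound.
rewrite ge0_integralZl//; last 2 first.
- by move=> k _; rewrite lee_fin cmod_ge0.
- by rewrite lee_fin mulr_ge0 ?cmod_ge0// mulr_ge0.
rewrite (@counting_like_bij _ _ _ _ _ _ _ (fun k : Z => k - z.1) (fun k => k + z.1)
  (fun k => (cmod (g2 k))%:E) muZc muZc (subrK z.1) (addrK z.1)); last first.
  by move=> k; rewrite lee_fin cmod_ge0.
rewrite -[X in (_ * X)%E]fineK; last exact: integrable_fin_num (integrable_cmod g2i).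
by rewrite -!EFinM lee_fin mulrAC.
Qed.

                                                                    
Lemma locop_summable : cintegrable muZ (locop s g1 g2 f).
Proof.
have w := @weighted_kernel_integrable (fun=> 1) 1.
have [||h _] := cFubini1 (w _).
- by move=> k; rewrite cmod1.
- move=> k; have := locop_kernel_integrable k.
  by under [X in _ -> cintegrable _ X]eq_fun do rewrite conjc1 mulr1.
by move: h; under eq_fun do under cintegral_ext do rewrite conjc1 mulr1.
Qed.

Lemma locop_l2 : (sqnorm muZ (locop s g1 g2 f) < +oo)%E.
Proof. exact: (counting_like_sqnorm_lty muZc locop_summable). Qed.

Section weak_form.
Variable h : Z -> R[i].
Hypothesis h2 : (sqnorm muZ h < +oo)%E.

Lemma weak_integrable : cintegrable muZT (weak_integrand s g1 g2 f h).
Proof.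
apply: (cintegrable_le _ (integrableZl measurableT (nrm2 muZ f * nrm2 muZ g1 * (nrm2 muZ h * nrm2 muZ g2)) (integrable_cmod si))).
  by apply: cmeasM; [apply: cmeasM => //; exact: cmeas_stft|apply: cmeas_conj; exact: cmeas_stft].
move=> z; rewrite /weak_integrand !cmodM cmod_conj [leRHS]mulrC -mulrA ler_wpM2l ?cmod_ge0//.
by apply: ler_pM; rewrite ?cmod_ge0 ?stft_bound.
Qed.

Lemma locop_weakE :
  inner (locop s g1 g2 f) h = cintegral muZT (weak_integrand s g1 g2 f h).
Proof.
have w := weighted_kernel_integrable (fun k => counting_like_sqnorm_bound muZc k h2).
have sec1 k : cintegrable muZT (fun z => locop_kernel s g1 g2 f k z * conjc (h k)).
  by have := cintegrableZ (conjc (h k)) (locop_kernel_integrable k); under eq_fun do rewrite mulrC.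
have sec z : cintegrable muZ (fun k => modulation z.2 (translation z.1 g2) k * conjc (h k)).
  have := cintegrable_conj (stft_integrable g2i h2 z).
  by under eq_fun do rewrite conjcM conjcK mulrC.
have sec2 z : cintegrable muZ (fun k => locop_kernel s g1 g2 f k z * conjc (h k)).
  have := cintegrableZ (s z * stft g1 f z) (sec z).
  by under eq_fun do rewrite mulrA.
have [_ e1] := cFubini1 w sec1; have [_ e2] := cFubini2 w sec2.
transitivity (cintegral muZ (fun k => cintegral muZT (fun z => locop_kernel s g1 g2 f k z * conjc (h k)))).
  by apply: cintegral_ext => k; rewrite cintegralZr//; exact: locop_kernel_integrable.
rewrite [LHS]e1 -e2; apply: cintegral_ext => z /=.
rewrite /weak_integrand -cintegral_conj; last exact: stft_integrable.
rewrite -cintegralZ; last exact: cintegrable_conj (stft_integrable g2i h2 z).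
by apply: cintegral_ext => k; rewrite conjcM conjcK /locop_kernel -mulrA [X in _ * X]mulrC.
Qed.

                                                                     
                                                   
Lemma weak_bound : cmod (cintegral muZT (weak_integrand s g1 g2 f h)) <=
  nrm2 muZT s * nrm2 muZ g1 * nrm2 muZ g2 * nrm2 muZ f * nrm2 muZ h.
Proof.
have V2l : (sqnorm muZT (stft g2 h) < +oo)%E.
  by rewrite sqnorm_stft// lte_mul_pinfty ?sqnorm_ge0// ge0_fin_numE ?sqnorm_ge0.
have V2 : nrm2 muZT (stft g2 h) = nrm2 muZ h * nrm2 muZ g2.
  rewrite /nrm2 sqnorm_stft// fineM ?ge0_fin_numE ?sqnorm_ge0// sqrtrM//.
  exact/fine_ge0/sqnorm_ge0.
have mV2 := cmeas_stft g2i h2.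
have cs := cauchy_schwarz sm mV2 s2 V2l.
rewrite -lee_fin; apply: le_trans (cmod_cintegral_lee weak_integrable) _.
pose A := nrm2 muZ f * nrm2 muZ g1.
have A0 : 0 <= A by rewrite mulr_ge0 ?nrm2_ge0.
apply: (@le_trans _ _ (\int[muZT]_z (A%:E * (cmod (s z) * cmod (stft g2 h z))%:E))%E).
  apply: ge0_le_integral => //.
  - by move=> z _; rewrite lee_fin cmod_ge0.
  - exact/measurable_EFinP/cmeas_cmod/(cintegrable_meas weak_integrable).
  - apply: emeasurable_funM; first exact: measurable_cst.
    by apply/measurable_EFinP/measurable_funM; exact: cmeas_cmod.
  - move=> z _; rewrite -EFinM lee_fin /weak_integrand !cmodM cmod_conj.
    rewrite mulrAC mulrC ler_wpM2r ?mulr_ge0 ?cmod_ge0//.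
    exact: stft_bound.
rewrite ge0_integralZl//; last 2 first.
- by apply/measurable_EFinP/measurable_funM; exact: cmeas_cmod.
- by move=> z _; rewrite lee_fin mulr_ge0 ?cmod_ge0.
apply: (@le_trans _ _ (A%:E * (nrm2 muZT s * nrm2 muZT (stft g2 h))%:E)%E).
  by apply: lee_wpmul2l => //; rewrite lee_fin.
by rewrite -EFinM lee_fin V2 le_eqVlt /A; apply/orP; left; apply/eqP; ring.
Qed.

End weak_form.

                                                                              
                            
Lemma locop_bound : nrm2 muZ (locop s g1 g2 f) <=
  nrm2 muZT s * nrm2 muZ g1 * nrm2 muZ g2 * nrm2 muZ f.
Proof.
set L := locop s g1 g2 f; set K := _ * _ * _ * _.
have K0 : 0 <= K by rewrite !mulr_ge0 ?nrm2_ge0.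
have Lc : cmeasurable L := counting_like_cmeas muZc L.
have L2 := locop_l2.
have Lc2 : (sqnorm muZ (fun k => conjc (L k)) < +oo)%E.
  by rewrite (_ : sqnorm _ _ = sqnorm muZ L)//; apply: eq_integral => k _; rewrite cmod_conj.
have [LL _] := cintegrable_mul2 Lc (cmeas_conj Lc) L2 Lc2.
have [_ E] := cintegral_sqr LL.
have := weak_bound L2; rewrite -locop_weakE// /inner E cmod_real.
rewrite ger0_norm ?fine_ge0 ?sqnorm_ge0// -/K.
rewrite -{1}(sqr_sqrtr (fine_ge0 (sqnorm_ge0 muZ L))) -/(nrm2 muZ L) expr2.
have [->//|N0] := eqVneq (nrm2 muZ L) 0.
by rewrite ler_pM2r// lt_def N0 nrm2_ge0.
Qed.

End fixed_signal.

Lemma locop_linear (a : R[i]) f h k : (sqnorm muZ f < +oo)%E -> (sqnorm muZ h < +oo)%E ->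
  locop s g1 g2 (fun j => a * f j + h j) k = a * locop s g1 g2 f k + locop s g1 g2 h k.
Proof.
move=> fl hl; have kf := locop_kernel_integrable fl k; have kh := locop_kernel_integrable hl k.
rewrite /locop -cintegralZ// -cintegralD//; last exact: cintegrableZ.
apply: cintegral_ext => z; rewrite /locop_kernel.
have -> : stft g1 (fun j => a * f j + h j) z = a * stft g1 f z + stft g1 h z.
  have vf := stft_integrable g1i fl z; have vh := stft_integrable g1i hl z.
  rewrite /stft -cintegralZ// -cintegralD//; last exact: cintegrableZ.
  by apply: cintegral_ext => j; rewrite mulrDl mulrA.
ring.
Qed.

Theorem locop_bounded : let L := locop s g1 g2 in
  [/\ locop_converges s g1 g2, locop_weak s g1 g2 L, bounded_operator L &
      (opnorm L <= (nrm2 muZT s * nrm2 muZ g1 * nrm2 muZ g2)%:E)%E].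
Proof.
move=> L; have opL : (opnorm L <= (nrm2 muZT s * nrm2 muZ g1 * nrm2 muZ g2)%:E)%E.
  apply: ge_ereal_sup => _ [f [/l2P f2 f1] <-].
  rewrite /norm2 normLp2_fin; last exact: locop_l2.
  move: f1; rewrite /norm2 normLp2_fin// !lee_fin => f1.
  apply: le_trans (locop_bound f2) _.
  by rewrite ler_piMr// !mulr_ge0 ?nrm2_ge0.
split => //.
- move=> f /l2P f2; split => [z|k]; first exact: stft_integrable.
  exact: locop_kernel_integrable.
- move=> f h /l2P f2 /l2P h2; split; first exact: weak_integrable.
  exact: locop_weakE.
- split; last exact: le_lt_trans opL (ltry _).
    by move=> f /l2P f2; apply/l2P; exact: locop_l2.
  by move=> a f h /l2P f2 /l2P h2 k; exact: locop_linear.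
Qed.

End operator.
End localization.

                          

Section final_estimate.
Variables (R : realType) (n : nat).
Local Notation Z := (Zn n).
Local Notation T := (Tn R n).
Local Notation muZ := (muZ R n).
Local Notation muZT := (muZT R n).

Let muZc := counting_like_muZ R n.
Let muIc := counting_like_ZZ R n.

Lemma schwartzZ_sqnorm (g : Z -> R[i]) : schwartzZ g -> (exists k, g k <> 0) ->
  (0 < sqnorm muZ g < +oo)%E.
Proof.
move=> gS [k gk]; rewrite (counting_like_sqnorm_lty muZc (schwartzZ_integrable gS)) andbT.
by apply: (counting_like_sqnorm_gt0 muZc (i := k)); apply/eqP.
Qed.

Lemma schwartzZT_sqnorm (G : Z * T -> R[i]) : schwartzZT G -> (exists z, G z <> 0) ->
  (0 < sqnorm muZT G < +oo)%E.
Proof.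
move=> GS G0; have [i Gi] := fcoef_neq0 GS G0; rewrite -(sqnorm_fcoef GS).
rewrite (counting_like_sqnorm_lty muIc (fcoef_integrable GS)) andbT.
exact: (counting_like_sqnorm_gt0 muIc Gi).
Qed.

Lemma nrm2_gt0 d (Y : measurableType d) (mu : {measure set Y -> \bar R}) (f : Y -> R[i]) :
  (0 < sqnorm mu f < +oo)%E -> 0 < nrm2 mu f.
Proof. by move=> f0; rewrite sqrtr_gt0; exact: fine_gt0. Qed.

                                                             
Lemma nrm2_le_div d (Y : measurableType d) (mu : {measure set Y -> \bar R})
    d' (W : measurableType d') (nu : {measure set W -> \bar R}) (c : Y -> R[i]) (gam : W -> R[i]) X :
  (0 < sqnorm nu gam < +oo)%E -> (sqnorm mu c < +oo)%E -> (0 <= X)%E -> (X < +oo)%E ->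
  (sqnorm mu c * sqnorm nu gam <= X * X)%E ->
  nrm2 mu c <= (nrm2 nu gam)^-1 * fine X.
Proof.
move=> g0 cl X0 Xl; have N0 := nrm2_gt0 g0; have /andP[_ gl] := g0.
rewrite -(@fineK _ X) ?ge0_fin_numE// -(@fineK _ (sqnorm mu c)) ?ge0_fin_numE ?sqnorm_ge0//.
rewrite -(@fineK _ (sqnorm nu gam)) ?ge0_fin_numE ?sqnorm_ge0// -!EFinM lee_fin /= => h.
rewrite mulrC ler_pdivlMr// -ler_sqr ?nnegrE ?mulr_ge0 ?nrm2_ge0 ?fine_ge0//.
by rewrite exprMn !sqr_sqrtr ?fine_ge0 ?sqnorm_ge0// expr2.
Qed.

End final_estimate.

Theorem proposition4p3 (R : realType) (n : nat)
    (g : Zn n -> R[i]) (G : Zn n * Tn R n -> R[i])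
    (gS : schwartzZ g) (g_neq0 : exists k, g k <> 0)
    (GS : schwartzZT G) (G_neq0 : exists z, G z <> 0) :
  exists C : R,
    [/\ 0 < C,
        norm2 g = 1%E -> normLp (muZT R n) 2%:E G = 1%E ->
          C = 1 &
        forall (sigma : (Zn n * Tn R n -> R[i]) -> R[i])
               (g1 g2 : (Zn n -> R[i]) -> R[i]),
          modulZT G 1%E sigma -> modulZ g 1%E g1 -> modulZ g 1%E g2 ->
          (exists s, represented sigma s) /\
          forall s, represented sigma s ->
            let L := locop s (funZ g1) (funZ g2) in
            [/\ locop_converges s (funZ g1) (funZ g2),
                locop_weak s (funZ g1) (funZ g2) L,
                bounded_operator L &
                (opnorm L <=
                 C%:E * (normMZT G 1%E sigma * normMZ g 1%E g1
                         * normMZ g 1%E g2))%E]].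
Proof.
have g0 := schwartzZ_sqnorm gS g_neq0; have G0 := schwartzZT_sqnorm GS G_neq0.
have Ng := nrm2_gt0 g0; have NG := nrm2_gt0 G0.
pose ng := nrm2 (muZ R n) g; pose nG := nrm2 (muZT R n) G.
exists (nG^-1 * ng^-1 * ng^-1); split; first by rewrite !mulr_gt0 ?invr_gt0.
  have /andP[_ gl] := g0; have /andP[_ Gl] := G0.
  rewrite /norm2 normLp2_fin// [X in _ -> X = _ -> _]normLp2_fin// => -[e1] [e2].
  by rewrite /nG /ng /nrm2 e1 e2 !invr1 !mulr1.
move=> sigma g1 g2 ms m1 m2.
have [ci Xl sb] := modulZT_coef GS G_neq0 ms.
have [i1 l1 X1l b1] := modulZ_coef gS g_neq0 m1.
have [i2 l2 X2l b2] := modulZ_coef gS g_neq0 m2.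
have [st _] := ms.
have rep0 := synth_represents st ci.
split; first by exists (synth (dcoef sigma)).
move=> s rep.
have [sm _] := rep; have [sm0 _] := rep0.
have ae := represented_unique rep0 rep.
have si := ae_cintegrable sm ae (cintegrable_synth ci).
have sE : sqnorm (muZT R n) s = sqnorm (muZ R n \x muZ R n)%E (dcoef sigma).
  rewrite -(sqnorm_synth ci); apply: ae_eq_integral => //.
  - exact/measurable_EFinP/measurable_funX/cmeas_cmod.
  - exact/measurable_EFinP/measurable_funX/cmeas_cmod.
  - by apply: filterS ae => z -> _.
have s2 : (sqnorm (muZT R n) s < +oo)%E.
  by rewrite sE; exact: (counting_like_sqnorm_lty (counting_like_ZZ R n) ci).
have X0 d (Y : measurableType d) (mu : {measure set Y -> \bar R}) f : (0 <= normLp mu 1%E f)%E.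
  by rewrite normLp1E; apply: integral_ge0 => x _; rewrite lee_fin cmod_ge0.
have [h1 h2 h3 h4] := locop_bounded sm si s2 i1 i2.
split => //; apply: le_trans h4 _.
rewrite -(@fineK _ (normMZT G 1 sigma)) ?ge0_fin_numE ?X0//.
rewrite -(@fineK _ (normMZ g 1 g1)) ?ge0_fin_numE ?X0//.
rewrite -(@fineK _ (normMZ g 1 g2)) ?ge0_fin_numE ?X0//.
rewrite -!EFinM lee_fin.
rewrite -sE in sb.
have q := nrm2_le_div G0 s2 (X0 _ _ _ _) Xl sb.
have q1 := nrm2_le_div g0 l1 (X0 _ _ _ _) X1l b1.
have q2 := nrm2_le_div g0 l2 (X0 _ _ _ _) X2l b2.
rewrite [leRHS](_ : _ = (nG^-1 * fine (normMZT G 1 sigma)) * (ng^-1 * fine (normMZ g 1 g1)) *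
  (ng^-1 * fine (normMZ g 1 g2))); last by ring.
apply: ler_pM; rewrite ?mulr_ge0 ?nrm2_ge0//.
by apply: ler_pM; rewrite ?nrm2_ge0.
Qed.
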